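(* Let $d\ge 1$ be a fixed integer and let $X(t)$, $t\in[0,1]^d$, be the Gaussian tensor product random field $$X(t)=\sum_{k\in\mathbb{N}^d}\ \prod_{l=1}^d\lambda(k_l)\ \prod_{l=1}^d\phi_{k_l}(t_l)\ \xi_k ,$$ where $(\phi_i)_{i\ge1}$ is an orthonormal system in $L_2([0,1])$, $(\xi_k)_{k\in\mathbb{N}^d}$ are jointly Gaussian non-correlated (hence independent) random variables with zero mean and unit variance, and $(\lambda(i))_{i\ge 1}$ is a sequence of nonnegative numbers satisfying $$\lambda(i)\sim \mu\, i^{-r}(\ln i)^q,\qquad i\to\infty,$$ for some $\mu>0$, $r>1/2$ and $q\in\mathbb{R}$ with $q\ne -r$. Let $\alpha:=q/r$ and $$\beta:=\begin{cases}(d-1)+d\alpha, & \alpha>-1,\\ \alpha, & \alpha<-1.\end{cases}$$ Let $\epsilon>0$ and $\gamma\in(0,1)$, and denote $$v:=\epsilon\left(1+\sqrt{2|\ln\gamma|}\right)^{-1}.$$ Then for some constant $C=C(X)$ there exists a linear approximation algorithm $A$ such that $$\mathbb{P}\big(\|X-AX\|_2>\epsilon\big)\le\gamma$$ and $A$ uses at most $$C\left(v^2|\ln v|^{1-2r(\beta+1)}\right)^{-1/(2r-1)}$$ point values.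
   Context: $\mathbb{N}=\{1,2,\dots\}$; $\|\cdot\|_2$ is the norm of $L_2([0,1]^d)$ with Lebesgue measure. The series defining $X$ is its Karhunen–Loève expansion: $X$ has zero mean and covariance $\prod_{l=1}^d K(s_l,t_l)$, where $K(s,t)=\sum_{i\ge1}\lambda(i)^2\phi_i(s)\phi_i(t)$ is a covariance kernel on $[0,1]$. The sample paths of $X$ are considered as elements of $L_2([0,1]^d)$. A linear approximation algorithm using $n$ point values is a map $Af=\sum_{l=1}^n f(\tau_l)\psi_l$ with fixed non-random points $\tau_l\in[0,1]^d$ and fixed non-random functions $\psi_l\in L_2([0,1]^d)$. The notation $C=C(X)$ means that the constant depends only on the field $X$ (through its distribution).
   Formalization: The bound is proved for |ln v| ≥ δ, with δ>0 arbitrary and C depending on X and δ; as v→1 the stated bound can tend to 0 (e.g. d=1, q=0, r=1), forcing A=0, so no C=C(X) can serve all ε and γ. *)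

(* Defs.v *)
From HB Require Import structures.
From mathcomp Require Import all_boot all_order all_algebra finmap.
From mathcomp Require Import all_classical all_reals all_analysis.
From mathcomp.analysis.showcase Require summability.

Set Implicit Arguments.
Unset Strict Implicit.
Unset Printing Implicit Defensive.

Import Order.TTheory GRing.Theory Num.Theory.
Import numFieldNormedType.Exports.

Local Open Scope classical_set_scope.
Local Open Scope ring_scope.

Section unit_interval.
Variable R : realType.

(* [measurableTypeR R] is R with the Borel sigma-algebra on which
   [lebesgue_measure] lives; its carrier is convertible to R. *)
Definition leb01 : set (measurableTypeR R) -> \bar R :=
  mrestr (@lebesgue_measure R) (measurable_itv `[0, 1]).

HB.instance Definition _ := Measure.on leb01.

Lemma leb01_setT : leb01 setT = 1%E.
Proof.
rewrite /leb01 /mrestr setTI; apply: etrans (lebesgue_measure_itv _) _.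
by rewrite /= lte_fin ltr01 oppr0 adde0.
Qed.

HB.instance Definition _ :=
  @Measure_isProbability.Build _ _ R leb01 leb01_setT.

End unit_interval.

Section unit_cube.
Variable R : realType.
Local Notation pt n := (n.-tuple (measurableTypeR R)).

Definition cube (n : nat) : set (pt n) :=
  [set t | forall l : 'I_n, 0 <= (tnth t l : R) <= 1].

Definition cons_pt (n : nat) (p : measurableTypeR R * pt n) : pt n.+1 :=
  [tuple of p.1 :: p.2].

Lemma measurable_cons_pt n : measurable_fun [set: _] (@cons_pt n).
Proof. by apply: measurable_cons. Qed.

Section cube_step.
Variables (n : nat) (P : probability (pt n) R).

Definition cube_step : set (pt n.+1) -> \bar R :=
  pushforward (@leb01 R \x P)%E (@cons_pt n).

Let cube_step0 : cube_step set0 = 0%E.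
Proof. by rewrite /cube_step /pushforward preimage_set0 measure0. Qed.

Let cube_step_ge0 A : (0 <= cube_step A)%E.
Proof. by rewrite /cube_step /pushforward measure_ge0. Qed.

Let cube_step_sigma_additive : semi_sigma_additive cube_step.
Proof.
pose m : {measure set _ -> \bar R} := (@leb01 R \x P)%E.
move=> F mF tF mUF; rewrite /cube_step /pushforward preimage_bigcup.
apply: (@measure_semi_sigma_additive _ _ _ m).
- by move=> k; rewrite -[X in measurable X]setTI; exact: measurable_cons_pt.
- apply/trivIsetP => /= i j _ _ ij; rewrite -preimage_setI.
  by move/trivIsetP : tF => /(_ _ _ _ _ ij) ->//; rewrite preimage_set0.
- rewrite -preimage_bigcup -[X in measurable X]setTI.
  exact: measurable_cons_pt.
Qed.

HB.instance Definition _ := isMeasure.Build _ _ _ cube_step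
  cube_step0 cube_step_ge0 cube_step_sigma_additive.

Let cube_stepT : cube_step setT = 1%E.
Proof.
by rewrite /cube_step /pushforward preimage_setT; exact: probability_setT.
Qed.

HB.instance Definition _ :=
  @Measure_isProbability.Build _ _ R cube_step cube_stepT.

End cube_step.

(* Lebesgue measure on R^n restricted to [0,1]^n, as an iterated product. *)
Fixpoint lebcube (n : nat) : probability (pt n) R :=
  match n with
  | 0 => \d_([tuple] : pt 0)
  | m.+1 => cube_step (lebcube m)
  end.

Lemma lebcube_box n (A : 'I_n -> set (measurableTypeR R)) :
  (forall l, measurable (A l)) ->
  lebcube n [set t | forall l, A l (tnth t l)] =
  (\prod_(l < n) leb01 (A l))%E.
Proof.
elim: n A => [|n IHn] A mA.
  by rewrite big_ord0 /= diracE mem_set// => -[].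
have mB : measurable [set t : pt n | forall l, A (lift ord0 l) (tnth t l)].
  have -> : [set t : pt n | forall l, A (lift ord0 l) (tnth t l)] =
      \bigcap_(l in [set: 'I_n]) ((tnth (T := measurableTypeR R))^~ l @^-1`
        A (lift ord0 l)).
    by apply/seteqP; split => t /= h l; [move=> _; exact: h | exact: h].
  apply: fin_bigcap_measurable => // l _.
  by rewrite -[X in measurable X]setTI; exact: measurable_tnth.
rewrite big_ord_recl -IHn// -product_measure1E//=.
rewrite /cube_step /pushforward; congr (product_measure1 _ _ _).
apply/seteqP; split => -[x t] /=.
  by move=> h; split=> [|l]; [exact: (h ord0) | move: (h (lift ord0 l)); rewrite tnthS].
by move=> [h0 h] l; case: (unliftP ord0 l) => [j|] ->; rewrite ?tnthS.
Qed.

End unit_cube.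

(* Sequences are indexed from 0: lambda i, phi i, and the coordinates of a
   multi-index k, stand for the terms numbered i + 1 and k_l + 1 in the usual
   notation with indices in {1, 2, ...}. *)
Section tensor_field.
Variable R : realType.

Definition orthonormal_L2_01 (phi : nat -> R -> R) : Prop :=
  (forall i, (phi i : measurableTypeR R -> R) \in Lfun (@leb01 R) 2%:E) /\
  (forall i j, (\int[@leb01 R]_x (phi i x * phi j x)%:E = (i == j)%:R%:E)%E).

Definition kernel_series (lambda : nat -> R) (phi : nat -> R -> R)
    (s t : R) : R^nat :=
  series (fun i => lambda i ^+ 2 * phi i s * phi i t).

Definition multi_index (d : nat) : choiceType := {ffun 'I_d -> nat}.

Definition tensor_coef (d : nat) (lambda : nat -> R) (phi : nat -> R -> R)
    (k : multi_index d) (t : d.-tuple (measurableTypeR R)) : R :=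
  (\prod_(l < d) lambda (k l)) * \prod_(l < d) phi (k l) (tnth t l).

Section probability_space.
Context (disp : measure_display) (Omega : measurableType disp)
  (P : probability Omega R).

(* [normal_prob m 0] is a uniform law in the library, so that the degenerate
   normal law has to be given separately. *)
Definition gaussian_rv (Y : Omega -> R) : Prop :=
  exists m s : R, 0 <= s /\
    forall A : set (measurableTypeR R), measurable A ->
      P (Y @^-1` A) = if s == 0 then \d_m A else normal_prob m s A.

Definition jointly_gaussian (I : choiceType) (xi : I -> Omega -> R) : Prop :=
  forall (J : {fset I}) (a : I -> R),
    gaussian_rv (fun w => \sum_(i <- J) a i * xi i w).

(* The multiple series is summed at each point of the cube in mean square,
   along the net of finite sets of multi-indices. Joint measurability gives a
   meaning to the sample paths X w as measurable functions. *)
Definition is_tensor_field (d : nat) (lambda : nat -> R) (phi : nat -> R -> R)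
    (xi : multi_index d -> {RV P >-> R})
    (X : Omega -> d.-tuple (measurableTypeR R) -> R) : Prop :=
  [/\ jointly_gaussian (fun k => xi k : Omega -> R),
      forall k, ('E_P[xi k] = 0)%E,
      forall k, ('V_P[xi k] = 1)%E,
      forall k k', k != k' -> covariance P (xi k) (xi k') = 0%E &
      measurable_fun setT
        (fun p : Omega * d.-tuple (measurableTypeR R) => X p.1 p.2) /\
      forall t, cube t ->
        (fun J : {fset multi_index d} => ('E_P[fun w =>
            ((X w t - \sum_(k <- J) tensor_coef lambda phi k t * xi k w)
              ^+ 2)%R])%E)
          @ @summability.totally (multi_index d) --> 0%E].

End probability_space.
End tensor_field.

Record linear_algorithm (R : realType) (d : nat) := LinearAlgorithm {
  nb_points : nat;
  node : 'I_nb_points -> d.-tuple (measurableTypeR R);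
  weight : 'I_nb_points -> d.-tuple (measurableTypeR R) -> R;
  node_cube : forall l, cube (node l);
  weight_L2 : forall l, weight l \in Lfun (lebcube R d) 2%:E
}.

Definition apply_algorithm (R : realType) (d : nat) (A : linear_algorithm R d)
    (f : d.-tuple (measurableTypeR R) -> R) :
    d.-tuple (measurableTypeR R) -> R :=
  fun t => \sum_(l < nb_points A) f (node l) * weight l t.

Definition L2_cube_norm (R : realType) (d : nat)
    (f : d.-tuple (measurableTypeR R) -> R) : \bar R :=
  ('N[lebcube R d]_2%:E [EFin \o f])%E.

Definition beta_exponent (R : realType) (d : nat) (alpha : R) : R :=
  if -1 < alpha then (d%:R - 1) + d%:R * alpha else alpha.

(* Main.v *)
From HB Require Import structures.
Require Import Defs.
From mathcomp Require Import all_boot all_order all_algebra finmap.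
From mathcomp Require Import all_classical all_reals all_analysis.
From mathcomp Require Import measurable_realfun ring lra.

(** The rate combines three facts.

    Sampling is as good as projecting, up to a logarithm. Let Y be a process
    that the span of N orthonormal functions approximates with mean square
    error tau, and let T be its total variance, the integral of E Y_t^2.
    Subtracting from Y its best linear prediction from the value Y_x at one
    point x decreases T by the integral over t of E(Y_t Y_x)^2 / E Y_x^2. As
    long as T is at least 2 tau, the N coefficients of Y carry at least half of
    T, and averaging over x yields a point where the decrease is at least
    T / (8 N) ([exists_pivot]). Since prediction from Y_x acts on the
    coefficients as a contraction, the approximation with error tau persists,
    so the step can be repeated: n points bring T below
    max (2 tau, (1 - 1 / (8 N))^n T_0) ([greedy]), and n of the order of
    N ln (1 / tau) is enough. The predictions only involve values of the
    process at the chosen points, hence form an algorithm of the required kind.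

    The error is concentrated. The residual is a mean square limit of Gaussian
    variables at each point, so that E exp (Y_t^2 / (96 E Y_t^2)) is bounded by
    an absolute constant; Jensen's inequality with the weights E Y_t^2 gives
    P (||Y||^2 > s) <= exp (5 - s / (96 e)) whenever T < e ([L2_tail]). With
    e = v^2 / (5 * 96) and s = eps^2 the right-hand side is at most gamma
    ([tail_le_gamma]). It remains to reach T < v^2 / (5 * 96) with few points.

    The spectrum is counted by hyperbolic crosses. One has lambda(i)^2 <=
    C h(i)^(2 r) with h(i) = (1 + ln i)^alpha / i for indices starting at 1.
    Take for the orthonormal functions those whose multi-index lies in the
    union over l of the sets where k_j <= x for j != l and
    k_l <= x prod_(j != l) h(k_j). With s = max (1 + alpha, 0), there are
    O (x (ln x)^((d - 1) s)) of them ([card_cross]), and the squared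
    coefficients outside sum up to O (x^(1 - 2 r) (ln x)^(2 q + (d - 1) s))
    ([tail_cross]). Both bounds rest on sum_(i <= x) h(i) = O ((ln x)^s), where
    alpha != -1 excludes an iterated logarithm. Making the tail of order v^2
    fixes x, of the order of
    v^(-2 / (2 r - 1)) |ln v|^((2 q + (d - 1) s) / (2 r - 1)), and the greedy
    construction multiplies the size of the cross by |ln v|. The resulting
    power of |ln v| is (2 r (beta + 1) - 1) / (2 r - 1), because beta is
    alpha + (d - 1) s in both of its cases ([suited_small]).

    When v is not small, but bounded and with |ln v| bounded away from 0, the
    claimed bound is bounded below, so that a fixed number of points will do;
    and no point at all is needed once v exceeds a multiple of the total
    standard deviation of X ([exists_suited]). *)

Set Implicit Arguments.
Unset Strict Implicit.
Unset Printing Implicit Defensive.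
Import Order.TTheory GRing.Theory Num.Theory.
Import numFieldNormedType.Exports.
Local Open Scope classical_set_scope.
Local Open Scope ring_scope.

(** * Square-integrable functions *)

Section L2.
Context (disp : measure_display) (T : measurableType disp) (R : realType).
Variable mu : {measure set T -> \bar R}.
Implicit Types f g h : T -> R.

Definition sqint f := measurable_fun setT f /\
  mu.-integrable setT (EFin \o (fun x => f x ^+ 2)).

Definition dot f g : R := \int[mu]_x (f x * g x).

Lemma le_integrable_EFin f g : measurable_fun setT f ->
  mu.-integrable setT (EFin \o g) -> (forall x, `|f x| <= g x) ->
  mu.-integrable setT (EFin \o f).
Proof.
move=> mf ig fg; apply: (le_integrable _ _ _ ig) => //.
  exact/measurable_EFinP.
by move=> x _ /=; rewrite lee_fin (le_trans (fg x))// ler_norm.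
Qed.

(** By 2 |f g| <= f^2 + g^2. *)
Lemma integrable_mul f g : sqint f -> sqint g ->
  mu.-integrable setT (EFin \o (fun x => f x * g x)).
Proof.
move=> [mf intf] [mg intg].
apply: (@le_integrable_EFin _ (fun x => f x ^+ 2 + g x ^+ 2)).
- exact: measurable_funM.
- have := integrableD measurableT intf intg.
  by apply: eq_integrable => // x _.
- move=> x; rewrite normrM -(real_normK (num_real (f x))) -(real_normK (num_real (g x))).
  have := sqr_ge0 (`|f x| - `|g x|); have := normr_ge0 (f x); have := normr_ge0 (g x).
  nra.
Qed.

Lemma sqint0 : sqint (fun _ => 0).
Proof.
split=> //; apply: eq_integrable (integrable0 _ _) => // x _ /=.
by rewrite expr0n.
Qed.

Lemma sqintZ a f : sqint f -> sqint (fun x => a * f x).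
Proof.
move=> [mf intf]; split; first exact: measurable_funM.
have := integrableZl measurableT (a ^+ 2) intf.
by apply: eq_integrable => // x _ /=; rewrite exprMn EFinM.
Qed.

Lemma sqintD f g : sqint f -> sqint g -> sqint (fun x => f x + g x).
Proof.
move=> lf lg; have intfg := integrable_mul lf lg.
move: lf lg => [mf intf] [mg intg]; split; first exact: measurable_funD.
have := integrableD measurableT (integrableD measurableT intf intg)
  (integrableZl measurableT 2 intfg).
apply: eq_integrable => // x _ /=; rewrite -EFinD; congr EFin.
ring.
Qed.

Lemma sqintB f g : sqint f -> sqint g -> sqint (fun x => f x - g x).
Proof.
move=> lf lg; have := sqintD lf (sqintZ (-1) lg).
by under eq_fun do rewrite mulN1r.
Qed.

Lemma sqint_sum (I : Type) (s : seq I) (F : I -> T -> R) :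
  (forall i, sqint (F i)) -> sqint (fun x => \sum_(i <- s) F i x).
Proof.
move=> lF; elim: s => [|i s IHs].
  by under eq_fun do rewrite big_nil; exact: sqint0.
by under eq_fun do rewrite big_cons; exact: sqintD.
Qed.

Lemma dotC f g : dot f g = dot g f.
Proof. by rewrite /dot; under eq_Rintegral do rewrite mulrC. Qed.

Lemma dotZl a f g : sqint f -> sqint g -> dot (fun x => a * f x) g = a * dot f g.
Proof.
move=> lf lg; rewrite /dot; under eq_Rintegral do rewrite -mulrA.
exact/RintegralZl/integrable_mul.
Qed.

Lemma dotDl f g h : sqint f -> sqint g -> sqint h ->
  dot (fun x => f x + g x) h = dot f h + dot g h.
Proof.
move=> lf lg lh; rewrite /dot; under eq_Rintegral do rewrite mulrDl.
by rewrite RintegralD//; exact: integrable_mul.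
Qed.

Lemma dotBl f g h : sqint f -> sqint g -> sqint h ->
  dot (fun x => f x - g x) h = dot f h - dot g h.
Proof.
move=> lf lg lh; rewrite /dot; under eq_Rintegral do rewrite mulrBl.
by rewrite RintegralB//; exact: integrable_mul.
Qed.

Lemma dotBr f g h : sqint f -> sqint g -> sqint h ->
  dot h (fun x => f x - g x) = dot h f - dot h g.
Proof. by move=> lf lg lh; rewrite dotC dotBl// ![dot h _]dotC. Qed.

Lemma dotZr a f g : sqint f -> sqint g -> dot g (fun x => a * f x) = a * dot g f.
Proof. by move=> lf lg; rewrite dotC dotZl// dotC. Qed.

Lemma dot0l f : dot (fun=> 0) f = 0.
Proof.
rewrite /dot; under eq_Rintegral do rewrite mul0r.
by rewrite /Rintegral integral0.
Qed.

Lemma dot_suml (I : Type) (s : seq I) (F : I -> T -> R) h :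
  (forall i, sqint (F i)) -> sqint h ->
  dot (fun x => \sum_(i <- s) F i x) h = \sum_(i <- s) dot (F i) h.
Proof.
move=> lF lh; elim: s => [|i s IHs].
  by under [X in dot X]eq_fun do rewrite big_nil; rewrite big_nil dot0l.
under [X in dot X]eq_fun do rewrite big_cons.
by rewrite dotDl ?big_cons ?IHs//; exact: sqint_sum.
Qed.

Lemma dot_sumr (I : Type) (s : seq I) (F : I -> T -> R) h :
  (forall i, sqint (F i)) -> sqint h ->
  dot h (fun x => \sum_(i <- s) F i x) = \sum_(i <- s) dot h (F i).
Proof.
move=> lF lh; rewrite dotC dot_suml//.
by apply: eq_bigr => i _; rewrite dotC.
Qed.

Lemma dot_ge0 f : 0 <= dot f f.
Proof. by apply: Rintegral_ge0 => x _; rewrite -expr2 sqr_ge0. Qed.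

Lemma EFin_dot f : sqint f -> (dot f f)%:E = (\int[mu]_x (f x ^+ 2)%:E)%E.
Proof.
move=> [_ intf]; rewrite /dot /Rintegral.
under eq_integral do rewrite -expr2.
by rewrite fineK//; exact: integrable_fin_num.
Qed.

Lemma dot_subK f g : sqint f -> sqint g ->
  dot (fun x => f x - g x) (fun x => f x - g x) =
  dot f f - 2 * dot f g + dot g g.
Proof.
move=> lf lg; have lfg := sqintB lf lg.
by rewrite dotBl// !dotBr// (dotC g f); ring.
Qed.

(** If g has norm zero, then dot f f - 2 a dot f g, the squared norm of
    f - a g, would be negative for some a unless dot f g = 0. *)
Lemma dot_eq0 f g : sqint f -> sqint g -> dot g g = 0 -> dot f g = 0.
Proof.
move=> lf lg g0; set c := dot f g.
have H a : 0 <= dot f f - 2 * a * c.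
  have := dot_ge0 (fun x => f x - a * g x).
  rewrite dot_subK//; last exact: sqintZ.
  rewrite dotZr// dotZl ?dotZr ?g0//; last exact: sqintZ.
  by rewrite !mulr0 addr0 mulrA.
apply/eqP/negPn/negP => c0.
have := H ((dot f f + 1) / (2 * c)).
have -> : 2 * ((dot f f + 1) / (2 * c)) * c = dot f f + 1 by field.
lra.
Qed.

Lemma cauchy_schwarz f g : sqint f -> sqint g ->
  dot f g ^+ 2 <= dot f f * dot g g.
Proof.
move=> lf lg; have [g0|g0] := eqVneq (dot g g) 0.
  by rewrite dot_eq0// g0 mulr0 expr0n.
have gp : 0 < dot g g by rewrite lt_neqAle eq_sym g0 dot_ge0.
set a := dot f g / dot g g.
have := dot_ge0 (fun x => f x - a * g x).
rewrite dot_subK//; last exact: sqintZ.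
rewrite dotZr// dotZl ?dotZr//; last exact: sqintZ.
have -> : dot f f - 2 * (a * dot f g) + a * (a * dot g g) =
          (dot f f * dot g g - dot f g ^+ 2) / dot g g by rewrite /a; field.
by rewrite pmulr_lge0 ?invr_gt0// subr_ge0.
Qed.

(** The variance left after the best linear prediction of f from g: both
    the contraction property and the gain of a greedy step are instances. *)
Lemma dot_projB f g : sqint f -> sqint g -> dot g g != 0 ->
  dot (fun x => f x - dot f g / dot g g * g x)
      (fun x => f x - dot f g / dot g g * g x) =
  dot f f - dot f g ^+ 2 / dot g g.
Proof.
move=> lf lg g0; rewrite dot_subK//; last exact: sqintZ.
rewrite dotZr// dotZl ?dotZr//; last exact: sqintZ.
by field.
Qed.

Section bessel.
Variables (I : finType) (u : I -> T -> R).
Hypothesis lu : forall i, sqint (u i).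
Hypothesis ou : forall i j, dot (u i) (u j) = (i == j)%:R.

Lemma bessel f : sqint f -> \sum_i dot f (u i) ^+ 2 <= dot f f.
Proof.
move=> lf; pose p x := \sum_i dot f (u i) * u i x.
have lp : sqint p by apply: sqint_sum => i; exact: sqintZ.
have dfp : dot f p = \sum_i dot f (u i) ^+ 2.
  rewrite dot_sumr//; last by move=> i; exact: sqintZ.
  by apply: eq_bigr => i _; rewrite dotZr// expr2.
have dpp : dot p p = \sum_i dot f (u i) ^+ 2.
  rewrite [LHS]dot_suml//; last by move=> i; exact: sqintZ.
  apply: eq_bigr => i _; rewrite dotZl// [dot (u i) _]dotC dot_suml//; last first.
    by move=> j; exact: sqintZ.
  rewrite (bigD1 i)//= dotZl// ou eqxx mulr1 big1 ?addr0 ?expr2// => j ji.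
  by rewrite dotZl// ou (negbTE ji) mulr0.
have := dot_ge0 (fun x => f x - p x).
rewrite dot_subK// dfp dpp; lra.
Qed.
End bessel.

End L2.

Lemma sqint_cst1 d (X : measurableType d) (R : realType) (mu : probability X R) :
  sqint mu (cst 1).
Proof.
split=> //; rewrite (_ : EFin \o _ = EFin \o cst (1 : R)).
  exact: finite_measure_integrable_cst.
by apply/funext => x /=; rewrite expr1n.
Qed.

(** * Square-integrable processes *)

(** Fubini's theorem produces partial integrals with extended real
    values, which are finite only almost everywhere; this passes to real
    values. *)
Lemma fine_integrable d (T : measurableType d) (R : realType)
    (mu : {measure set T -> \bar R}) (g : T -> \bar R) :
  mu.-integrable setT g -> mu.-integrable setT (EFin \o (fine \o g)) /\
  (\int[mu]_x (fine (g x))%:E = \int[mu]_x g x)%E.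
Proof.
move=> ig; have mg := measurable_int mu ig.
have mfg : measurable_fun setT (EFin \o (fine \o g)).
  apply/measurable_EFinP.
  by apply: measurableT_comp => //; exact: measurable_fine.
split.
  apply: (le_integrable _ _ _ ig) => // x _ /=.
  by case: (g x) => [r||] //=; rewrite normr0 leey.
apply: ae_eq_integral => //.
have := integrable_ae measurableT ig.
by apply: filterS => x /(_ I) gx _; rewrite fineK.
Qed.

Section process.
Context (d1 d2 : measure_display) (Omega : measurableType d1)
  (T : measurableType d2) (R : realType).
Variables (P : probability Omega R) (Q : probability T R).
Implicit Types (Y : Omega -> T -> R) (u : T -> R) (h : Omega -> R).

Local Notation PQ := (P \x Q)%E.
Local Notation unc Y := (fun p : Omega * T => Y p.1 p.2).
Local Notation ten h u := (fun p : Omega * T => h p.1 * u p.2).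

Lemma Rintegral12 (f : Omega * T -> R) : PQ.-integrable setT (EFin \o f) ->
  P.-integrable setT (EFin \o (fun w => \int[Q]_t f (w, t))) /\
  \int[P]_w (\int[Q]_t f (w, t)) = \int[PQ]_p f p.
Proof.
move=> intf; have [] := fine_integrable (integrable_fubini_F intf).
rewrite /fubini_F /Rintegral => i1 i2; split=> //.
by rewrite i2 -(integral12_prod_meas1 intf).
Qed.

Lemma integrable_fubini_G (f : Omega * T -> \bar R) : PQ.-integrable setT f ->
  Q.-integrable setT (fubini_G P f).
Proof.
move=> intf; have mf := measurable_int _ intf; apply/integrableP; split.
  exact: measurable_fubini_G intf.
apply: (le_lt_trans _ ((@integrable21ltyP _ _ _ _ _ P Q _ mf).1 intf)).
apply: ge0_le_integral => //.
- by apply: measurableT_comp => //; exact: measurable_fubini_G intf.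
- apply: (measurable_fun_fubini_tonelli_G (abse \o f)) => //=.
  exact: measurableT_comp.
- move=> t _; apply: le_abse_integral => //.
  exact: (measurableT_comp mf (measurable_pair2 t)).
Qed.

Lemma Rintegral21 (f : Omega * T -> R) : PQ.-integrable setT (EFin \o f) ->
  Q.-integrable setT (EFin \o (fun t => \int[P]_w f (w, t))) /\
  \int[Q]_t (\int[P]_w f (w, t)) = \int[PQ]_p f p.
Proof.
move=> intf; have [] := fine_integrable (integrable_fubini_G intf).
rewrite /fubini_G /Rintegral => i1 i2; split=> //.
by rewrite i2 -(integral21_prod_meas1 intf).
Qed.

Lemma sqint_ten h u : sqint P h -> sqint Q u -> sqint PQ (ten h u).
Proof.
move=> lh lu; have mten : measurable_fun setT (ten h u).
  apply: measurable_funM; apply: measurableT_comp => //; first exact: lh.1.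
  exact: lu.1.
split=> //; apply/integrable12ltyP.
  by apply/measurable_EFinP; exact: measurable_funX.
have mh2 : measurable_fun setT (EFin \o (fun w => h w ^+ 2)).
  by apply/measurable_EFinP; apply: measurable_funX; exact: lh.1.
have mu2 : measurable_fun setT (EFin \o (fun t => u t ^+ 2)).
  by apply/measurable_EFinP; apply: measurable_funX; exact: lu.1.
have E w : (\int[Q]_t `|((h w * u t) ^+ 2)%:E| =
    (h w ^+ 2)%:E * \int[Q]_t (u t ^+ 2)%:E)%E.
  rewrite -ge0_integralZl//=; last 2 first.
  - by move=> t _; rewrite lee_fin sqr_ge0.
  - by rewrite lee_fin sqr_ge0.
  apply: eq_integral => t _.
  by rewrite ger0_norm ?sqr_ge0// exprMn EFinM.
under eq_integral do rewrite /= E.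
rewrite ge0_integralZr//=.
- by rewrite -!EFin_dot// -EFinM ltry.
- by move=> t _; rewrite lee_fin sqr_ge0.
- by apply: integral_ge0 => t _; rewrite lee_fin sqr_ge0.
Qed.

(** Joint square integrability controls almost every [Y^~ t] only; the
    second clause is needed to use the value at a chosen point. *)
Definition sqproc Y := sqint PQ (unc Y) /\ forall t, sqint P (Y^~ t).

Lemma sqproc_ten h u : sqint P h -> sqint Q u -> sqproc (fun w t => h w * u t).
Proof.
move=> lh lu; split; first exact: sqint_ten.
by move=> t; under eq_fun do rewrite mulrC; exact: sqintZ.
Qed.

Lemma sqprocB Y Z : sqproc Y -> sqproc Z -> sqproc (fun w t => Y w t - Z w t).
Proof.
move=> [lY lYt] [lZ lZt]; split; first exact: sqintB.
by move=> t; exact: sqintB.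
Qed.

Lemma sqproc_sum (I : finType) (F : I -> Omega -> T -> R) :
  (forall i, sqproc (F i)) -> sqproc (fun w t => \sum_i F i w t).
Proof.
move=> lF; split; first by apply: sqint_sum => i; exact: (lF i).1.
by move=> t; apply: sqint_sum => i; exact: (lF i).2.
Qed.

(** The trace of the covariance operator of Y. *)
Definition trace Y := dot PQ (unc Y) (unc Y).

Lemma traceE Y : sqproc Y ->
  Q.-integrable setT (EFin \o (fun t => dot P (Y^~ t) (Y^~ t))) /\
  trace Y = \int[Q]_t dot P (Y^~ t) (Y^~ t).
Proof.
move=> [lY lYt]; have [] := Rintegral21 (integrable_mul lY lY).
by move=> i1 i2; split=> //; rewrite /trace /dot i2.
Qed.

(** The random coefficient of Y along u. *)
Definition coef Y u w : R := \int[Q]_t (Y w t * u t).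

Section coef.
Variables (Y : Omega -> T -> R) (u : T -> R).
Hypotheses (lY : sqproc Y) (lu : sqint Q u) (u1 : dot Q u u = 1).

Lemma measurable_slice w : measurable_fun setT (Y w).
Proof. by exact: (measurableT_comp lY.1.1 (measurable_pair1 w)). Qed.

Lemma coef_integrable : PQ.-integrable setT (EFin \o (fun p => Y p.1 p.2 * u p.2)).
Proof.
have := integrable_mul lY.1 (sqint_ten (sqint_cst1 P) lu).
by apply: eq_integrable => // p _ /=; rewrite mul1r.
Qed.

Lemma measurable_coef : measurable_fun setT (coef Y u).
Proof.
have [+ _] := Rintegral12 coef_integrable.
by move=> /(measurable_int P)/measurable_EFinP.
Qed.

(** Stated in the extended reals, since the path [Y w] may fail to be
    square integrable for exceptional w. *)
Lemma sqr_coef_le w : ((coef Y u w ^+ 2)%:E <= \int[Q]_t (Y w t ^+ 2)%:E)%E.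
Proof.
have mYw := measurable_slice w.
have i0 : (0 <= \int[Q]_t (Y w t ^+ 2)%:E)%E.
  by apply: integral_ge0 => t _; rewrite lee_fin sqr_ge0.
have [ifin|] := boolP (\int[Q]_t (Y w t ^+ 2)%:E < +oo)%E; last first.
  by rewrite -leNgt leye_eq => /eqP ->; rewrite leey.
have lYw : sqint Q (Y w).
  split=> //; apply/integrableP; split.
    by apply/measurable_EFinP; exact: measurable_funX.
  by under eq_integral do rewrite /= ger0_norm ?sqr_ge0//.
by rewrite -EFin_dot// lee_fin (le_trans (cauchy_schwarz lYw lu))// u1 mulr1.
Qed.

Lemma sqint_coef : sqint P (coef Y u).
Proof.
have mc := measurable_coef; split=> //; apply/integrableP; split.
  by apply/measurable_EFinP; exact: measurable_funX.
have mY2 : measurable_fun setT (fun p : Omega * T => (Y p.1 p.2 ^+ 2)%:E).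
  by apply/measurable_EFinP; apply: measurable_funX; exact: lY.1.1.
apply: (@le_lt_trans _ _ (\int[P]_w \int[Q]_t (Y w t ^+ 2)%:E)%E).
  apply: ge0_le_integral => //.
  - apply: measurableT_comp => //.
    by apply/measurable_EFinP; exact: measurable_funX.
  - apply: (measurable_fun_fubini_tonelli_F
      (fun p : Omega * T => (Y p.1 p.2 ^+ 2)%:E)) => //.
    by move=> p; rewrite lee_fin sqr_ge0.
  - by move=> w _; rewrite /= ger0_norm ?sqr_ge0// sqr_coef_le.
rewrite -(@fubini_tonelli1 _ _ _ _ _ P Q (fun p : Omega * T => (Y p.1 p.2 ^+ 2)%:E))//.
  by rewrite -(EFin_dot lY.1) ltry.
by move=> p; rewrite lee_fin sqr_ge0.
Qed.

(** Expectation and integration over T commute: the covariance of a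
    coefficient with h is the coefficient of the covariance with h. *)
Lemma dot_coef h : sqint P h ->
  [/\ Q.-integrable setT (EFin \o (fun t => dot P (Y^~ t) h * u t)),
   \int[Q]_t (dot P (Y^~ t) h * u t) = dot P (coef Y u) h &
   dot PQ (unc Y) (ten h u) = dot P (coef Y u) h].
Proof.
move=> lh; have intf := integrable_mul lY.1 (sqint_ten lh lu).
have dE : dot PQ (unc Y) (ten h u) = dot P (coef Y u) h.
  have [i1 e1] := Rintegral12 intf.
  rewrite {1}/dot -e1 /dot {1 3}/Rintegral; congr fine; apply: ae_eq_integral => //.
  - by have /measurable_int := i1.
  - apply/measurable_EFinP; apply: measurable_funM; last exact: lh.1.
    exact: measurable_coef.
  - have := ae_integrable1 coef_integrable.
    apply: filterS => w /= iw _; congr EFin; rewrite /coef -RintegralZr//.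
    by apply: eq_Rintegral => t _; ring.
have [i2 e2] := Rintegral21 intf.
have E t : \int[P]_w (Y w t * (h w * u t)) = dot P (Y^~ t) h * u t.
  rewrite /dot -RintegralZr//; last exact: integrable_mul (lY.2 t) lh.
  by apply: eq_Rintegral => w _; rewrite mulrA.
split=> //.
- by apply: eq_integrable i2 => // t _ /=; rewrite E.
- by rewrite -dE /dot -e2; apply: eq_Rintegral => t _; rewrite E.
Qed.

End coef.

End process.

(** * Greedy prediction from point values *)

Section greedy.
Context (d1 d2 : measure_display) (Omega : measurableType d1)
  (T : measurableType d2) (R : realType).
Variables (P : probability Omega R) (Q : probability T R).
Implicit Types (Y : Omega -> T -> R) (h : Omega -> R).

Lemma sqint_cov Y h : sqproc P Q Y -> sqint P h ->
  sqint Q (fun t => dot P (Y^~ t) h).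
Proof.
move=> lY lh; have [i1 _ _] := dot_coef lY (sqint_cst1 Q) lh.
have mk : measurable_fun setT (fun t => dot P (Y^~ t) h).
  have /measurable_int/measurable_EFinP := i1.
  by under eq_fun do rewrite mulr1.
split=> //.
have [iK _] := traceE lY.
apply: (@le_integrable_EFin _ _ _ _ _ (fun t => dot P h h * dot P (Y^~ t) (Y^~ t))).
- exact: measurable_funX.
- have := integrableZl measurableT (dot P h h) iK.
  by apply: eq_integrable => // t _.
- move=> t; rewrite ger0_norm ?sqr_ge0// mulrC.
  exact: (cauchy_schwarz (lY.2 t) lh).
Qed.

Variables (I : finType) (u : I -> T -> R).
Hypotheses (lu : forall i, sqint Q (u i))
  (ou : forall i j, dot Q (u i) (u j) = (i == j)%:R).
Variables (S : set T) (tau : R).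

Let u1 i : dot Q (u i) (u i) = 1. Proof. by rewrite ou eqxx. Qed.

(** The coefficients g are left free, because a greedy step changes those
    that are available for its residual. *)
Definition approx Y := exists2 g : I -> Omega -> R, (forall i, sqint P (g i)) &
  trace P Q (fun w t => Y w t - \sum_i g i w * u i t) <= tau.

(** The optimal coefficients of Y are [coef Q Y (u i)], and any other
    choice has a larger error; hence the error with these is at most tau,
    and by orthonormality it is the trace minus the sum of their
    variances. *)
Lemma captured Y : sqproc P Q Y -> approx Y ->
  trace P Q Y - tau <= \sum_i dot P (coef Q Y (u i)) (coef Q Y (u i)).
Proof.
move=> lY [g lg]; rewrite /trace.
have lgu i : sqint (P \x Q)%E (fun p : Omega * T => g i p.1 * u i p.2).
  exact: sqint_ten.
have lZ i := sqint_coef lY (lu i) (u1 i).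
rewrite (@dot_subK _ _ _ _ (fun p => Y p.1 p.2)
  (fun p => \sum_i g i p.1 * u i p.2)) ?lY.1//; last 2 first.
- exact: lY.1.
- by exact: sqint_sum.
rewrite dot_sumr//; last exact: lY.1.
have dYg i : dot (P \x Q)%E (fun p => Y p.1 p.2) (fun p => g i p.1 * u i p.2) =
    dot P (coef Q Y (u i)) (g i) by have [_ _] := dot_coef lY (lu i) (lg i).
under eq_bigr do rewrite dYg.
rewrite (_ : dot _ (fun p => \sum_i g i p.1 * u i p.2) _ =
    \sum_i dot P (g i) (g i)); last first.
  rewrite dot_suml//; last exact: sqint_sum.
  apply: eq_bigr => i _; rewrite dot_sumr//.
  have E j : dot (P \x Q)%E (fun p => g i p.1 * u i p.2)
       (fun p => g j p.1 * u j p.2) = dot P (g i) (g j) * dot Q (u i) (u j).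
    rewrite {1}/dot -(Rintegral12 (integrable_mul (lgu i) (lgu j))).2.
    rewrite /= {1}/dot -RintegralZr//; last exact: integrable_mul.
    apply: eq_Rintegral => w _.
    rewrite -RintegralZl//; last exact: integrable_mul.
    by apply: eq_Rintegral => t _; ring.
  rewrite (bigD1 i)//= E ou eqxx mulr1 big1 ?addr0// => j ji.
  by rewrite E ou eq_sym (negbTE ji) mulr0.
move=> le_tau; rewrite lerBlDr -lerBlDl (le_trans _ le_tau)//.
rewrite -addrA lerD2l mulr_sumr -sumrN -!sumrN -big_split/=.
apply: ler_sum => i _.
have := dot_ge0 P (fun w => coef Q Y (u i) w - g i w).
rewrite dot_subK//; lra.
Qed.

Lemma sqr_sum_le (a : I -> R) : (\sum_i a i) ^+ 2 <= #|I|%:R * \sum_i a i ^+ 2.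
Proof.
rewrite expr2 mulr_suml; under eq_bigr do rewrite mulr_sumr.
apply: (@le_trans _ _ (\sum_i \sum_j (a i ^+ 2 + a j ^+ 2) / 2)).
  apply: ler_sum => i _; apply: ler_sum => j _.
  have := sqr_ge0 (a i - a j); nra.
have cst_sum (c : R) : \sum_(i : I) c = #|I|%:R * c.
  by rewrite sumr_const mulr_natl.
under eq_bigr do rewrite -mulr_suml big_split/= cst_sum.
rewrite -mulr_suml big_split/= cst_sum -mulr_sumr.
lra.
Qed.

(** The weight of Y_x in the best linear prediction of Y_t from Y_x. *)
Definition pivot Y x t := dot P (Y^~ t) (Y^~ x) / dot P (Y^~ x) (Y^~ x).

(** Write T for the trace, Z_i for the coefficients of Y and
    z_i(x) = E (Y_x Z_i). If the inequality failed for every x, integrating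
    over x would bound the sum of ||z_i||^2 by T^2 / (8 N). But E Z_i^2 is
    the coefficient of z_i along u_i, so the sum of the (E Z_i^2)^2 is no
    larger, and the sum of the N numbers E Z_i^2 is at most T / sqrt 8 by
    Cauchy-Schwarz. By [captured] it is at least T / 2. *)
Lemma exists_pivot Y : sqproc P Q Y -> approx Y -> 0 < trace P Q Y ->
  2 * tau <= trace P Q Y ->
  exists x, trace P Q Y / (8 * #|I|%:R) * dot P (Y^~ x) (Y^~ x) <
    \sum_i dot P (Y^~ x) (coef Q Y (u i)) ^+ 2.
Proof.
move=> lY aY T0 Ttau; have lZ i := sqint_coef lY (lu i) (u1 i).
set rho := _ / _.
apply/not_existsP => H.
have {}H x : \sum_i dot P (Y^~ x) (coef Q Y (u i)) ^+ 2 <=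
    rho * dot P (Y^~ x) (Y^~ x) by rewrite leNgt; apply/negP; exact: H.
pose e i := dot P (coef Q Y (u i)) (coef Q Y (u i)).
have lz i : sqint Q (fun x => dot P (Y^~ x) (coef Q Y (u i))).
  exact: sqint_cov.
have [iK KE] := traceE lY.
have le1 : \sum_i dot Q (fun x => dot P (Y^~ x) (coef Q Y (u i)))
   (fun x => dot P (Y^~ x) (coef Q Y (u i))) <= rho * trace P Q Y.
  rewrite KE -RintegralZl//.
  have -> : \sum_i dot Q (fun x => dot P (Y^~ x) (coef Q Y (u i)))
     (fun x => dot P (Y^~ x) (coef Q Y (u i))) =
     \int[Q]_x \sum_i dot P (Y^~ x) (coef Q Y (u i)) ^+ 2.
    apply/esym; rewrite /Rintegral.
    under eq_integral do rewrite -sumEFin.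
    rewrite integral_sum//; last by move=> i; exact: (lz i).2.
    rewrite -[RHS]/(fine (EFin _)) -sumEFin; congr fine; apply: eq_bigr => i _.
    by rewrite EFin_dot.
  apply: le_Rintegral => //.
  - rewrite (_ : EFin \o _ = fun x =>
      (\sum_i (dot P (Y^~ x) (coef Q Y (u i)) ^+ 2)%:E)%E); last first.
      by apply/funext => x /=; rewrite sumEFin.
    by apply: integrable_sum => // i _; exact: (lz i).2.
  - have := integrableZl measurableT rho iK.
    by apply: eq_integrable => // t _.
have le2 i : e i ^+ 2 <= dot Q (fun x => dot P (Y^~ x) (coef Q Y (u i)))
   (fun x => dot P (Y^~ x) (coef Q Y (u i))).
  have [_ + _] := dot_coef lY (lu i) (lZ i).
  rewrite -/(dot Q (fun x => dot P (Y^~ x) (coef Q Y (u i))) (u i)) -/(e i) => <-.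
  by rewrite (le_trans (cauchy_schwarz _ _))// u1 mulr1.
have le3 := captured lY aY.
have le4 := sqr_sum_le e.
have le5 : \sum_i e i ^+ 2 <= rho * trace P Q Y.
  by apply: le_trans le1; apply: ler_sum.
have I0 : 0 < #|I|%:R :> R.
  rewrite ltr0n lt0n; apply/negP => /eqP I0.
  have : \sum_i e i = 0 by apply: big1 => i _; have := fintype0 i I0.
  by move: le3; rewrite -/e => le3 e0; lra.
have : #|I|%:R * (\sum_i e i ^+ 2) <= #|I|%:R * (rho * trace P Q Y).
  by rewrite ler_pM2l.
have -> : #|I|%:R * (rho * trace P Q Y) = trace P Q Y ^+ 2 / 8.
  by rewrite /rho; field; rewrite gt_eqF.
move=> le6; have le7 := le_trans le4 le6.
have : (trace P Q Y / 2) ^+ 2 <= (\sum_i e i) ^+ 2.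
  by apply: lerXn2r; rewrite ?nnegrE; rewrite -/(e _) in le3 *; lra.
nra.
Qed.

Lemma cov_eq0 Y x : sqproc P Q Y -> dot P (Y^~ x) (Y^~ x) = 0 ->
  \sum_i dot P (Y^~ x) (coef Q Y (u i)) ^+ 2 = 0.
Proof.
move=> lY Y0; apply: big1 => i _; rewrite dotC dot_eq0 ?expr0n//.
  by have := sqint_coef lY (lu i) (u1 i).
exact: lY.2.
Qed.

(** The trace decreases by the squared norm of the function
    t -> E (Y_t Y_x), divided by E Y_x^2. Bessel's inequality bounds this
    norm below by the coefficients of that function along the u_i, which
    are what [exists_pivot] makes large. *)
Lemma greedy_step Y : sqproc P Q Y -> approx Y ->
  (forall t, ~ S t -> forall w, Y w t = 0) -> 0 < trace P Q Y ->
  2 * tau <= trace P Q Y ->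
  exists x, [/\ S x, sqint Q (pivot Y x), forall t, ~ S t -> pivot Y x t = 0 &
    let Y' := fun w t => Y w t - Y w x * pivot Y x t in
    [/\ sqproc P Q Y', approx Y' &
        trace P Q Y' <= (1 - (8 * #|I|%:R)^-1) * trace P Q Y]].
Proof.
move=> lY aY YS T0 Ttau; have [x zx] := exists_pivot lY aY T0 Ttau.
have K0 : 0 < dot P (Y^~ x) (Y^~ x).
  rewrite lt_neqAle dot_ge0 andbT eq_sym; apply/negP => /eqP Yx0.
  by move: zx; rewrite cov_eq0// Yx0 mulr0 ltxx.
have Kn0 : dot P (Y^~ x) (Y^~ x) != 0 by rewrite gt_eqF.
have lYx := lY.2 x.
have lcov : sqint Q (fun t => dot P (Y^~ t) (Y^~ x)) by exact: sqint_cov.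
have lpiv : sqint Q (pivot Y x).
  have := sqintZ (dot P (Y^~ x) (Y^~ x))^-1 lcov.
  by rewrite /pivot; under eq_fun do rewrite mulrC.
have lY' : sqproc P Q (fun w t => Y w t - Y w x * pivot Y x t).
  exact: (sqprocB lY (sqproc_ten lYx lpiv)).
exists x; split=> //.
- apply: contrapT => Sx; move: K0; rewrite [X in dot _ X](_ : _ = fun=> 0).
    by rewrite dot0l ltxx.
  by apply/funext => w; exact: YS.
- move=> t St; rewrite /pivot [X in dot _ X](_ : _ = fun=> 0) ?dot0l ?mul0r//.
  by apply/funext => w; exact: YS.
have slice t : (fun w => Y w t - Y w x * pivot Y x t) =
    (fun w => Y w t - dot P (Y^~ t) (Y^~ x) / dot P (Y^~ x) (Y^~ x) * Y w x).
  by apply/funext => w; rewrite /pivot [Y w x * _]mulrC.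
split=> //.
- have [g lg le_tau] := aY.
  (* subtract from each g_i its own prediction from Y_x: the error process
     is then replaced by its projection, a contraction for every t *)
  pose c i := dot P (g i) (Y^~ x) / dot P (Y^~ x) (Y^~ x).
  have lcx i : sqint P (fun w => c i * Y w x) by exact: sqintZ.
  exists (fun i w => g i w - c i * Y w x).
    by move=> i; exact: sqintB.
  have lg' i : sqint P (fun w => g i w - c i * Y w x) by exact: sqintB.
  have lE : sqproc P Q (fun w t => Y w t - \sum_i g i w * u i t).
    apply: (sqprocB lY).
    apply: (@sqproc_sum _ _ _ _ _ P Q _ (fun i w t => g i w * u i t)) => i.
    exact: sqproc_ten.
  have lE' : sqproc P Q (fun w t => Y w t - Y w x * pivot Y x t -
      \sum_i (g i w - c i * Y w x) * u i t).
    apply: (sqprocB lY').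
    apply: (@sqproc_sum _ _ _ _ _ P Q _
      (fun i w t => (g i w - c i * Y w x) * u i t)) => i.
    exact: sqproc_ten.
  apply: le_trans le_tau; rewrite (traceE lE).2 (traceE lE').2.
  apply: le_Rintegral => //.
  + exact: (traceE lE').1.
  + exact: (traceE lE).1.
  move=> t _; pose e w := Y w t - \sum_i g i w * u i t.
  have le := lE.2 t.
  rewrite [X in dot _ X X <= _](_ : _ = fun w =>
    e w - dot P e (Y^~ x) / dot P (Y^~ x) (Y^~ x) * Y w x); last first.
    have lgu i : sqint P (fun w => g i w * u i t).
      by under eq_fun do rewrite mulrC; exact: sqintZ.
    have -> : dot P e (Y^~ x) =
        dot P (Y^~ t) (Y^~ x) - \sum_i u i t * dot P (g i) (Y^~ x).
      rewrite dotBl//; last 2 first.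
      - exact: lY.2.
      - exact: sqint_sum.
      rewrite dot_suml//; congr (_ - _); apply: eq_bigr => i _.
      by rewrite -dotZl//; under eq_fun do rewrite mulrC.
    apply/funext => w; rewrite /e /pivot /c.
    under eq_bigr do rewrite mulrBl.
    rewrite sumrB.
    have -> : \sum_i dot P (g i) (Y^~ x) / dot P (Y^~ x) (Y^~ x) * Y w x * u i t =
       (\sum_i u i t * dot P (g i) (Y^~ x)) / dot P (Y^~ x) (Y^~ x) * Y w x.
      by rewrite !mulr_suml; apply: eq_bigr => i _; field.
    by field.
  rewrite dot_projB// lerBlDr lerDl divr_ge0 ?sqr_ge0//.
  exact: ltW.
- have [iK KE] := traceE lY.
  have E t : dot P (fun w => Y w t - Y w x * pivot Y x t)
      (fun w => Y w t - Y w x * pivot Y x t) = dot P (Y^~ t) (Y^~ t) -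
      dot P (Y^~ t) (Y^~ x) ^+ 2 * (dot P (Y^~ x) (Y^~ x))^-1.
    by rewrite slice dot_projB//; exact: lY.2.
  rewrite (traceE lY').2; under eq_Rintegral do rewrite E.
  have ik2 := lcov.2.
  rewrite RintegralB//; last first.
    have := integrableZr measurableT (dot P (Y^~ x) (Y^~ x))^-1 ik2.
    by apply: eq_integrable => // t _.
  rewrite RintegralZr// -KE mulrBl mul1r lerD2l lerN2.
  rewrite ler_pdivlMr//.
  have := bessel lu ou lcov.
  have -> : dot Q (fun t => dot P (Y^~ t) (Y^~ x)) (fun t => dot P (Y^~ t) (Y^~ x))
     = \int[Q]_t (dot P (Y^~ t) (Y^~ x) ^+ 2).
    by apply: eq_Rintegral => t _; rewrite expr2.
  apply: le_trans; apply: ltW; rewrite mulrC in zx.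
  rewrite mulrC [_ ^-1 * _]mulrC; apply: (lt_le_trans zx).
  apply: ler_sum => i _.
  have -> : dot Q (fun t => dot P (Y^~ t) (Y^~ x)) (u i) =
      dot P (coef Q Y (u i)) (Y^~ x) by have [] := dot_coef lY (lu i) lYx.
  by rewrite dotC.
Qed.

(** The pairs are a node and its weight, so that the sum is a linear
    algorithm using [size s] values of X. *)
Definition residual (X : Omega -> T -> R) (s : seq (T * (T -> R))) w t :=
  X w t - \sum_(p <- s) X w p.1 * p.2 t.

(** Predicting the residual, rather than X, from a value at x still
    gives an algorithm based on values of X: the correction of the residual
    at x is distributed over the weights of the earlier nodes. *)
Lemma residual_cons X s x (psi : T -> R) :
  residual X ((x, psi) :: [seq (p.1, fun t => p.2 t - p.2 x * psi t) | p <- s]) =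
  fun w t => residual X s w t - residual X s w x * psi t.
Proof.
apply/funext => w; apply/funext => t; rewrite /residual big_cons big_map/=.
under eq_bigr do rewrite mulrBr.
rewrite sumrB mulrBl mulr_suml.
under [X in _ - (_ + (_ - X))]eq_bigr do rewrite mulrA.
ring.
Qed.

(** Iterate [greedy_step] until the trace falls below 2 tau. Processes
    vanishing outside S keep doing so, whence nodes in S. *)
Theorem greedy (X : Omega -> T -> R) (n : nat) : sqproc P Q X -> approx X ->
  (forall t, ~ S t -> forall w, X w t = 0) ->
  exists s : seq (T * (T -> R)), [/\ (size s <= n)%N,
    List.Forall (fun p => S p.1 /\ sqint Q p.2) s,
    sqproc P Q (residual X s) &
    trace P Q (residual X s) <=
      Num.max (2 * tau) ((1 - (8 * #|I|%:R)^-1) ^+ n * trace P Q X)].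
Proof.
move=> lX aX XS; set rho := 1 - _.
have rho0 : 0 <= rho.
  rewrite /rho subr_ge0; have [->|I0] := posnP #|I|.
    by rewrite mulr0 invr0.
  have : 1 <= #|I|%:R :> R by rewrite ler1n.
  by move=> I1; rewrite invf_le1; lra.
suff [s [sn sS ls [as_ sO le_s]]] : exists s : seq (T * (T -> R)),
   [/\ (size s <= n)%N,
    List.Forall (fun p => S p.1 /\ (sqint Q p.2 /\ forall t, ~ S t -> p.2 t = 0)) s,
    sqproc P Q (residual X s) &
    [/\ approx (residual X s),
     forall t, ~ S t -> forall w, residual X s w t = 0 &
    trace P Q (residual X s) <= Num.max (2 * tau) (rho ^+ n * trace P Q X)]].
  exists s; split=> //.
  by apply: List.Forall_impl sS => p [? []].
elim: n => [|n [s [sn sS ls [as_ sO le_s]]]].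
  have rX : residual X [::] = X.
    by apply/funext => w; apply/funext => t; rewrite /residual big_nil subr0.
  exists [::]; rewrite rX; split=> //; split=> //.
  by rewrite expr0 mul1r le_max lexx orbT.
have [small|/negP big] := boolP ((trace P Q (residual X s) <= 0) ||
    (trace P Q (residual X s) <= 2 * tau)).
  exists s; split=> //; first exact: leqW.
  split=> //; rewrite le_max; case/orP: small => [T0|->//].
  apply/orP; right.
  by rewrite (le_trans T0)// mulr_ge0 ?exprn_ge0//; exact: dot_ge0.
have {big}[T0 Ttau] : 0 < trace P Q (residual X s) /\
    2 * tau < trace P Q (residual X s).
  by move/negP: big; rewrite negb_or -!ltNge => /andP[].
have [x [Sx lpsi psi0 [lY' aY' leY']]] := greedy_step ls as_ sO T0 (ltW Ttau).
set psi := pivot _ _ in lpsi psi0 lY' aY' leY'.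
exists ((x, psi) :: [seq (p.1, fun t => p.2 t - p.2 x * psi t) | p <- s]).
rewrite residual_cons; split=> //.
- by rewrite /= size_map ltnS.
- apply: List.Forall_cons => //.
  elim: (s) sS => [|p s' IH] /= H; first exact: List.Forall_nil.
  apply: List.Forall_cons; last by apply: IH; inversion H.
  have {H}[Sp [lp p0]] := List.Forall_inv H; split=> //; split.
    by apply: sqintB => //; exact: sqintZ.
  by move=> t St /=; rewrite p0// psi0// mulr0 subr0.
- split=> //.
    by move=> t St w; rewrite psi0// sO// mulr0 subr0.
  apply: (le_trans leY').
  have le2 : trace P Q (residual X s) <= rho ^+ n * trace P Q X.
    by move: le_s; rewrite le_max leNgt Ttau.
  by rewrite le_max exprS -mulrA [X in _ || X]ler_wpM2l ?orbT.
Qed.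

End greedy.

(** * Exponential moments of squared Gaussian variables *)

Lemma measurable_EFinM d (T : measurableType d) (R : realType) (f g : T -> R) :
  measurable_fun setT f -> measurable_fun setT g ->
  measurable_fun setT (fun x => (f x)%:E * (g x)%:E)%E.
Proof.
by move=> mf mg; apply: (@emeasurable_funM _ _ _ _ (EFin \o f) (EFin \o g));
  exact/measurable_EFinP.
Qed.

Section density.
Context d (T : measurableType d) (R : realType).
Variables (nu mu : {measure set T -> \bar R}) (g : T -> R).
Hypotheses (mg : measurable_fun setT g) (g0 : forall x, 0 <= g x).
Hypothesis nuE : forall A, measurable A ->
  nu A = (\int[mu]_(x in A) (g x)%:E)%E.

Import HBNNSimple.

(** For simple functions this is the defining property of the density,
    by linearity. *)
Let density_nnsfun (h : {nnsfun T >-> R}) :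
  (\int[nu]_x (h x)%:E = \int[mu]_x ((h x)%:E * (g x)%:E))%E.
Proof.
under [LHS]eq_integral do rewrite fimfunE -fsumEFin//.
rewrite [LHS]ge0_integral_fsum//; last 2 first.
  - by move=> r; exact/measurable_EFinP/measurableT_comp.
  - by move=> n x _; rewrite EFinM nnfun_muleindic_ge0.
pose F (r : R) x := ((r * \1_(h @^-1` [set r]) x)%:E * (g x)%:E)%E.
have mF r : measurable_fun setT (F r).
  apply: measurable_EFinM => //.
  by apply: measurable_funM => //; exact: measurable_indic.
have F0 r x : (0 <= F r x)%E.
  by rewrite /F EFinM mule_ge0// ?nnfun_muleindic_ge0// lee_fin.
transitivity (\int[mu]_x (\sum_(r \in range h) F r x)%E)%E; last first.
  apply: eq_integral => x _; rewrite fimfunE -fsumEFin// ge0_mule_fsuml//.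
  by move=> r; rewrite EFinM nnfun_muleindic_ge0.
rewrite ge0_integral_fsum//.
apply: eq_fsbigr => r /[!inE] -[t _ htr].
have mr : measurable (h @^-1` [set r]) by [].
have r0 : 0 <= r by rewrite -htr.
under eq_integral do rewrite EFinM.
under [RHS]eq_integral do rewrite /F EFinM -muleA.
rewrite !ge0_integralZl//; last 3 first.
- by apply: measurable_EFinM => //; exact: measurable_indic.
- by move=> x _; rewrite mule_ge0// lee_fin.
- by apply/measurable_EFinP; exact: measurable_indic.
rewrite integral_indic// setIT nuE//; congr (_ * _)%E.
rewrite integral_mkcond; apply: eq_integral => x _; rewrite patchE indicE.
by case: ifPn; rewrite ?mul1e ?mul0e.
Qed.

Lemma ge0_integral_density (f : T -> \bar R) : measurable_fun setT f ->
  (forall x, 0 <= f x)%E ->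
  (\int[nu]_x f x = \int[mu]_x (f x * (g x)%:E))%E.
Proof.
move=> mf f0.
pose f_ := nnsfun_approx measurableT mf.
transitivity (lim (\int[nu]_x (f_ n x)%:E @[n --> \oo])%E).
  rewrite -monotone_convergence//=.
  - apply: eq_integral => ? /[!inE] xD; apply/esym/cvg_lim => //=.
    exact: cvg_nnsfun_approx.
  - by move=> n; exact/measurable_EFinP/measurable_funTS.
  - by move=> n ? _; rewrite lee_fin.
  - by move=> ? _ ? ? mn; rewrite lee_fin; exact/lefP/nd_nnsfun_approx.
rewrite [RHS](_ : _ = lim
    (\int[mu]_x ((f_ n x)%:E * (g x)%:E) @[n --> \oo])%E); last first.
  rewrite -monotone_convergence//=.
  - apply: eq_integral => x /[!inE] xD.
    rewrite muleC (_ : limn _ = ((g x)%:E * limn (fun n => (f_ n x)%:E))%E).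
      by congr (_ * _)%E; apply/esym/cvg_lim => //; exact: cvg_nnsfun_approx.
    rewrite -limeMl//.
      by congr (limn _); apply/funext => n; rewrite muleC.
    by apply/cvg_ex; exists (f x); exact: cvg_nnsfun_approx.
  - by move=> n; exact: measurable_EFinM.
  - by move=> n ? _; rewrite mule_ge0// lee_fin.
  - move=> x _ m n mn; rewrite -!EFinM lee_fin ler_wpM2r//.
    exact/lefP/nd_nnsfun_approx.
by apply: congr_lim; apply/funext => n /=; exact: density_nnsfun.
Qed.

End density.

Section gaussian.
Variable R : realType.
Local Notation leb := (@lebesgue_measure R).

(** Completing the square: multiplying a normal density by exp (b x^2)
    gives a multiple of another normal density. *)
Lemma expR_sqr_normal_pdf (m s b x : R) : 0 < s -> 0 < 1 - 2 * b * s ^+ 2 ->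
  expR (b * x ^+ 2) * normal_pdf m s x =
  (expR (b * m ^+ 2 / (1 - 2 * b * s ^+ 2)) / Num.sqrt (1 - 2 * b * s ^+ 2)) *
  normal_pdf (m / (1 - 2 * b * s ^+ 2)) (s / Num.sqrt (1 - 2 * b * s ^+ 2)) x.
Proof.
move=> s0; set D := 1 - _ => D0.
have qD0 : 0 < Num.sqrt D by rewrite sqrtr_gt0.
have s'0 : 0 < s / Num.sqrt D by rewrite divr_gt0.
rewrite !normal_pdfE ?gt_eqF// /normal_peak /normal_fun.
have sD : (s / Num.sqrt D) ^+ 2 = s ^+ 2 / D.
  by rewrite expr_div_n sqr_sqrtr ?ltW.
rewrite !sD.
have -> : Num.sqrt (s ^+ 2 / D * pi *+ 2) =
   Num.sqrt (s ^+ 2 * pi *+ 2) / Num.sqrt D.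
  rewrite -sqrtrV ?ltW// -sqrtrM; last by rewrite mulrn_wge0// mulr_ge0 ?sqr_ge0 ?pi_ge0.
  by rewrite mulrnAl [s ^+ 2 / D * pi]mulrAC.
have p0 : 0 < Num.sqrt (s ^+ 2 * pi *+ 2).
  by rewrite sqrtr_gt0 mulrn_wgt0// mulr_gt0 ?pi_gt0// exprn_gt0.
move: (Num.sqrt (s ^+ 2 * pi *+ 2)) p0 => p p0.
have expE : b * x ^+ 2 + - (x - m) ^+ 2 / (s ^+ 2 *+ 2) =
    b * m ^+ 2 / D + - (x - m / D) ^+ 2 / (s ^+ 2 / D *+ 2).
  rewrite -(mulr_natr (s ^+ 2)) -(mulr_natr (s ^+ 2 / D)) /D; field.
  by rewrite !gt_eqF.
rewrite mulrCA -expRD expE expRD.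
move: (expR _) (expR _) (Num.sqrt D) qD0 => u v q q0.
by field; rewrite !gt_eqF.
Qed.

Lemma integral_expR_sqr_normal (m s b : R) : 0 < s -> 0 < 1 - 2 * b * s ^+ 2 ->
  (\int[normal_prob m s]_x (expR (b * x ^+ 2))%:E =
  (expR (b * m ^+ 2 / (1 - 2 * b * s ^+ 2)) / Num.sqrt (1 - 2 * b * s ^+ 2))%:E)%E.
Proof.
move=> s0 D0.
rewrite (@ge0_integral_density _ _ _ (normal_prob m s) leb (normal_pdf m s))//.
- under eq_integral do rewrite -EFinM expR_sqr_normal_pdf// EFinM.
  rewrite ge0_integralZl//=.
  + by rewrite integral_normal_pdf mule1.
  + by apply/measurable_EFinP; exact: measurable_normal_pdf.
  + by move=> x _; rewrite lee_fin normal_pdf_ge0.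
- exact: measurable_normal_pdf.
- exact: normal_pdf_ge0.
- apply/measurable_EFinP; apply: measurableT_comp => //.
  by apply: measurable_funM => //; exact: measurable_funX.
Qed.

End gaussian.

(** Monotone convergence of the truncations; it makes the integrals of
    unbounded exponentials accessible to mean square limits. *)
Lemma integral_le_trunc d (T : measurableType d) (R : realType)
    (mu : {measure set T -> \bar R}) (f : T -> R) (C : \bar R) :
  measurable_fun setT f -> (forall x, 0 <= f x) ->
  (forall n : nat, (\int[mu]_x (Num.min (f x) n%:R)%:E <= C)%E) ->
  (\int[mu]_x (f x)%:E <= C)%E.
Proof.
move=> mf f0 fC; pose g (n : nat) x := (Num.min (f x) n%:R)%:E.
have gf x : limn (g ^~ x) = (f x)%:E.
  apply/cvg_lim => //; apply: cvg_near_cst.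
  near=> n; rewrite /g; congr EFin; apply/min_idPl.
  by near: n; exact: nbhs_infty_ger.
have mg n : measurable_fun setT (g n).
  by apply/measurable_EFinP; exact: measurable_minr.
have g0 n x : setT x -> (0 <= g n x)%E by move=> _; rewrite lee_fin le_min f0 ler0n.
have ndg x : setT x -> nondecreasing_seq (g ^~ x).
  by move=> _ m n mn; rewrite lee_fin le_min !ge_min lexx ler_nat mn orbT.
under eq_integral do rewrite -gf.
rewrite monotone_convergence//; apply: lime_le; last exact: nearW.
apply: ereal_nondecreasing_is_cvgn => m n mn; apply: ge0_le_integral => //.
- by move=> x _; exact: g0.
- by move=> x _; exact: ndg.
Unshelve. all: by end_near. Qed.

Section gaussian_moment.
Context (d : measure_display) (Omega : measurableType d) (R : realType).
Variable P : probability Omega R.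

(** Change of variables when the law is known through its values on sets and
    Y is a bare measurable function. *)
Let ge0_integral_law (Y : Omega -> R) (nu : {measure set (measurableTypeR R) -> \bar R})
   (f : R -> R) :
  measurable_fun setT Y ->
  (forall A : set (measurableTypeR R), measurable A -> P (Y @^-1` A) = nu A) ->
  measurable_fun setT f -> (forall x, 0 <= f x) ->
  (\int[P]_w (f (Y w))%:E = \int[nu]_x (f x)%:E)%E.
Proof.
move=> mY law mf f0.
pose mixin := isMeasurableFun.Build _ _ _ (measurableTypeR R) Y mY.
pose Y' : {RV P >-> measurableTypeR R} := HB.pack Y mixin.
rewrite -[LHS](@ge0_integral_distribution _ _ _ _ _ P Y' (fun x => (f x)%:E))//.
- by apply: eq_measure_integral => A mA _; exact: law.
- by apply/measurable_EFinP.
Qed.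

(** A variance bound alone controls the exponential moment, the mean
    m being arbitrary: w >= E Y^2 bounds the parameters of the law by
    s^2 <= 3 w and m^2 <= 8 w, and then the explicit formula applies. These
    bounds are derived from the same formula at a negative exponent, which
    avoids computing second moments. *)
Lemma gaussian_expR_sqr (Y : Omega -> R) (w : R) : measurable_fun setT Y ->
  gaussian_rv P Y -> 0 < w -> (\int[P]_x (Y x ^+ 2)%:E <= w%:E)%E ->
  (\int[P]_x (expR ((12 * w)^-1 * Y x ^+ 2))%:E <= (expR 3)%:E)%E.
Proof.
move=> mY [m [s [s0 law]]] w0 Yw.
have mexp (b : R) : measurable_fun setT (fun x : R => expR (b * x ^+ 2)).
  apply: measurableT_comp => //.
  by apply: measurable_funM => //; exact: measurable_funX.
have mexpE (b : R) : measurable_fun setT (EFin \o (fun x : R => expR (b * x ^+ 2))).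
  exact/measurable_EFinP.
have msq : measurable_fun setT (fun x : R => x ^+ 2) by exact: measurable_funX.
have msqr : measurable_fun setT (EFin \o (fun x : R => x ^+ 2)).
  exact/measurable_EFinP.
have [s_eq0|sn0] := eqVneq s 0.
  have lawd (A : set (measurableTypeR R)) :
      measurable A -> P (Y @^-1` A) = \d_(m : measurableTypeR R) A.
    by move=> mA; rewrite law// s_eq0 eqxx.
  rewrite (ge0_integral_law (nu := \d_(m : measurableTypeR R)) mY lawd (mexp _)) => [|x]; last exact: expR_ge0.
  rewrite integral_dirac; [|by []|exact: mexpE].
  rewrite diracT mul1e lee_fin ler_expR.
  move: Yw; rewrite (ge0_integral_law (nu := \d_(m : measurableTypeR R)) mY lawd msq (fun x => sqr_ge0 x)).
  rewrite integral_dirac; [|by []|exact: msqr].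
  rewrite diracT mul1e lee_fin => mw.
  rewrite mulrC ler_pdivrMr ?mulr_gt0//; lra.
have {s0}s0 : 0 < s by rewrite lt_neqAle eq_sym sn0.
have lawn (A : set (measurableTypeR R)) : measurable A -> P (Y @^-1` A) = normal_prob m s A.
  by move=> mA; rewrite law// (negbTE sn0).
have E (b : R) : 0 < 1 - 2 * b * s ^+ 2 ->
  (\int[P]_x (expR (b * Y x ^+ 2))%:E =
  (expR (b * m ^+ 2 / (1 - 2 * b * s ^+ 2)) / Num.sqrt (1 - 2 * b * s ^+ 2))%:E)%E.
  move=> D0; rewrite (ge0_integral_law (nu := normal_prob m s) mY lawn (mexp _)).
    exact: integral_expR_sqr_normal.
  by move=> x; rewrite expR_ge0.
pose b := (2 * w)^-1; have b0 : 0 < b by rewrite invr_gt0 mulr_gt0.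
pose D := 1 + 2 * b * s ^+ 2.
have s2 : 0 < s ^+ 2 by rewrite exprn_gt0.
have D1 : 1 <= D by rewrite /D lerDl !mulr_ge0 ?ltW.
have qD1 : 1 <= Num.sqrt D by rewrite -sqrtr1 ler_wsqrtr.
have D0 : 0 < 1 - 2 * - b * s ^+ 2 by rewrite mulrN mulNr opprK (lt_le_trans ltr01).
have mY2 : measurable_fun setT (fun x => Y x ^+ 2) by exact: measurable_funX.
(* exp (- b Y^2) >= 1 - b Y^2 has expectation at least 1/2, and neither
   factor of its closed form exceeds 1 *)
have half : 1 / 2 <= expR (- (b * m ^+ 2 / D)) / Num.sqrt D.
  have := E (- b) D0; rewrite mulrN !mulNr opprK -/D => Eb.
  have : (1%:E <= \int[P]_x ((expR (- (b * Y x ^+ 2)))%:E + b%:E * (Y x ^+ 2)%:E))%E.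
    rewrite -[leLHS]mul1e -(probability_setT P) -integral_cst//.
    apply: ge0_le_integral => //.
    - apply: emeasurable_funD.
        apply/measurable_EFinP; apply: measurableT_comp => //.
        by apply: measurableT_comp => //; exact: measurable_funM.
      by apply: measurable_funeM; exact/measurable_EFinP.
    - move=> x _; rewrite [leLHS](_ : _ = 1%:E); last exact: probability_setT.
      rewrite /= -EFinM -EFinD lee_fin; have := expR_ge1Dx (- (b * Y x ^+ 2)); lra.
  rewrite (@ge0_integralD _ _ _ P setT measurableT
    (fun x => (expR (- (b * Y x ^+ 2)))%:E) (fun x => b%:E * (Y x ^+ 2)%:E)%E);
    last 4 first.
  - by move=> x _; rewrite lee_fin expR_ge0.
  - apply/measurable_EFinP; apply: measurableT_comp => //.
    by apply: measurableT_comp => //; exact: measurable_funM.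
  - by move=> x _; rewrite -EFinM lee_fin mulr_ge0 ?sqr_ge0// ltW.
  - by apply: measurable_funeM; exact/measurable_EFinP.
  rewrite ge0_integralZl//; last 3 first.
  - exact/measurable_EFinP.
  - by move=> x _; rewrite lee_fin sqr_ge0.
  - by rewrite lee_fin ltW.
  under eq_integral do rewrite -mulNr.
  rewrite Eb => le1.
  have : (1%:E <= (expR (- (b * m ^+ 2 / D)) / Num.sqrt D)%:E + b%:E * w%:E)%E.
    apply: (le_trans le1); rewrite leeD2l//.
    by rewrite lee_pmul2l// lte_fin.
  rewrite -EFinM -EFinD lee_fin.
  have -> : b * w = 1 / 2 by rewrite /b; field; rewrite gt_eqF.
  lra.
have qD0 : 0 < Num.sqrt D by lra.
have y0 : 0 <= b * m ^+ 2 / D.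
  apply: divr_ge0; last by lra.
  by apply: mulr_ge0; [exact: ltW|exact: sqr_ge0].
have D4 : D <= 4.
  have : 1 / 2 <= (Num.sqrt D)^-1.
    apply: (le_trans half); rewrite ler_piMl ?invr_ge0 ?(ltW qD0)//.
    by rewrite -[X in _ <= X]expR0 ler_expR oppr_le0.
  rewrite mul1r lef_pV2 ?posrE ?ltr0n// => qD2.
  have -> : D = Num.sqrt D ^+ 2 by rewrite sqr_sqrtr//; lra.
  nra.
have bm : b * m ^+ 2 <= 4.
  have h2 : 1 / 2 <= expR (- (b * m ^+ 2 / D)).
    apply: (le_trans half); rewrite ler_piMr ?expR_ge0// invf_le1//.
  have h3 : b * m ^+ 2 / D <= 1.
    move: h2; rewrite expRN mul1r lef_pV2 ?posrE ?expR_gt0// => h2.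
    have := expR_ge1Dx (b * m ^+ 2 / D); lra.
  move: h3; rewrite ler_pdivrMr; lra.
have bE : b = w^-1 / 2 by rewrite /b; field; rewrite gt_eqF.
have sw : s ^+ 2 <= 3 * w.
  have : s ^+ 2 / w <= 3 by move: D4; rewrite /D bE; lra.
  by rewrite ler_pdivrMr.
have mw : m ^+ 2 <= 8 * w.
  have : m ^+ 2 / w <= 8 by move: bm; rewrite bE; lra.
  by rewrite ler_pdivrMr.
set a := (12 * w)^-1.
have a0 : 0 < a by rewrite invr_gt0 mulr_gt0.
have as_ : a * s ^+ 2 <= 1 / 4.
  rewrite /a mulrC ler_pdivrMr ?mulr_gt0//; lra.
have am : a * m ^+ 2 <= 2 / 3.
  rewrite /a mulrC ler_pdivrMr ?mulr_gt0//; lra.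
have D' : 1 / 2 <= 1 - 2 * a * s ^+ 2 by lra.
rewrite E; last by lra.
rewrite lee_fin ler_pdivrMr; last by rewrite sqrtr_gt0; lra.
have q2 : 1 / 2 <= Num.sqrt (1 - 2 * a * s ^+ 2).
  rewrite -[leLHS]ger0_norm; last by lra.
  rewrite -sqrtr_sqr ler_wsqrtr//; lra.
have e1 : 2 <= expR 1 :> R by have := expR_ge1Dx (1 : R); lra.
have -> : expR 3 = expR 2 * expR 1 :> R by rewrite -expRD; congr expR; lra.
apply: (@le_trans _ _ (expR 2)).
  rewrite ler_expR ler_pdivrMr; last by lra.
  lra.
rewrite -[leRHS]mulrA ler_peMr ?expR_ge0//; nra.
Qed.

(** Such a limit is Gaussian, but only its exponential moment matters,
    and this one passes to the limit directly. *)
Definition gaussian_limit (Y : Omega -> R) := forall e : R, 0 < e ->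
  exists2 V, gaussian_rv P V /\ sqint P V &
    dot P (fun x => Y x - V x) (fun x => Y x - V x) <= e.

(** Let V be Gaussian and close to Y. Where (Y - V)^2 <= w, the
    exponential of Y^2 is at most a constant times that of 2 V^2; elsewhere a
    truncated exponential is at most a multiple of (Y - V)^2, which has a
    small integral. *)
Lemma gaussian_limit_expR_sqr (Y : Omega -> R) (w : R) : sqint P Y ->
  gaussian_limit Y -> 0 < w -> dot P Y Y <= w ->
  (\int[P]_x (expR ((96 * w)^-1 * Y x ^+ 2))%:E <= (expR 5)%:E)%E.
Proof.
move=> lY gY w0 Yw; pose f x := expR ((96 * w)^-1 * Y x ^+ 2).
have mf : measurable_fun setT f.
  apply: measurableT_comp => //; apply: measurable_funM => //.
  by apply: measurable_funX; exact: lY.1.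
have f0 x : 0 <= f x by exact: expR_ge0.
apply: (integral_le_trunc mf f0) => n.
(* makes the contribution of the bad event at most 1 *)
pose M : R := n%:R + 1; have M0 : 0 < M by rewrite ltr_wpDl.
have [V [gV lV] YV] := gY (w / M) (divr_gt0 w0 M0).
have wM : w / M <= w by rewrite ler_pdivrMr// ler_peMr ?(ltW w0)// /M lerDr.
pose e x := Y x - V x; have le : sqint P e by exact: sqintB.
have VV : (\int[P]_x (V x ^+ 2)%:E <= (4 * w)%:E)%E.
  rewrite -EFin_dot// lee_fin.
  apply: (@le_trans _ _ (2 * dot P Y Y + 2 * dot P e e)).
    have -> : V = fun x => Y x - e x by apply/funext => x; rewrite /e; ring.
    rewrite dot_subK//.
    have := dot_ge0 P (fun x => Y x - (-1) * e x).
    rewrite dot_subK//; last exact: sqintZ.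
    by rewrite dotZr// dotZl ?dotZr//; [lra|exact: sqintZ].
  have : dot P e e <= w / M by [].
  lra.
pose fV x := expR ((12 * (4 * w))^-1 * V x ^+ 2).
have EV : (\int[P]_x (fV x)%:E <= (expR 3)%:E)%E.
  by apply: gaussian_expR_sqr VV => //; [exact: lV.1|rewrite mulr_gt0].
have mfV : measurable_fun setT fV.
  apply: measurableT_comp => //; apply: measurable_funM => //.
  by apply: measurable_funX; exact: lV.1.
have fV0 x : 0 <= fV x by exact: expR_ge0.
have Mw0 : 0 <= M / w by rewrite divr_ge0 ?ltW.
(* 1 / (12 (4 w)) is twice 1 / (96 w), to allow for Y^2 <= 2 V^2 + 2 w *)
have pw x : Num.min (f x) n%:R <= expR 1 * fV x + M / w * e x ^+ 2.
  have [small|large] := leP (e x ^+ 2) w.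
    rewrite ge_min; apply/orP; left; rewrite -[leLHS]addr0 lerD//; last first.
      by rewrite mulr_ge0 ?sqr_ge0.
    rewrite /f /fV -expRD ler_expR.
    have -> : Y x = V x + e x by rewrite /e; ring.
    have le2 : (V x + e x) ^+ 2 <= 2 * V x ^+ 2 + 2 * w.
      have := sqr_ge0 (V x - e x); nra.
    have -> : (96 * w)^-1 = w^-1 / 96 by field; rewrite gt_eqF.
    have -> : (12 * (4 * w))^-1 = w^-1 / 48 by field; rewrite gt_eqF.
    have wi : 0 <= w^-1 by rewrite invr_ge0 ltW.
    have := ler_wpM2l wi le2.
    rewrite mulrDr [w^-1 * (2 * w)]mulrCA mulVf ?gt_eqF// mulrCA; lra.
  rewrite ge_min; apply/orP; right; rewrite -[leLHS]add0r lerD//.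
    by rewrite mulr_ge0 ?expR_ge0.
  apply: (@le_trans _ _ (M / w * w)); first by rewrite divfK ?gt_eqF// /M; lra.
  by rewrite ler_wpM2l// ltW.
have me2 : measurable_fun setT (EFin \o (fun x => e x ^+ 2)).
  by apply/measurable_EFinP; apply: measurable_funX; exact: le.1.
have mfV' : measurable_fun setT (EFin \o fV) by exact/measurable_EFinP.
apply: (@le_trans _ _ (\int[P]_x ((expR 1)%:E * (fV x)%:E + (M / w)%:E * (e x ^+ 2)%:E))%E).
  apply: ge0_le_integral => //.
  - by move=> x _; rewrite lee_fin le_min f0 ler0n.
  - by apply/measurable_EFinP; exact: measurable_minr.
  - by apply: emeasurable_funD; exact: measurable_funeM.
  - by move=> x _; rewrite -!EFinM -EFinD lee_fin.
rewrite ge0_integralD//; last 4 first.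
- by move=> x _; rewrite -EFinM lee_fin mulr_ge0 ?expR_ge0.
- exact: measurable_funeM.
- by move=> x _; rewrite -EFinM lee_fin mulr_ge0 ?sqr_ge0.
- exact: measurable_funeM.
rewrite !ge0_integralZl//; try by
  move=> *; rewrite lee_fin ?sqr_ge0 ?fV0 ?expR_ge0.
rewrite -EFin_dot//.
apply: (@le_trans _ _ ((expR 1)%:E * (expR 3)%:E + (M / w)%:E * (w / M)%:E)%E).
  apply: leeD; first by rewrite lee_wpmul2l// lee_fin expR_ge0.
  by rewrite lee_wpmul2l// lee_fin.
rewrite -!EFinM -EFinD lee_fin -expRD.
have -> : M / w * (w / M) = 1 by field; rewrite !gt_eqF.
have -> : expR 5 = expR 1 * expR (1 + 3) :> R by rewrite -expRD; congr expR; lra.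
have e1 : 2 <= expR 1 :> R by have := expR_ge1Dx (1 : R); lra.
have e4 : 1 <= expR (1 + 3) :> R by have := expR_ge1Dx (1 + 3 : R); lra.
nra.
Qed.

End gaussian_moment.

(** * Concentration of the norm of a Gaussian process *)

Section tail.
Context (d1 d2 : measure_display) (Omega : measurableType d1)
  (T : measurableType d2) (R : realType).
Variables (P : probability Omega R) (Q : probability T R).

(** With v(t) = E Y_t^2 + eta, where eta makes the total mass of v equal
    to e, the average of exp (Y_t^2 / (96 v(t))) with weights v / e has
    expectation at most exp 5. By convexity this average is at least
    exp (||Y||^2 / (96 e)), so the claim is Markov's inequality. Adding eta
    keeps v positive where Y_t vanishes. *)
Lemma L2_tail (Y : Omega -> T -> R) (e s : R) : sqproc P Q Y -> 0 <= s ->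
  (forall t, gaussian_limit P (Y^~ t)) -> trace P Q Y < e ->
  (P [set w | s%:E < \int[Q]_t (Y w t ^+ 2)%:E] <=
    (expR (5 - s / (96 * e)))%:E)%E.
Proof.
move=> lY s0 gY Ye.
have T0 : 0 <= trace P Q Y by exact: dot_ge0.
have e0 : 0 < e by exact: le_lt_trans Ye.
have [iK KE] := traceE lY.
pose eta := e - trace P Q Y; have eta0 : 0 < eta by rewrite subr_gt0.
pose v t := dot P (Y^~ t) (Y^~ t) + eta.
have v0 t : 0 < v t by rewrite ltr_wpDl// dot_ge0.
have mv : measurable_fun setT v.
  apply: measurable_funD => //.
  by have /measurable_int/measurable_EFinP := iK.
have iv : (\int[Q]_t (v t)%:E = e%:E)%E.
  under eq_integral do rewrite EFinD.
  rewrite integralD_EFin//; last exact: finite_measure_integrable_cst.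
  have -> : (\int[Q]_t eta%:E = eta%:E)%E.
    by rewrite integral_cst// [X in (_ * X)%E]probability_setT mule1.
  rewrite -[X in (X + _)%E]fineK; last exact: integrable_fin_num.
  rewrite -/(Rintegral _ _ _) -KE -EFinD /eta; congr EFin; ring.
pose m := s / (96 * e).
pose z w t := (96 * v t)^-1 * Y w t ^+ 2.
pose G (p : Omega * T) : R := v p.2 / e * expR (z p.1 p.2).
have mY2 : measurable_fun setT (fun p : Omega * T => Y p.1 p.2 ^+ 2).
  by apply: measurable_funX; exact: lY.1.1.
have mG : measurable_fun setT (EFin \o G).
  apply/measurable_EFinP; apply: measurable_funM.
    apply: measurable_funM => //.
    by apply: measurableT_comp => //; exact: measurable_snd.
  apply: measurableT_comp => //; apply: measurable_funM => //.
  rewrite (_ : (fun _ => _) = (fun p : Omega * T => (96 * v p.2) `^ (-1))); last first.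
    by apply/funext => p; rewrite powR_inv1// mulr_ge0// ltW.
  apply: (@measurableT_comp _ _ _ _ _ _ (fun x : R => x `^ (-1)) _
    (fun p : Omega * T => 96 * v p.2)); first exact: measurable_powR.
  apply: measurable_funM => //.
  by apply: measurableT_comp => //; exact: measurable_snd.
have G0 p : (0 <= (EFin \o G) p)%E.
  by rewrite lee_fin mulr_ge0 ?expR_ge0// divr_ge0// ltW.
have mY2' : measurable_fun setT (EFin \o (fun p : Omega * T => Y p.1 p.2 ^+ 2)).
  exact/measurable_EFinP.
pose N w := (\int[Q]_t (Y w t ^+ 2)%:E)%E.
have mN : measurable_fun setT N.
  apply: (measurable_fun_fubini_tonelli_F (EFin \o (fun p : Omega * T => Y p.1 p.2 ^+ 2))) => //.
  by move=> p; rewrite lee_fin sqr_ge0.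
pose F w := (\int[Q]_t (G (w, t))%:E)%E.
have mF : measurable_fun setT F by exact: (measurable_fun_fubini_tonelli_F _ mG).
have mB : measurable [set w | s%:E < N w]%E.
  rewrite -[X in measurable X]setTI; exact: emeasurable_fun_o_infty.
(* Jensen's inequality for the exponential, through its tangent at m *)
have FB w : (s%:E < N w)%E -> ((expR m)%:E <= F w)%E.
  move=> sN; pose c := expR m; have c0 : 0 < c by exact: expR_gt0.
  have m0 : 0 <= m by rewrite divr_ge0// mulr_ge0// ltW.
  have mYw : measurable_fun setT (fun t => Y w t ^+ 2).
    by apply: measurable_funX; exact: measurable_slice lY w.
  have mGw : measurable_fun setT (fun t => (G (w, t))%:E).
    exact: (measurableT_comp mG (measurable_pair1 w)).
  have ivZ (k : R) : 0 <= k -> (\int[Q]_t (k%:E * (v t)%:E) = (k * e)%:E)%E.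
    move=> k0; rewrite ge0_integralZl//; first by rewrite iv -EFinM.
    - exact/measurable_EFinP.
    - by move=> t _; rewrite lee_fin ltW.
  have : (\int[Q]_t ((c / e)%:E * (v t)%:E + (c / (96 * e))%:E * (Y w t ^+ 2)%:E)
      <= \int[Q]_t ((G (w, t))%:E + (c * m / e)%:E * (v t)%:E))%E.
    apply: ge0_le_integral => //.
    - move=> t _; rewrite -!EFinM -EFinD lee_fin.
      rewrite addr_ge0// mulr_ge0 ?sqr_ge0 ?(ltW (v0 _))// ?divr_ge0 ?(ltW c0)//.
        exact: ltW.
      by rewrite mulr_ge0// ltW.
    - by apply: emeasurable_funD; apply: measurable_funeM; exact/measurable_EFinP.
    - by apply: emeasurable_funD => //; apply: measurable_funeM; exact/measurable_EFinP.
    - move=> t _; rewrite -!EFinM -!EFinD lee_fin /G/=.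
      have zE : Y w t ^+ 2 = 96 * v t * z w t.
        by rewrite /z mulrA mulfV ?mul1r// gt_eqF ?mulr_gt0.
      have : c * (1 + (z w t - m)) <= expR (z w t).
        have -> : expR (z w t) = c * expR (z w t - m).
          by rewrite -expRD; congr expR; ring.
        by rewrite ler_pM2l// expR_ge1Dx.
      move=> tangent; rewrite zE.
      have -> : c / e * v t + c / (96 * e) * (96 * v t * z w t) =
        v t / e * (c * (1 + (z w t - m))) + c * m / e * v t.
        by field; rewrite gt_eqF.
      by rewrite lerD2r ler_wpM2l// divr_ge0 ?ltW.
  rewrite ge0_integralD//; last 4 first.
  - by move=> t _; rewrite -EFinM lee_fin mulr_ge0 ?divr_ge0 ?ltW.
  - by apply: measurable_funeM; exact/measurable_EFinP.
  - move=> t _; rewrite -EFinM lee_fin mulr_ge0 ?sqr_ge0// divr_ge0 ?(ltW c0)//.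
    by rewrite mulr_ge0// ltW.
  - by apply: measurable_funeM; exact/measurable_EFinP.
  have cm : 0 <= c * m / e by apply: divr_ge0; [apply: mulr_ge0 => //|]; exact: ltW.
  rewrite ge0_integralD//; last 3 first.
  - by move=> t _; exact: G0.
  - by move=> t _; rewrite -EFinM lee_fin mulr_ge0 ?(ltW (v0 _)).
  - by apply: measurable_funeM; exact/measurable_EFinP.
  have ce : 0 <= c / (96 * e).
    by rewrite divr_ge0 ?(ltW c0)// mulr_ge0// ltW.
  have ce' : 0 <= c / e by rewrite divr_ge0 ?(ltW c0) ?(ltW e0).
  rewrite (ivZ _ ce') (ivZ _ cm).
  rewrite [X in (_ + X <= _)%E]ge0_integralZl//; last 2 first.
  - exact/measurable_EFinP.
  - by move=> t _; rewrite lee_fin sqr_ge0.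
  rewrite -/(F w) -/(N w) divfK ?gt_eqF// divfK ?gt_eqF// => le1.
  rewrite -(leeD2rE _ _ (_ : (c * m)%:E \is a fin_num))//.
  apply: le_trans le1; rewrite leeD2l//.
  apply: (@le_trans _ _ ((c / (96 * e))%:E * s%:E)%E).
    rewrite -EFinM lee_fin /m; by rewrite mulrA mulrAC.
  by rewrite lee_wpmul2l// ltW.
have EF : (\int[P]_w F w <= (expR 5)%:E)%E.
  rewrite /F (@fubini_tonelli _ _ _ _ _ P Q (EFin \o G))//.
  apply: (@le_trans _ _ (\int[Q]_t ((v t / e)%:E * (expR 5)%:E))%E).
    apply: ge0_le_integral => //.
    - by move=> t _; exact: integral_ge0.
    - exact: (measurable_fun_fubini_tonelli_G _ mG).
    - apply: measurable_EFinM => //; exact: measurable_funM.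
    - move=> t _; rewrite /G /=; under eq_integral do rewrite EFinM.
      rewrite ge0_integralZl//.
      + apply: lee_wpmul2l.
          by rewrite lee_fin divr_ge0 ?(ltW (v0 t)) ?(ltW e0).
        apply: (gaussian_limit_expR_sqr (lY.2 t) (gY t) (v0 t)).
        by rewrite /v lerDl ltW.
      + apply/measurable_EFinP; apply: measurableT_comp => //.
        apply: measurable_funM => //; apply: measurable_funX.
        exact: (lY.2 t).1.
      + by rewrite lee_fin divr_ge0 ?ltW.
  rewrite ge0_integralZr//.
  - under eq_integral do rewrite mulrC EFinM.
    rewrite ge0_integralZl//.
    + by rewrite iv -!EFinM mulVf ?gt_eqF// mul1r.
    + exact/measurable_EFinP.
    + by move=> t _; rewrite lee_fin ltW.
    + by rewrite lee_fin invr_ge0 ltW.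
  - by apply/measurable_EFinP; exact: measurable_funM.
  - by move=> t _; rewrite lee_fin divr_ge0 ?ltW.
have : ((expR m)%:E * P [set w | s%:E < N w] <= (expR 5)%:E)%E.
  apply: le_trans EF.
  rewrite -[X in P X]setIT -integral_indic// -ge0_integralZl//.
  - apply: ge0_le_integral => //.
    + by apply: measurable_funeM; apply/measurable_EFinP; exact: measurable_indic.
    + move=> w _; rewrite indicE; have [/set_mem/= sN|_] := boolP (w \in _).
        by rewrite mule1; exact: FB.
      by rewrite mule0; apply: integral_ge0 => t _; exact: G0.
  - by apply/measurable_EFinP; exact: measurable_indic.
have -> : expR (5 - s / (96 * e)) = expR 5 / expR m by rewrite -expRN -expRD.
by rewrite muleC EFinM lee_pdivlMr ?expR_gt0.
Qed.

End tail.

(** * Processes given by a mean square expansion *)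

Section expansion.
Context (d1 d2 : measure_display) (Omega : measurableType d1)
  (T : measurableType d2) (R : realType).
Variables (P : probability Omega R) (Q : probability T R).
Variables (I : choiceType) (xi : I -> Omega -> R).
Hypothesis lxi : forall k, sqint P (xi k).
Hypothesis oxi : forall k j, dot P (xi k) (xi j) = (k == j)%:R.

Definition combination (a : I -> R) (s : seq I) w := \sum_(k <- s) a k * xi k w.

Lemma sqint_combination a s : sqint P (combination a s).
Proof. by apply: sqint_sum => k; exact: sqintZ. Qed.

Lemma dot_combination a s : uniq s ->
  dot P (combination a s) (combination a s) = \sum_(k <- s) a k ^+ 2.
Proof.
move=> us; rewrite [LHS]dot_suml; last 2 first.
- by move=> k; exact: sqintZ.
- exact: sqint_combination.
rewrite !big_seq; apply: eq_bigr => k ks.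
rewrite dot_sumr//; last 2 first.
- by move=> j; exact: sqintZ.
- exact: sqintZ.
rewrite (bigD1_seq k)//= big1 ?addr0; last first.
  move=> j jk; rewrite dotZl//; last exact: sqintZ.
  by rewrite dotZr// oxi eq_sym (negbTE jk) !mulr0.
by rewrite dotZl ?dotZr ?oxi ?eqxx ?mulr1 ?expr2//; exact: sqintZ.
Qed.

(** Convergence in mean square along the net of finite sets of
    indices. *)
Definition mean_square_sum (a : I -> R) (Y : Omega -> R) := sqint P Y /\
  forall e : R, 0 < e -> exists A : {fset I}, forall J : {fset I},
    (A `<=` J)%fset -> dot P (fun w => Y w - combination a J w)
                           (fun w => Y w - combination a J w) <= e.

Lemma dot_addr_le (f g : Omega -> R) : sqint P f -> sqint P g ->
  dot P (fun w => f w + g w) (fun w => f w + g w) <= 2 * dot P f f + 2 * dot P g g.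
Proof.
move=> lf lg; have lfg := sqintD lf lg.
have := dot_ge0 P (fun w => f w - g w); rewrite dot_subK//.
rewrite dotDl// (dotC P f (fun w => _ + _)) (dotC P g (fun w => _ + _)) !dotDl//.
rewrite (dotC P g f); lra.
Qed.

Lemma combinationD a b s w : combination (fun k => a k + b k) s w =
  combination a s w + combination b s w.
Proof.
by rewrite /combination -big_split; apply: eq_bigr => k _; rewrite mulrDl.
Qed.

Lemma combinationZ c a s w : combination (fun k => c * a k) s w =
  c * combination a s w.
Proof.
by rewrite /combination mulr_sumr; apply: eq_bigr => k _; rewrite mulrA.
Qed.

Lemma mean_square_sumD a b Y Z : mean_square_sum a Y -> mean_square_sum b Z ->
  mean_square_sum (fun k => a k + b k) (fun w => Y w + Z w).
Proof.
move=> [lY hY] [lZ hZ]; split; first exact: sqintD.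
move=> e e0; have e4 : 0 < e / 4 by rewrite divr_gt0.
have [A hA] := hY _ e4; have [B hB] := hZ _ e4.
exists (A `|` B)%fset => J; rewrite fsubUset => /andP[/hA AJ /hB BJ].
rewrite (_ : (fun w => _ - _) = fun w => (Y w - combination a J w) + (Z w - combination b J w)).
  apply: (le_trans (dot_addr_le _ _)).
  - exact/sqintB/sqint_combination.
  - exact/sqintB/sqint_combination.
  - lra.
by apply/funext => w; rewrite combinationD; ring.
Qed.

Lemma mean_square_sumZ c a Y : mean_square_sum a Y -> mean_square_sum (fun k => c * a k) (fun w => c * Y w).
Proof.
move=> [lY hY]; split; first exact: sqintZ.
move=> e e0; have c0 : 0 < c ^+ 2 + 1 by rewrite ltr_wpDl ?sqr_ge0.
have [A hA] := hY _ (divr_gt0 e0 c0).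
exists A => J /hA le_e.
have lYJ : sqint P (fun w => Y w - combination a J w).
  exact/sqintB/sqint_combination.
rewrite (_ : (fun w => _ - _) = fun w => c * (Y w - combination a J w)).
  rewrite dotZl//; last exact: sqintZ.
  rewrite dotZr// mulrA -expr2.
  apply: (@le_trans _ _ (c ^+ 2 * (e / (c ^+ 2 + 1)))); first by rewrite ler_wpM2l ?sqr_ge0.
  by rewrite mulrA ler_pdivrMr// mulrC ler_pM2l// lerDl.
by apply/funext => w; rewrite combinationZ; ring.
Qed.

Lemma mean_square_sum0 : mean_square_sum (fun=> 0) (fun=> 0).
Proof.
split; first exact: sqint0.
move=> e e0; exists fset0 => J _.
rewrite (_ : (fun w => _ - _) = fun=> 0) ?dot0l ?ltW//.
by apply/funext => w; rewrite /combination big1 ?subr0// => k _; rewrite mul0r.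
Qed.

Lemma mean_square_sum_sum (U : Type) (s : seq U) (a : U -> I -> R) (Y : U -> Omega -> R) :
  (forall i, mean_square_sum (a i) (Y i)) ->
  mean_square_sum (fun k => \sum_(i <- s) a i k) (fun w => \sum_(i <- s) Y i w).
Proof.
move=> hY; elim: s => [|i s IHs].
  under [X in mean_square_sum X]eq_fun do rewrite big_nil.
  under [X in mean_square_sum _ X]eq_fun do rewrite big_nil.
  exact: mean_square_sum0.
under [X in mean_square_sum X]eq_fun do rewrite big_cons.
under [X in mean_square_sum _ X]eq_fun do rewrite big_cons.
exact: mean_square_sumD.
Qed.

Lemma mean_square_sum_gaussian a Y : jointly_gaussian P xi -> mean_square_sum a Y ->
  gaussian_limit P Y.
Proof.
move=> gxi [lY hY] e e0; have [A hA] := hY _ e0.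
exists (combination a A); last exact: (hA A (fsubset_refl A)).
by split; [exact: gxi|exact: sqint_combination].
Qed.

(** The residual at t is a linear combination of values of X, hence
    itself a mean square sum of the xi_k. *)
Lemma residual_gaussian (X : Omega -> T -> R) (c : I -> T -> R) s t :
  jointly_gaussian P xi -> (forall t, mean_square_sum (c^~ t) (X^~ t)) ->
  gaussian_limit P (fun w => residual X s w t).
Proof.
move=> gxi hX; pose a k := c k t + (-1) * \sum_(p <- s) p.2 t * c k p.1.
apply: (@mean_square_sum_gaussian a) => //.
rewrite /residual (_ : (fun _ => _) = fun w => X w t + (-1) * \sum_(p <- s) p.2 t * X w p.1).
  apply: mean_square_sumD => //; apply: mean_square_sumZ; apply: mean_square_sum_sum => p; exact: mean_square_sumZ.
apply/funext => w; rewrite mulN1r; congr (_ - _).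
by apply: eq_bigr => p _; rewrite mulrC.
Qed.

Variables (B : nat -> {fset I}).
Hypothesis ndB : forall m n, (m <= n)%N -> (B m `<=` B n)%fset.
Hypothesis exB : forall A : {fset I}, exists n, (A `<=` B n)%fset.
Variables (X : Omega -> T -> R) (c : I -> T -> R).
Hypothesis mX : measurable_fun setT (fun p : Omega * T => X p.1 p.2).
Hypothesis lc : forall k, sqint Q (c k).
Hypothesis hX : forall t, mean_square_sum (c^~ t) (X^~ t).

Let h (J : {fset I}) n t := \sum_(k <- B n | k \notin J) c k t ^+ 2.

(** Approximate X_t by the combination over a large B n, and use that the
    coefficients in B n outside J are those of an orthonormal family. *)
Let pointwise (J : {fset I}) t (e : R) : 0 < e -> exists n,
  dot P (fun w => X w t - combination (c^~ t) J w)
        (fun w => X w t - combination (c^~ t) J w) <= e + 2 * h J n t.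
Proof.
move=> e0; have [A hA] := (hX t).2 _ (divr_gt0 e0 (ltr0n _ 2)).
have [n An] := exB (A `|` J)%fset; exists n.
move: An; rewrite fsubUset => /andP[/hA AB JB].
have BE w : combination (c^~ t) (B n) w = combination (c^~ t) J w +
    combination (c^~ t) [seq k <- B n | k \notin J] w.
  rewrite /combination (bigID (mem J))/= -big_filter -[X in _ + X]big_filter.
  congr (_ + _); apply: perm_big; apply: uniq_perm.
  - exact/filter_uniq/fset_uniq.
  - exact: fset_uniq.
  - move=> k; rewrite mem_filter; have [kJ|//] := boolP (k \in J).
    by rewrite (fsubsetP JB).
rewrite (_ : (fun w => _ - _) = fun w => (X w t - combination (c^~ t) (B n) w) +
  combination (c^~ t) [seq k <- B n | k \notin J] w); last first.
  by apply/funext => w; rewrite BE; ring.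
apply: (le_trans (dot_addr_le _ _)).
- by apply: sqintB; [exact: (hX t).1|exact: sqint_combination].
- exact: sqint_combination.
rewrite dot_combination; last exact/filter_uniq/fset_uniq.
rewrite big_filter -/(h J n t) lerD2r; lra.
Qed.

(** The pointwise bound by twice the tail of the series of squares, the
    limit over B n being taken under the integral by monotone convergence.
    The factor 2 spares a passage to the limit in the mean square
    approximation. *)
Theorem mean_square_tail (J : {fset I}) (tau : R) :
  (forall n, \sum_(k <- B n | k \notin J) dot Q (c k) (c k) <= tau) ->
  (\int[Q]_t (dot P (fun w => X w t - combination (c^~ t) J w)
        (fun w => X w t - combination (c^~ t) J w))%:E <= (2 * tau)%:E)%E.
Proof.
move=> htau; pose g n t := (2 * h J n t)%:E.
have mh n : measurable_fun setT (fun t => 2 * h J n t).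
  apply: measurable_funM => //; rewrite /h.
  under eq_fun do rewrite -big_filter.
  apply: measurable_sum => k; apply: measurable_funX; exact: (lc k).1.
have mg n : measurable_fun setT (g n) by exact/measurable_EFinP.
have h0 n t : 0 <= h J n t by apply: sumr_ge0 => k _; exact: sqr_ge0.
have g0 n t : setT t -> (0 <= g n t)%E by move=> _; rewrite lee_fin mulr_ge0.
have ndg t : setT t -> nondecreasing_seq (g ^~ t).
  move=> _ m n mn; rewrite lee_fin ler_wpM2l//.
  rewrite /h -big_filter.
  have Bmn := fsubsetP (ndB mn).
  rewrite [leRHS](bigID (mem (B m)))/=.
  rewrite [X in _ <= X + _](_ : _ = \sum_(k <- [seq k <- B m | k \notin J]) c k t ^+ 2).
    by rewrite lerDl; apply: sumr_ge0 => k _; exact: sqr_ge0.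
  rewrite -[LHS]big_filter; apply: perm_big; apply: uniq_perm.
  - exact/filter_uniq/fset_uniq.
  - exact/filter_uniq/fset_uniq.
  - move=> k; rewrite !mem_filter; have [kB|] := boolP (k \in B m).
      by rewrite (Bmn _ kB) !andbT.
    by rewrite !andbF.
have cg t : cvgn (g ^~ t) by exact/ereal_nondecreasing_is_cvgn/ndg.
have le1 t : ((dot P (fun w => X w t - combination (c^~ t) J w)
        (fun w => X w t - combination (c^~ t) J w))%:E <= limn (g ^~ t))%E.
  apply/lee_addgt0Pr => e e0; have [n le_n] := pointwise J t e0.
  apply: (@le_trans _ _ (e%:E + g n t)%E).
    by rewrite -EFinD lee_fin.
  rewrite addeC leeD2r//; apply: lime_ge => //.
  near=> m; apply: ndg => //; near: m; exact: nbhs_infty_ge.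
apply: (@le_trans _ _ (\int[Q]_t limn (g ^~ t))%E).
  apply: ge0_le_integral => //.
  - by move=> t _; rewrite lee_fin dot_ge0.
  - apply/measurable_EFinP.
    have mf : measurable_fun setT (fun p : Omega * T =>
        X p.1 p.2 - combination (c^~ p.2) J p.1).
      apply: measurable_funB => //; apply: measurable_sum => k.
      apply: measurable_funM.
        by apply: measurableT_comp => //; exact: (lc k).1.
      by apply: measurableT_comp => //; exact: (lxi k).1.
    have mF := measurable_funM mf mf.
    apply: (measurableT_comp (f := fine)) => //.
    have mF' : measurable_fun setT (EFin \o (fun p : Omega * T =>
        (X p.1 p.2 - combination (c^~ p.2) J p.1) *
        (X p.1 p.2 - combination (c^~ p.2) J p.1))) by exact/measurable_EFinP.
    apply: (measurable_fun_fubini_tonelli_G (m1 := P) _ mF').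
    by move=> p; rewrite lee_fin -expr2 sqr_ge0.
  - apply: emeasurable_fun_cvg mg _ => t _; exact: cg.
rewrite monotone_convergence//; apply: lime_le.
  apply: ereal_nondecreasing_is_cvgn => m n mn; apply: ge0_le_integral => //.
  - by move=> t _; exact: g0.
  - by move=> t _; exact: ndg.
apply: nearW => n.
have mh' k : measurable_fun setT (fun t => (c k t ^+ 2)%:E).
  by apply/measurable_EFinP; apply: measurable_funX; exact: (lc k).1.
under eq_integral do rewrite /g EFinM /h -big_filter -sumEFin.
rewrite ge0_integralZl//; last 2 first.
- exact: emeasurable_sum.
- by move=> t _; apply: sume_ge0 => k _; rewrite lee_fin sqr_ge0.
rewrite EFinM lee_wpmul2l// ge0_integral_sum//; last first.
  by move=> k t _; rewrite lee_fin sqr_ge0.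
rewrite big_filter; under eq_bigr do rewrite -EFin_dot//.
by rewrite sumEFin lee_fin.
Unshelve. all: by end_near. Qed.

Lemma sqproc_expansion (Lambda : R) :
  (forall n, \sum_(k <- B n) dot Q (c k) (c k) <= Lambda) ->
  sqproc P Q X /\ trace P Q X <= 2 * Lambda.
Proof.
move=> hL.
have X0 t : (fun w => X w t - combination (c^~ t) fset0 w) = X^~ t.
  by apply/funext => w; rewrite /combination big_seq_fset0 subr0.
have le1 : (\int[Q]_t (dot P (X^~ t) (X^~ t))%:E <= (2 * Lambda)%:E)%E.
  have := @mean_square_tail fset0 Lambda; under eq_integral do rewrite X0.
  by apply => n; under eq_bigl do rewrite in_fset0.
have mX2 : measurable_fun setT (EFin \o (fun p : Omega * T => X p.1 p.2 ^+ 2)).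
  by apply/measurable_EFinP; exact: measurable_funX.
have lX : sqproc P Q X.
  split; last by move=> t; exact: (hX t).1.
  split=> //; apply/integrable21ltyP => //.
  under eq_integral => t _.
    under eq_integral => w _ do rewrite /= ger0_norm ?sqr_ge0//.
    rewrite -EFin_dot; last exact: (hX t).1.
    over.
  by rewrite (le_lt_trans le1) ?ltry.
split=> //; rewrite (traceE lX).2 -lee_fin /Rintegral fineK//.
exact/integrable_fin_num/(traceE lX).1.
Qed.

End expansion.

(** [greedy] applied to the span of the u_k for k in J: the variance of
    X outside this span is governed by the coefficients outside J, and the
    total variance by all of them. *)
Theorem greedy_expansion (d1 d2 : measure_display) (Omega : measurableType d1)
    (T : measurableType d2) (R : realType) (P : probability Omega R)
    (Q : probability T R) (I : choiceType) (xi : I -> Omega -> R)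
    (B : nat -> {fset I}) (X : Omega -> T -> R) (a : I -> R) (u : I -> T -> R)
    (S : set T) (J : {fset I}) (tau Lambda : R) (n : nat) :
  (forall k, sqint P (xi k)) ->
  (forall k j, dot P (xi k) (xi j) = (k == j)%:R) ->
  (forall m n, (m <= n)%N -> (B m `<=` B n)%fset) ->
  (forall A : {fset I}, exists n, (A `<=` B n)%fset) ->
  measurable_fun setT (fun p : Omega * T => X p.1 p.2) ->
  (forall k, sqint Q (u k)) ->
  (forall k j, dot Q (u k) (u j) = (k == j)%:R) ->
  (forall t, mean_square_sum P xi (fun k => a k * u k t) (X^~ t)) ->
  (forall t, ~ S t -> forall w, X w t = 0) ->
  (forall n, \sum_(k <- B n | k \notin J) a k ^+ 2 <= tau) ->
  (forall n, \sum_(k <- B n) a k ^+ 2 <= Lambda) ->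
  exists s : seq (T * (T -> R)), [/\ (size s <= n)%N,
    List.Forall (fun p => S p.1 /\ sqint Q p.2) s,
    sqproc P Q (residual X s) &
    trace P Q (residual X s) <=
      Num.max (4 * tau) ((1 - (8 * #|` J|%:R)^-1) ^+ n * (2 * Lambda))].
Proof.
move=> lxi oxi ndB exB mX lu ou hX XS htau hL.
have lc k : sqint Q (fun t => a k * u k t) by exact: sqintZ.
have dc k : dot Q (fun t => a k * u k t) (fun t => a k * u k t) = a k ^+ 2.
  by rewrite dotZl// dotZr// ou eqxx mulr1 expr2.
have [lX le_tr] : sqproc P Q X /\ trace P Q X <= 2 * Lambda.
  apply: (sqproc_expansion lxi oxi ndB exB mX lc hX) => m.
  by under eq_bigr do rewrite dc.
have lE : sqproc P Q (fun w t => X w t -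
    \sum_(i : J) (a (val i) * xi (val i) w) * u (val i) t).
  apply: (sqprocB lX).
  apply: (@sqproc_sum _ _ _ _ _ P Q _ (fun (i : J) w t => a (val i) * xi (val i) w * u (val i) t)) => i.
  by apply: sqproc_ten => //; exact: sqintZ.
have aX : approx P Q (fun i : J => u (val i)) (2 * tau) X.
  exists (fun i w => a (val i) * xi (val i) w); first by move=> i; exact: sqintZ.
  rewrite (traceE lE).2 -lee_fin /Rintegral fineK; last first.
    exact/integrable_fin_num/(traceE lE).1.
  have := @mean_square_tail _ _ _ _ _ P Q _ xi lxi oxi B ndB exB X _ mX lc hX J tau.
  rewrite (_ : (fun t => (dot P _ _)%:E) = fun t => (dot P
     (fun w => X w t - \sum_(i : J) a (val i) * xi (val i) w * u (val i) t)
     (fun w => X w t - \sum_(i : J) a (val i) * xi (val i) w * u (val i) t))%:E).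
    by apply=> m; under eq_bigr do rewrite dc.
  apply/funext => t; congr (dot P _ _)%:E; apply/funext => w; congr (_ - _);
    rewrite /combination big_seq_fsetE/=; apply: eq_bigr => i _; ring.
have [] := @greedy _ _ _ _ _ P Q _ (fun i : J => u (val i)) _ _ S (2 * tau) X n lX aX XS.
- by move=> i; exact: lu.
- by move=> i j; rewrite ou.
move=> s [sn sS ls le_s]; exists s; split=> //.
have -> : 4 * tau = 2 * (2 * tau) by ring.
apply: (le_trans le_s); rewrite cardfE ge_max !le_max lexx/=.
apply/orP; right; rewrite ler_wpM2l// exprn_ge0// subr_ge0.
have [->|J0] := posnP #|{: J}|; first by rewrite mulr0 invr0.
have : 1 <= #|{: J}|%:R :> R by rewrite ler1n.
by move=> J1; rewrite invf_le1; lra.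
Qed.

(** * Sums of a power times a power of the logarithm *)

Section log_sums.
Variable R : realType.
Implicit Types x y z : R.

(** Adding 1 keeps this positive on [1, +oo[, so that arbitrary real powers
    behave well there. *)
Definition lg x : R := 1 + ln x.

Lemma lg_ge1 x : 1 <= x -> 1 <= lg x.
Proof. by move=> x1; rewrite lerDl ln_ge0. Qed.

Lemma lg_gt0 x : 1 <= x -> 0 < lg x.
Proof. by move=> /lg_ge1; exact: lt_le_trans. Qed.

Lemma lg_le x y : 0 < x -> x <= y -> lg x <= lg y.
Proof. by move=> x0 xy; rewrite lerD2l ler_ln ?posrE// (lt_le_trans x0). Qed.

Lemma lg_le_powR (e z : R) : 0 < e -> 1 <= z -> lg z <= (1 + e^-1) * z `^ e.
Proof.
move=> e0 z1; have z0 : 0 < z by exact: lt_le_trans z1.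
have ze : 1 + e * ln z <= z `^ e.
  by rewrite /powR gt_eqF// expR_ge1Dx.
have lnz : 0 <= ln z by exact: ln_ge0.
rewrite /lg mulrDl mul1r lerD//.
  by rewrite (le_trans _ ze)// lerDl mulr_ge0// ltW.
rewrite mulrC ler_pdivlMr// mulrC.
by rewrite (le_trans _ ze)// lerDr.
Qed.

(** From 1 + a + b <= (1 + a) (1 + b) for a, b >= 0. *)
Lemma lg_ratio x y : 1 <= y -> y <= x -> lg x <= lg y * lg (x / y).
Proof.
move=> y1 yx; have y0 : 0 < y by exact: lt_le_trans y1.
have x0 : 0 < x by exact: lt_le_trans yx.
have a0 := ln_ge0 y1.
have b0 : 0 <= ln (x / y) by rewrite ln_ge0// ler_pdivlMr// mul1r.
have -> : x = y * (x / y) by rewrite mulrC divfK// gt_eqF.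
rewrite {1}/lg lnM ?posrE ?divr_gt0// mulrAC mulrV ?unitfE ?gt_eqF// mul1r.
by rewrite /lg; nra.
Qed.

(** A power of the logarithm varies more slowly than any power: the tool
    that pulls logarithmic factors out of sums over i >= y. *)
Lemma powR_lg_slow (b e : R) : 0 < e -> exists2 K : R, 0 < K & forall x y,
  1 <= y -> y <= x -> lg x `^ b <= K * (x / y) `^ e * lg y `^ b.
Proof.
move=> e0; have [b0|b0] := leP b 0.
  exists 1 => // x y y1 yx; have y0 : 0 < y by exact: lt_le_trans y1.
  have r1 : 1 <= x / y by rewrite ler_pdivlMr// mul1r.
  have re : 1 <= (x / y) `^ e by rewrite -(powRr0 (x / y)) ler_powR// ltW.
  have ly := lg_gt0 y1; have lx : 0 < lg x by rewrite lg_gt0// (le_trans y1).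
  have le_b : lg x `^ b <= lg y `^ b.
    have E z : z `^ b = (z `^ (- b))^-1 by rewrite -powRN opprK.
    rewrite !E lef_pV2 ?posrE ?powR_gt0//.
    by apply: ge0_ler_powR; rewrite ?oppr_ge0 ?nnegrE ?(ltW ly) ?(ltW lx)// lg_le.
  by rewrite mul1r (le_trans le_b)// ler_peMl ?powR_ge0.
exists ((1 + (e / b)^-1) `^ b) => [|x y y1 yx].
  by rewrite powR_gt0// ltr_wpDr// invr_ge0 divr_ge0// ltW.
have y0 : 0 < y by exact: lt_le_trans y1.
have r1 : 1 <= x / y by rewrite ler_pdivlMr// mul1r.
have eb : 0 < e / b by rewrite divr_gt0.
have K0 : 0 <= 1 + (e / b)^-1 by rewrite addr_ge0// invr_ge0 ltW.
have -> : (x / y) `^ e = ((x / y) `^ (e / b)) `^ b.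
  by rewrite -powRrM divfK// gt_eqF.
rewrite -powRM ?powR_ge0// -powRM ?mulr_ge0 ?powR_ge0 ?(ltW (lg_gt0 y1))//.
apply: ge0_ler_powR; rewrite ?nnegrE ?(ltW b0)//.
- by rewrite ltW// lg_gt0// (le_trans y1).
- by rewrite !mulr_ge0 ?powR_ge0 ?(ltW (lg_gt0 y1)).
- rewrite (le_trans (lg_ratio y1 yx))// mulrC ler_wpM2r ?(ltW (lg_gt0 y1))//.
  exact: lg_le_powR.
Qed.

(** The tangent bound exp u >= 1 + u at u = s ln (x / y); it replaces the
    mean value theorem in the telescoping arguments below. *)
Lemma powR_ratio_ge (s x y : R) : 0 < x -> 0 < y ->
  y `^ s * (1 + s * ln (x / y)) <= x `^ s.
Proof.
move=> x0 y0; have z0 : 0 < x / y by rewrite divr_gt0.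
have -> : x `^ s = y `^ s * (x / y) `^ s.
  by rewrite -powRM ?(ltW y0) ?(ltW z0)// mulrC divfK// gt_eqF.
apply: ler_wpM2l; first exact: powR_ge0.
by rewrite [X in _ <= X]/powR gt_eqF// expR_ge1Dx.
Qed.

Lemma ln_ratio_ge x y : 0 < x -> 0 < y -> (x - y) / x <= ln (x / y).
Proof.
move=> x0 y0; have yx : 0 < y / x by rewrite divr_gt0.
have := le_ln1Dx (_ : -1 < y / x - 1).
have -> : 1 + (y / x - 1) = y / x by ring.
have -> : ln (y / x) = - ln (x / y) by rewrite -[y / x]invf_div lnV ?posrE ?divr_gt0.
have -> : (x - y) / x = 1 - y / x by field; rewrite gt_eqF.
by move=> H; have := H _; lra.
Qed.

(** The increment of a primitive dominates its derivative, for telescoping. *)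
Lemma powR_step (p : R) (m : nat) : 1 < p -> (0 < m)%N ->
  (p - 1) * m.+1%:R `^ (- p) <= m%:R `^ (1 - p) - m.+1%:R `^ (1 - p).
Proof.
move=> p1 m0; have m0' : 0 < m%:R :> R by rewrite ltr0n.
have m1 : 0 < m.+1%:R :> R by rewrite ltr0n.
have le1 := powR_ratio_ge (1 - p) m0' m1.
have le2 := ln_ratio_ge m1 m0'.
have lnE : ln (m%:R / m.+1%:R) = - ln (m.+1%:R / m%:R) :> R.
  by rewrite -[m%:R / _]invf_div lnV ?posrE ?divr_gt0.
have e1 : m.+1%:R `^ (- p) = m.+1%:R `^ (1 - p) * m.+1%:R^-1 :> R.
  rewrite -(powR_inv1 (ltW m1)) -powRD; first by congr (_ `^ _); ring.
  by rewrite (gt_eqF m1) implybT.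
have e2 : (m.+1%:R - m%:R) / m.+1%:R = m.+1%:R^-1 :> R.
  by rewrite -natrB// subSnn mul1r.
rewrite e2 in le2; rewrite lnE in le1; rewrite e1.
have w0 : 0 <= m.+1%:R `^ (1 - p) :> R by exact: powR_ge0.
have p0 : 0 <= p - 1 by lra.
have gen (W V L i : R) : W * (1 + (1 - p) * - L) <= V -> 0 <= W -> i <= L ->
    (p - 1) * (W * i) <= V - W.
  move=> h1 h2 h3; have := ler_wpM2l h2 (ler_wpM2l p0 h3).
  have E : W * (1 + (1 - p) * - L) = W + W * ((p - 1) * L) by ring.
  rewrite E in h1; lra.
exact: gen le1 w0 le2.
Qed.

(** Telescoping with [powR_step]. The induction on m needs the sharper
    bound that retains the last boundary term. *)
Lemma sum_powR_tail (p : R) : 1 < p -> exists2 C : R, 0 < C & forall (y : R) (m : nat),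
  1 <= y -> \sum_(i < m | y <= i.+1%:R) i.+1%:R `^ (- p) <= C * y `^ (1 - p).
Proof.
move=> p1; have c0 : 0 < (p - 1)^-1 by rewrite invr_gt0 subr_gt0.
set c := (p - 1)^-1 in c0 *.
exists (1 + c) => [|y m y1]; first by rewrite addr_gt0.
have y0 : 0 < y by exact: lt_le_trans y1.
(* the first term past y is bounded by y^(1 - p), the others telescope *)
suff : \sum_(i < m | y <= i.+1%:R) i.+1%:R `^ (- p) <=
    if y <= m%:R then (1 + c) * y `^ (1 - p) - c * m%:R `^ (1 - p) else 0.
  move=> /le_trans; apply; case: ifPn => _; last by rewrite mulr_ge0 ?powR_ge0// addr_ge0// ltW.
  by rewrite lerBlDr lerDl mulr_ge0 ?powR_ge0// ltW.
elim: m => [|m IH].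
  by rewrite big_ord0; case: ifPn => // /(le_trans y1); rewrite ler10.
rewrite big_mkcond big_ord_recr -big_mkcond/=.
have [ym|my] := leP y m%:R.
  have m0 : (0 < m)%N by rewrite -(ltr_nat R) (lt_le_trans y0).
  have ym1 : y <= m.+1%:R by rewrite (le_trans ym)// ler_nat.
  rewrite ym in IH; rewrite ym1; have step := powR_step p1 m0.
  have : c * ((p - 1) * m.+1%:R `^ (- p)) <=
      c * (m%:R `^ (1 - p) - m.+1%:R `^ (1 - p)) by rewrite ler_pM2l.
  rewrite mulrA mulVf ?gt_eqF ?subr_gt0// mul1r; lra.
rewrite ifF in IH; last by rewrite leNgt my.
case: ifPn => ym1; last by rewrite addr0.
have m1 : 1 <= m.+1%:R :> R by rewrite ler1n.
have le1 : m.+1%:R `^ (- p) <= m.+1%:R `^ (1 - p) :> R by rewrite ler_powR//; lra.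
have le2 : m.+1%:R `^ (1 - p) <= y `^ (1 - p).
  have -> : 1 - p = - (p - 1) by ring.
  rewrite !powRN lef_pV2 ?posrE ?powR_gt0 ?ltr0n//.
  by apply: ge0_ler_powR; rewrite ?nnegrE ?subr_ge0 ?(ltW p1) ?(ltW y0).
have : c * m.+1%:R `^ (1 - p) <= c * y `^ (1 - p) by rewrite ler_pM2l.
lra.
Qed.

Variable alpha : R.

(** The model for lambda(i)^(1 / r), up to a constant, with the index shifted
    by one. *)
Definition decay (i : nat) : R := lg i.+1%:R `^ alpha / i.+1%:R.

Lemma decay_gt0 i : 0 < decay i.
Proof. by rewrite divr_gt0 ?ltr0n// powR_gt0// lg_gt0// ler1n. Qed.

(** Half of the excess p - 1 of the exponent is spent on absorbing the
    variation of the logarithm. *)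
Lemma sum_decay_tail (p : R) : 1 < p -> exists2 C : R, 0 < C & forall (y : R) (m : nat),
  1 <= y -> \sum_(i < m | y <= i.+1%:R) decay i `^ p <=
    C * (y `^ (1 - p) * lg y `^ (alpha * p)).
Proof.
move=> p1; pose e := (p - 1) / 2.
have e0 : 0 < e by rewrite divr_gt0// subr_gt0.
have pe1 : 1 < p - e by rewrite /e; lra.
have [K K0 hK] := powR_lg_slow (alpha * p) e0.
have [C C0 hC] := sum_powR_tail pe1.
exists (K * C) => [|y m y1]; first by rewrite mulr_gt0.
have y0 : 0 < y by exact: lt_le_trans y1.
have w0 : 0 <= K * lg y `^ (alpha * p) * y `^ (- e).
  by rewrite !mulr_ge0 ?powR_ge0// ltW.
apply: (@le_trans _ _ (\sum_(i < m | y <= i.+1%:R)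
    K * lg y `^ (alpha * p) * y `^ (- e) * i.+1%:R `^ (- (p - e)))).
  apply: ler_sum => i yi.
  have i0 : 0 < i.+1%:R :> R by rewrite ltr0n.
  have -> : decay i `^ p = lg i.+1%:R `^ (alpha * p) * i.+1%:R `^ (- p).
    rewrite /decay powRM ?powR_ge0 ?invr_ge0 ?ler0n// -powRrM; congr (_ * _).
    by rewrite -powR_inv1 ?ler0n// -powRrM mulN1r.
  apply: (@le_trans _ _ (K * (i.+1%:R / y) `^ e * lg y `^ (alpha * p) * i.+1%:R `^ (- p))).
    by rewrite ler_wpM2r ?powR_ge0// hK.
  have -> : (i.+1%:R / y) `^ e = i.+1%:R `^ e * y `^ (- e).
    rewrite powRM ?invr_ge0 ?ler0n ?(ltW y0)//; congr (_ * _).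
    by rewrite -powR_inv1 ?(ltW y0)// -powRrM mulN1r.
  have -> : i.+1%:R `^ (- (p - e)) = i.+1%:R `^ e * i.+1%:R `^ (- p) :> R.
    by rewrite -powRD ?(gt_eqF i0) ?implybT//; congr (_ `^ _); ring.
  by rewrite le_eqVlt; apply/orP; left; apply/eqP; ring.
rewrite -mulr_sumr (le_trans (ler_wpM2l w0 (hC y m y1)))//.
have -> : y `^ (1 - p) = y `^ (- e) * y `^ (1 - (p - e)).
  by rewrite -powRD ?(gt_eqF y0) ?implybT//; congr (_ `^ _); ring.
by rewrite le_eqVlt; apply/orP; left; apply/eqP; ring.
Qed.

(** The first bound drives the telescoping; the second makes consecutive terms comparable. *)
Lemma lg_step (m : nat) : (0 < m)%N ->
  m.+1%:R^-1 <= lg m.+1%:R - lg m%:R /\ lg m.+1%:R <= 2 * lg m%:R.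
Proof.
move=> m0; have m0' : 0 < m%:R :> R by rewrite ltr0n.
have m1 : 0 < m.+1%:R :> R by rewrite ltr0n.
have -> : lg m.+1%:R - lg m%:R = ln (m.+1%:R / m%:R).
  by rewrite ln_div ?posrE// /lg; ring.
split.
  apply: le_trans (ln_ratio_ge m1 m0').
  by rewrite -natrB// subSnn mul1r.
have lm : 1 <= lg m%:R by rewrite lg_ge1// ler1n.
have : ln (1 + m%:R^-1) <= m%:R^-1 :> R.
  by apply: le_ln1Dx; rewrite (lt_trans (_ : -1 < 0))// ?ltrN10// invr_gt0.
have -> : 1 + m%:R^-1 = m.+1%:R / m%:R :> R.
  by rewrite -natr1; field; rewrite gt_eqF.
have : m%:R^-1 <= 1 :> R by rewrite invf_le1// ler1n.
have : lg m.+1%:R = lg m%:R + ln (m.+1%:R / m%:R).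
  by rewrite ln_div ?posrE// /lg; ring.
lra.
Qed.

(** Exhibits the derivative of lg^s, apart from the factor s and a shift
    by one. *)
Lemma decayE (s : R) m : alpha = s - 1 ->
  decay m = lg m.+1%:R `^ s * ((lg m.+1%:R)^-1 * m.+1%:R^-1).
Proof.
move=> aE; have lm : 0 < lg m.+1%:R by rewrite lg_gt0// ler1n.
rewrite /decay aE powRD ?(gt_eqF lm) ?implybT// powR_inv1 ?(ltW lm)//.
by rewrite mulrA.
Qed.

(** Telescoping against lg^s with s = 1 + alpha. For s < 0 this is
    decreasing and the sum converges; for s > 0 it dominates the sum; for
    s = 0 an iterated logarithm would be needed. *)
Lemma sum_decay_le : alpha != -1 -> exists2 C : R, 0 < C & forall m : nat, (0 < m)%N ->
  \sum_(i < m) decay i <= C * lg m%:R `^ Num.max (1 + alpha) 0.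
Proof.
move=> a1; pose s := 1 + alpha; have sE : alpha = s - 1 by rewrite /s; ring.
have hyp0 : decay 0 = 1 by rewrite /decay /lg ln1 addr0 powR1 divr1.
have lg1 : lg 1 = 1 by rewrite /lg ln1 addr0.
(* the hypothesis removes the case s = 0 *)
rewrite -/s; have [s0|s0|s0] := ltgtP s 0.
- have ns0 : 0 < (- s)^-1 by rewrite invr_gt0; lra.
  exists (1 + (- s)^-1) => [|m m0]; first by lra.
  rewrite powRr0 mulr1.
  suff : \sum_(i < m) decay i <= 1 + (- s)^-1 - (- s)^-1 * lg m%:R `^ s.
    move=> /le_trans; apply; rewrite lerBlDr lerDl mulr_ge0 ?powR_ge0//.
    exact: ltW.
  elim: m m0 => // -[_ _|m IH _].
    by rewrite big_ord_recr big_ord0/= add0r hyp0 lg1 powR1; lra.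
  rewrite big_ord_recr/=; have {IH} := IH isT.
  have [st _] := lg_step (ltn0Sn m); set y := lg m.+1%:R in st *.
  have Yy : y <= lg m.+2%:R by apply: lg_le; rewrite ?ltr0n// ler_nat.
  have y0 : 0 < y by rewrite lg_gt0// ler1n.
  rewrite (decayE _ sE); set Y := lg m.+2%:R in st Yy *.
  have Y0 : 0 < Y by exact: lt_le_trans Yy.
  have le1 := powR_ratio_ge s y0 Y0.
  have le2 := ln_ratio_ge Y0 y0.
  have lnE : ln (y / Y) = - ln (Y / y) by rewrite -[y / Y]invf_div lnV ?posrE ?divr_gt0.
  have le3 : Y^-1 * m.+2%:R^-1 <= ln (Y / y).
    by apply: le_trans le2; rewrite [leRHS]mulrC ler_wpM2l// invr_ge0 ltW.
  have gen (u v L i : R) : u * (1 + s * - L) <= v -> 0 <= u -> i <= L ->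
      u * i <= (- s)^-1 * (v - u).
    move=> h1 h2 h3.
    have h4 : 0 <= (- s)^-1 * (v - u * (1 + s * - L)).
      by apply: mulr_ge0; [exact: ltW|rewrite subr_ge0].
    have E : (- s)^-1 * (v - u * (1 + s * - L)) = (- s)^-1 * (v - u) - u * L.
      by field; rewrite lt_eqF.
    rewrite E in h4; have := ler_wpM2l h2 h3; lra.
  rewrite lnE in le1; have := gen _ _ _ _ le1 (powR_ge0 _ _) le3.
  move: ((- s)^-1) (Y `^ s * _) => K u; lra.
- have K0 : 0 < 2 `^ s / s by rewrite divr_gt0// powR_gt0.
  exists (1 + 2 `^ s / s) => [|m m0]; first by lra.
  suff : \sum_(i < m) decay i <= 1 + 2 `^ s / s * (lg m%:R `^ s - 1).
    move=> /le_trans; apply.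
    have : 1 <= lg m%:R `^ s.
      by rewrite -[X in X <= _](powRr0 (lg m%:R)) ler_powR ?lg_ge1 ?ler1n// ltW.
    rewrite mulrDl mul1r; lra.
  elim: m m0 => // -[_ _|m IH _].
    by rewrite big_ord_recr big_ord0/= add0r hyp0 lg1 powR1; lra.
  rewrite big_ord_recr/=; have {IH} := IH isT.
  have [st dbl] := lg_step (ltn0Sn m); set y := lg m.+1%:R in st dbl *.
  have Yy : y <= lg m.+2%:R by apply: lg_le; rewrite ?ltr0n// ler_nat.
  have y0 : 0 < y by rewrite lg_gt0// ler1n.
  rewrite (decayE _ sE); set Y := lg m.+2%:R in st dbl Yy *.
  have Y0 : 0 < Y by exact: lt_le_trans Yy.
  have le1 := powR_ratio_ge s Y0 y0.
  have le2 := ln_ratio_ge Y0 y0.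
  have le3 : Y^-1 * m.+2%:R^-1 <= ln (Y / y).
    by apply: le_trans le2; rewrite [leRHS]mulrC ler_wpM2l// invr_ge0 ltW.
  have le4 : Y `^ s <= 2 `^ s * y `^ s.
    rewrite -powRM ?(ltW y0)//; apply: ge0_ler_powR; rewrite ?nnegrE ?(ltW s0) ?(ltW Y0)//.
    by rewrite mulr_ge0// ltW.
  have i0 : 0 <= Y^-1 * m.+2%:R^-1 by rewrite mulr_ge0// invr_ge0 ?ler0n ?(ltW Y0).
  have gen (u v U t L i : R) : u * (1 + s * L) <= v -> 0 <= u -> i <= L ->
      U <= t * u -> 0 <= i -> 0 <= t -> U * i <= t / s * (v - u).
    move=> h1 h2 h3 h4 h5 h6.
    have h7 := ler_wpM2r h5 h4; apply: (le_trans h7).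
    have h8 : t / s * (u * (s * L)) <= t / s * (v - u).
      apply: ler_wpM2l; first by rewrite divr_ge0// ltW.
      by move: h1; rewrite mulrDr mulr1; lra.
    apply: le_trans h8.
    have -> : t / s * (u * (s * L)) = t * u * L by field; rewrite gt_eqF.
    by rewrite ler_wpM2l// mulr_ge0.
  have := gen _ _ _ _ _ _ le1 (powR_ge0 _ _) le3 le4 i0 (powR_ge0 _ _).
  move: (2 `^ s / s) (Y `^ s * _) => K u; lra.
- by move: a1; rewrite sE s0 sub0r eqxx.
Qed.

End log_sums.

(** * Hyperbolic crosses *)

Section boxes.
Variable d : nat.

Definition index_of M (k : {ffun 'I_d -> 'I_M}) : multi_index d := [ffun l => val (k l)].

Lemma index_ofE M (k : {ffun 'I_d -> 'I_M}) l : index_of k l = k l.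
Proof. by rewrite ffunE. Qed.

Lemma index_of_inj M : injective (@index_of M).
Proof.
move=> k k' e; apply/ffunP => l; apply/val_inj.
by have /ffunP/(_ l) := e; rewrite !ffunE.
Qed.

(** Boxes exhaust the multi-indices, and their sums factor as sums over
    functions between finite types. *)
Definition box M : {fset multi_index d} :=
  [fset k in [seq index_of k | k <- enum {: {ffun 'I_d -> 'I_M}}]]%fset.

Lemma mem_box M (k : multi_index d) : (k \in box M) = [forall l, k l < M]%N.
Proof.
rewrite inE; apply/mapP/forallP => [[k' _ ->] l|kM].
  by rewrite ffunE ltn_ord.
exists [ffun l => Ordinal (kM l)]; first by rewrite mem_enum.
by apply/ffunP => l; rewrite !ffunE.
Qed.

Lemma big_box (R : nmodType) M (p : pred (multi_index d)) (f : multi_index d -> R) :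
  \sum_(k <- box M | p k) f k = \sum_(k : {ffun 'I_d -> 'I_M} | p (index_of k)) f (index_of k).
Proof.
rewrite (perm_big [seq index_of k | k <- enum {: {ffun 'I_d -> 'I_M}}]).
  by rewrite big_map big_enum_cond.
apply: uniq_perm.
- exact: fset_uniq.
- by rewrite (map_inj_uniq (@index_of_inj M)) enum_uniq.
- by move=> k; rewrite inE.
Qed.

Lemma box_sub m n : (m <= n)%N -> (box m `<=` box n)%fset.
Proof.
move=> mn; apply/fsubsetP => k; rewrite !mem_box => /forallP km.
by apply/forallP => l; rewrite (leq_trans (km l)).
Qed.

Lemma box_exhaust (A : {fset multi_index d}) : exists n, (A `<=` box n)%fset.
Proof.
exists (\max_(k <- A) \max_l (k l)).+1; apply/fsubsetP => k kA.
rewrite mem_box; apply/forallP => l; rewrite ltnS.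
by rewrite (leq_trans _ (leq_bigmax_seq _ kA isT))// (leq_bigmax l).
Qed.

End boxes.

Section insertion.
Variables (n M : nat) (l : 'I_n.+1).

(** Fubini for multi-indices: one coordinate i is separated from the
    others, which form a multi-index g with one coordinate less. *)
Definition insert_at (i : 'I_M) (g : {ffun 'I_n -> 'I_M}) : {ffun 'I_n.+1 -> 'I_M} :=
  [ffun x => oapp g i (unlift l x)].

Lemma insert_at_eq i g : insert_at i g l = i.
Proof. by rewrite ffunE unlift_none. Qed.

Lemma insert_at_lift i g j : insert_at i g (lift l j) = g j.
Proof. by rewrite ffunE liftK. Qed.

Lemma big_insert_at (R : nmodType) (F : {ffun 'I_n.+1 -> 'I_M} -> R) :
  \sum_k F k = \sum_g \sum_i F (insert_at i g).
Proof.
rewrite pair_big/= (reindex (fun p : {ffun 'I_n -> 'I_M} * 'I_M => insert_at p.2 p.1))//=.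
exists (fun k => ([ffun j => k (lift l j)], k l)) => [[g i] _|k _] /=.
  by congr (_, _); rewrite ?insert_at_eq//; apply/ffunP => j; rewrite ffunE insert_at_lift.
apply/ffunP => x; rewrite ffunE; case: (unliftP l x) => [j|] ->/=.
  by rewrite ffunE.
by [].
Qed.

End insertion.

Section counting.
Variable R : realType.
Implicit Types x y z : R.

Lemma count_ord_le M z : 0 <= z -> \sum_(i < M | i.+1%:R <= z) (1 : R) <= z.
Proof.
move=> z0; suff : \sum_(i < M | i.+1%:R <= z) (1 : R) <= Num.min z M%:R.
  by move=> /le_trans; apply; rewrite ge_min lexx.
elim: M => [|M IH]; first by rewrite big_ord0 le_min z0 ler0n.
rewrite big_mkcond big_ord_recr -big_mkcond/=.
move: IH; rewrite !le_min => /andP[h1 h2].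
case: ifPn => Mz; rewrite -natr1; move: Mz; rewrite -?natr1 => Mz; apply/andP; split; lra.
Qed.

(** The sign of the exponent decides which comparison is used. *)
Lemma powR_comparable (b D u v : R) : 0 < u -> 0 < v -> 1 <= D ->
  u <= D * v -> v <= D * u -> u `^ b <= D `^ `|b| * v `^ b.
Proof.
move=> u0 v0 D1 uv vu; have D0 : 0 < D by exact: lt_le_trans D1.
have [b0|b0] := leP 0 b.
  rewrite ger0_norm// -powRM ?(ltW D0) ?(ltW v0)//.
  by apply: ge0_ler_powR; rewrite // nnegrE ltW// mulr_gt0.
have nb : 0 <= - b by lra.
rewrite ltr0_norm//.
have E z : z `^ b = (z `^ (- b))^-1 by rewrite -powRN opprK.
rewrite !E ler_pdivlMr ?powR_gt0// mulrC ler_pdivrMr ?powR_gt0//.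
rewrite -powRM ?(ltW D0) ?(ltW u0)//.
by apply: ge0_ler_powR; rewrite // nnegrE ltW// mulr_gt0.
Qed.

Lemma powR_prod (p : R) m (F : 'I_m -> R) : (forall j, 0 <= F j) ->
  (\prod_j F j) `^ p = \prod_j F j `^ p.
Proof.
move=> F0; suff [] : 0 <= \prod_j F j /\ (\prod_j F j) `^ p = \prod_j F j `^ p by [].
elim/big_ind2 : _ => //; first by rewrite powR1.
by move=> a a' c c' [a0 <-] [c0 <-]; rewrite mulr_ge0// powRM.
Qed.

Variable alpha : R.
Local Notation h := (decay alpha).

(** Crude polynomial bounds, enough where only the order of a logarithm
    matters. *)
Lemma decay_bounds : exists2 H : R, 1 <= H &
  forall i, h i <= H /\ 1 <= H * i.+1%:R ^+ 2 * h i.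
Proof.
pose m := `|alpha| + 1; have m1 : 1 <= m by rewrite lerDr.
have m0 : 0 < m by lra.
exists ((1 + m) `^ m) => [|i].
  by rewrite -[X in X <= _](powRr0 (1 + m)); apply: ler_powR; lra.
have i1 : 1 <= i.+1%:R :> R by rewrite ler1n.
have i0 : 0 < i.+1%:R :> R by rewrite ltr0n.
have l1 := lg_ge1 i1; have l0 := lg_gt0 i1.
have lgm : lg i.+1%:R `^ m <= (1 + m) `^ m * i.+1%:R.
  have mi : 0 < m^-1 by rewrite invr_gt0.
  have := lg_le_powR mi i1; rewrite invrK => le1.
  have -> : (1 + m) `^ m * i.+1%:R = ((1 + m) * i.+1%:R `^ m^-1) `^ m.
    rewrite powRM ?powR_ge0//; last by lra.
    by rewrite -powRrM mulVf ?gt_eqF// powRr1// ltW.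
  apply: ge0_ler_powR => //; rewrite ?nnegrE ?ltW//.
  by rewrite mulr_gt0 ?powR_gt0//; lra.
have am : `|alpha| <= m by rewrite /m; lra.
split.
  rewrite /decay ler_pdivrMr//; apply: le_trans lgm; apply: ler_powR => //.
  by rewrite (le_trans (ler_norm _)).
have up : 1 <= lg i.+1%:R `^ m * lg i.+1%:R `^ alpha.
  rewrite -powRD ?(gt_eqF l0) ?implybT// -[X in X <= _](powRr0 (lg i.+1%:R)); apply: ler_powR => //.
  by have := ler_norm (- alpha); rewrite normrN; lra.
apply: (le_trans up).
have -> : (1 + m) `^ m * i.+1%:R ^+ 2 * h i =
   (1 + m) `^ m * i.+1%:R * lg i.+1%:R `^ alpha.
  by rewrite /decay; field; rewrite gt_eqF.
by rewrite ler_wpM2r ?powR_ge0.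
Qed.

Variable n : nat.

(** The arm of the cross in direction l. If the l-th coordinate is the
    largest, then outside the arm the product of the decays of the
    coordinates is less than 1 / x, up to logarithms. *)
Definition cross_arm x (l : 'I_n.+1) (k : multi_index n.+1) : bool :=
  [forall j : 'I_n, (k (lift l j)).+1%:R <= x] &&
  ((k l).+1%:R <= x * \prod_(j < n) h (k (lift l j))).

Lemma cross_arm_ins M x l (i : 'I_M) (g : {ffun 'I_n -> 'I_M}) :
  cross_arm x l (index_of (insert_at l i g)) = [forall j, (g j).+1%:R <= x] &&
    (i.+1%:R <= x * \prod_j h (g j)).
Proof.
rewrite /cross_arm; congr (_ && _).
  by apply: eq_forallb => j; rewrite ffunE insert_at_lift.
rewrite ffunE insert_at_eq; congr (_ <= _ * _).
by apply: eq_bigr => j _; rewrite ffunE insert_at_lift.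
Qed.

(** Each arm is bounded, because the decays are. *)
Lemma exists_cross x : 1 <= x -> exists J : {fset multi_index n.+1},
  forall k, (k \in J) = [exists l, cross_arm x l k].
Proof.
move=> x1; have x0 : 0 <= x by lra.
have [H H1 hH] := decay_bounds.
exists [fset k in box n.+1 (Num.truncn (x * H ^+ n)) | [exists l, cross_arm x l k]]%fset.
move=> k; rewrite !inE/=; apply/andb_idl => /existsP[l /andP[/forallP hj hl]].
have Hn : 1 <= H ^+ n by rewrite exprn_ege1.
suff : k \in box n.+1 (Num.truncn (x * H ^+ n)) by rewrite inE.
rewrite mem_box; apply/forallP => a; rewrite truncn_gt_nat.
case: (unliftP l a) => [j|] ->.
  by rewrite (le_trans (hj j))// ler_peMr.
rewrite (le_trans hl)// ler_wpM2l//.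
rewrite -[X in H ^+ X]card_ord -prodr_const; apply: ler_prod => j _.
by rewrite (ltW (decay_gt0 _ _)) (hH _).1.
Qed.

Hypothesis alpha_neq : alpha != -1.
Local Notation s0 := (Num.max (1 + alpha) 0).

Lemma sum_decay_upto : exists2 C : R, 0 < C & forall x M, 1 <= x ->
  \sum_(i < M | i.+1%:R <= x) h i <= C * lg x `^ s0.
Proof.
have [C C0 hC] := sum_decay_le alpha_neq; exists C => // x M x1.
have s00 : 0 <= s0 by rewrite le_max lexx orbT.
have mono (m : nat) : (0 < m)%N -> m%:R <= x -> C * lg m%:R `^ s0 <= C * lg x `^ s0.
  move=> m0 mx; rewrite ler_pM2l//; apply: ge0_ler_powR => //.
  - by rewrite nnegrE ltW// lg_gt0// ler1n.
  - by rewrite nnegrE ltW// lg_gt0.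
  - by rewrite lg_le// ltr0n.
have x0 : 0 <= x by lra.
have [M0|M0] := posnP M.
  by rewrite M0 big_ord0 mulr_ge0 ?powR_ge0// ltW.
have [MX|XM] := leqP M (Num.truncn x).
  apply: le_trans (mono M M0 _); last by rewrite -truncn_ge_nat.
  apply: le_trans (hC M M0); rewrite [leRHS](bigID (fun i : 'I_M => i.+1%:R <= x))/=.
  by rewrite lerDl sumr_ge0// => i _; rewrite ltW// decay_gt0.
have X0 : (0 < Num.truncn x)%N by rewrite truncn_gt0.
apply: le_trans (mono _ X0 _); last by rewrite truncn_le.
apply: le_trans (hC _ X0).
rewrite (big_ord_widen_cond M predT h (ltnW XM)).
by under eq_bigl do rewrite -truncn_gt_nat.
Qed.

(** The sum factors into n equal sums. *)
Lemma sum_prod_decay : exists2 C : R, 0 < C & forall x M, 1 <= x ->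
  \sum_(g : {ffun 'I_n -> 'I_M} | [forall j, (g j).+1%:R <= x]) \prod_j h (g j)
    <= C ^+ n * lg x `^ (n%:R * s0).
Proof.
have [C C0 hC] := sum_decay_upto; exists C => // x M x1.
have -> : C ^+ n * lg x `^ (n%:R * s0) = (C * lg x `^ s0) ^+ n.
  by rewrite exprMn [n%:R * s0]mulrC powRrM powR_mulrn ?powR_ge0.
apply: (@le_trans _ _ ((\sum_(i < M | i.+1%:R <= x) h i) ^+ n)); last first.
  apply: lerXn2r; rewrite ?nnegrE; last exact: hC.
    by apply: sumr_ge0 => i _; rewrite ltW// decay_gt0.
  by rewrite mulr_ge0 ?powR_ge0// ltW.
rewrite -[X in _ ^+ X]card_ord -prodr_const bigA_distr_big_dep/=.
rewrite le_eqVlt; apply/orP; left; apply/eqP; apply: eq_bigl => g.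
by apply/forallP/familyP => gj j; have := gj j.
Qed.

(** Sum over the arms, and in the arm l first over the l-th coordinate,
    which has at most x prod h(g_j) admissible values. *)
Lemma card_cross : exists2 C : R, 0 < C & forall x (J : {fset multi_index n.+1}),
  1 <= x -> (forall k, (k \in J) = [exists l, cross_arm x l k]) ->
  #|` J|%:R <= C * (x * lg x `^ (n%:R * s0)).
Proof.
have [C C0 hC] := sum_prod_decay.
exists (n.+1%:R * C ^+ n) => [|x J x1 JE].
  by rewrite mulr_gt0 ?ltr0n ?exprn_gt0.
have x0 : 0 <= x by lra.
have [M JM] := box_exhaust J.
have -> : #|` J|%:R = \sum_(k <- box n.+1 M | k \in J) (1 : R).
  rewrite -big_filter (perm_big J).
    by rewrite big_seq_fsetE/= sumr_const cardfE.
  apply: uniq_perm; rewrite ?fset_uniq ?filter_uniq ?fset_uniq// => k.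
  by rewrite mem_filter; apply/andb_idr; exact: (fsubsetP JM).
rewrite big_box.
apply: (@le_trans _ _ (\sum_(k : {ffun 'I_n.+1 -> 'I_M}) \sum_(l < n.+1) (cross_arm x l (index_of k))%:R)).
  rewrite big_mkcond; apply: ler_sum => k _.
  case: ifPn => [|_]; last by apply: sumr_ge0 => l _; rewrite ler0n.
  rewrite JE => /existsP[l jl]; rewrite (bigD1 l)//= jl lerDl.
  by apply: sumr_ge0 => i _; rewrite ler0n.
rewrite exchange_big/=.
rewrite -mulrA; set B := C ^+ n * _.
have -> : n.+1%:R * B = \sum_(l < n.+1) B by rewrite sumr_const card_ord mulr_natl.
apply: ler_sum => l _; rewrite {}/B.
rewrite (big_insert_at l).
apply: (@le_trans _ _ (\sum_(g : {ffun 'I_n -> 'I_M} | [forall j, (g j).+1%:R <= x])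
    x * \prod_j h (g j))).
  rewrite [leRHS]big_mkcond; apply: ler_sum => g _.
  case: ifPn => gx; last first.
    by rewrite big1// => i _; rewrite cross_arm_ins (negbTE gx).
  have z0 : 0 <= x * \prod_j h (g j).
    by rewrite mulr_ge0// prodr_ge0// => j _; rewrite ltW// decay_gt0.
  apply: le_trans (count_ord_le M z0); rewrite [leRHS]big_mkcond; apply: ler_sum => i _.
  by rewrite cross_arm_ins gx; case: ifP.
rewrite -mulr_sumr mulrCA ler_wpM2l//.
exact: hC.
Qed.

Variables (p C0 : R) (lam2 : nat -> R).
Hypotheses (p1 : 1 < p) (C00 : 0 < C0) (lam2_ge0 : forall i, 0 <= lam2 i)
  (lam2_le : forall i, lam2 i <= C0 * h i `^ p).
Local Notation b := (alpha * p).

Lemma sum_lam2_tail : exists2 C : R, 0 < C & forall y (m : nat), 1 <= y ->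
  \sum_(i < m | y <= i.+1%:R) lam2 i <= C * (y `^ (1 - p) * lg y `^ b).
Proof.
have [C Cgt hC] := sum_decay_tail alpha p1.
exists (C0 * C) => [|y m y1]; first exact: mulr_gt0.
rewrite -mulrA (le_trans _ (ler_wpM2l (ltW C00) (hC y m y1)))// mulr_sumr.
exact: ler_sum.
Qed.

Lemma sum_lam2_le : exists2 A : R, 0 < A & forall m, \sum_(i < m) lam2 i <= A.
Proof.
have [C Cgt hC] := sum_lam2_tail; exists C => // m.
have := hC 1 m (lexx _); rewrite powR1 mul1r /lg ln1 addr0 powR1 mulr1.
by under eq_bigl do rewrite ler1n.
Qed.

(** Outside the cross the largest index must exceed the maximum y of z
    and of all other indices. Bounding the tail beyond y needs lg y, and the
    point is that this is of the order of lg x: in one direction since the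
    decays are bounded, in the other since h(i) is at least a multiple of
    i^-2 and the other indices are at most y, so that x is at most a
    power of y. *)
Lemma cutoff_comparable : exists2 D : R, 1 <= D &
  forall x M (g : {ffun 'I_n -> 'I_M}), 1 <= x -> 
  (forall j, (g j).+1%:R <= x) ->
  let z := x * \prod_j h (g j) in
  exists y, [/\ 1 <= y, z <= y, forall j, (g j).+1%:R <= y,
    forall w, 1 <= w -> z <= w -> (forall j, (g j).+1%:R <= w) -> y <= w &
    lg y <= D * lg x /\ lg x <= D * lg y].
Proof.
have [H H1 hH] := decay_bounds.
have lnH : 0 <= ln H by exact: ln_ge0.
exists (n.+1.*2%:R + n%:R * ln H) => [|x M g x1 gx z].
  by rewrite -[X in X <= _]addr0 lerD ?ler1n// mulr_ge0.
have x0 : 0 < x by lra.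
have z0 : 0 < z by rewrite mulr_gt0// prodr_gt0// => j _; exact: decay_gt0.
pose y := \big[Num.max/Num.max z 1]_j (g j).+1%:R.
have zy : z <= y by apply: le_trans (bigmax_ge_id _ _ _ _); rewrite le_max lexx.
have y1 : 1 <= y by apply: le_trans (bigmax_ge_id _ _ _ _); rewrite le_max lexx orbT.
have gy j : (g j).+1%:R <= y by rewrite /y (le_bigmax _ (fun j => (g j).+1%:R) j).
have y0 : 0 < y by lra.
have yw w : 1 <= w -> z <= w -> (forall j, (g j).+1%:R <= w) -> y <= w.
  by move=> w1 zw gw; apply: bigmax_le => //; rewrite ge_max zw w1.
exists y; split=> //.
have H0 : 0 < H by lra.
have lx := ln_ge0 x1; have ly := ln_ge0 y1.
split.
  have yx : y <= x * H ^+ n.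
    have xH : x <= x * H ^+ n by rewrite ler_peMr ?(ltW x0)// exprn_ege1.
    apply: yw; [exact: le_trans xH| |by move=> j; exact: le_trans xH].
    rewrite ler_wpM2l ?(ltW x0)// -[X in H ^+ X]card_ord -prodr_const.
    by apply: ler_prod => j _; rewrite (ltW (decay_gt0 _ _)) (hH _).1.
  have : lg y <= lg (x * H ^+ n) by exact: lg_le.
  have -> : lg (x * H ^+ n) = lg x + n%:R * ln H.
    by rewrite /lg lnM ?posrE ?exprn_gt0// lnXn// addrA mulr_natl.
  move/le_trans; apply; rewrite mulrDl.
  have l1 := lg_ge1 x1; have l0 : 0 <= lg x by lra.
  apply: lerD; first by rewrite ler_peMl// ler1n.
  by rewrite ler_peMr// mulr_ge0.
(* each h (g_j) is at least 1 / (H y^2), and z <= y *)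
have xy : x <= H ^+ n * y ^+ n.+1.*2.
  have pr : 1 <= (H * y ^+ 2) ^+ n * \prod_j h (g j).
    rewrite -[X in _ ^+ X]card_ord -prodr_const -big_split/=.
    have {1}-> : 1 = \prod_(j < n) (1 : R) by rewrite big1.
    apply: ler_prod => j _.
    rewrite ler01/= (le_trans (hH (g j)).2)// ler_wpM2r ?(ltW (decay_gt0 _ _))//.
    rewrite ler_wpM2l ?(ltW H0)//; apply: lerXn2r; rewrite ?nnegrE ?ler0n ?(ltW y0)//.
  apply: (@le_trans _ _ ((H * y ^+ 2) ^+ n * z)).
    by rewrite /z mulrCA ler_peMr// (ltW x0).
  apply: (@le_trans _ _ ((H * y ^+ 2) ^+ n * y)).
    by rewrite ler_wpM2l// exprn_ge0// mulr_ge0 ?sqr_ge0 ?(ltW H0).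
  rewrite exprMn -exprM -mulrA -exprSr ler_wpM2l ?exprn_ge0 ?(ltW H0)//.
  by rewrite ler_weXn2l// doubleS ltnS mul2n leqnSn.
have : lg x <= lg (H ^+ n * y ^+ n.+1.*2) by exact: lg_le.
have -> : lg (H ^+ n * y ^+ n.+1.*2) = 1 + n%:R * ln H + n.+1.*2%:R * ln y.
  by rewrite /lg lnM ?posrE ?exprn_gt0// !lnXn// addrA !mulr_natl.
move/le_trans; apply; rewrite /lg.
have c1 : 1 <= n.+1.*2%:R :> R by rewrite ler1n.
have c2 : 0 <= n%:R * ln H by rewrite mulr_ge0.
have c3 := mulr_ge0 c2 ly.
lra.
Qed.

(** Sum first over the largest coordinate. If the others, g, are at most
    x, it exceeds y >= z = x prod h(g_j), and the tail of lam2 beyond y is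
    at most a multiple of z^(1 - p) (lg x)^b. With the factor prod h(g_j)^p
    coming from the other coordinates this is x^(1 - p) (lg x)^b prod h(g_j),
    and summing over g gives the power of lg x. If some other coordinate
    exceeds x, so does the largest, and the tail beyond x is enough. *)
Lemma tail_cross : exists2 C : R, 0 < C & forall x (J : {fset multi_index n.+1}),
  1 <= x -> (forall k, (k \in J) = [exists l, cross_arm x l k]) ->
  forall M, \sum_(k <- box n.+1 M | k \notin J) \prod_l lam2 (k l) <=
    C * (x `^ (1 - p) * lg x `^ (b + n%:R * s0)).
Proof.
have [C1 C1gt hC1] := sum_lam2_tail.
have [A Agt hA] := sum_lam2_le.
have [D D1 hD] := cutoff_comparable.
have [C2 C2gt hC2] := sum_prod_decay.
pose K := D `^ `|b|.
have K0 : 0 < K by rewrite powR_gt0//; lra.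
exists (n.+1%:R * (A ^+ n * C1 + C1 * K * C0 ^+ n * C2 ^+ n)) => [|x J x1 JE M].
  by rewrite mulr_gt0 ?ltr0n// addr_gt0 ?mulr_gt0 ?exprn_gt0.
have x0 : 0 < x by lra.
have lx1 := lg_ge1 x1; have lx0 := lg_gt0 x1.
have s00 : 0 <= s0 by rewrite le_max lexx orbT.
rewrite big_box.
apply: (@le_trans _ _ (\sum_(k : {ffun 'I_n.+1 -> 'I_M}) \sum_(l < n.+1)
  if [forall j, index_of k j <= index_of k l]%N && ~~ cross_arm x l (index_of k)
  then \prod_a lam2 (k a) else 0)).
  rewrite big_mkcond; apply: ler_sum => k _.
  have pk : 0 <= \prod_a lam2 (k a) by apply: prodr_ge0.
  have nn l : 0 <= if [forall j, index_of k j <= index_of k l]%N && ~~ cross_arm x l (index_of k)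
     then \prod_a lam2 (k a) else 0 by case: ifP.
  case: ifPn => [|_]; last exact: sumr_ge0.
  rewrite JE negb_exists => /forallP nj.
  have [l _ lmax] := @arg_maxnP _ ord0 predT (fun l => index_of k l) isT.
  rewrite [leRHS](bigD1 l)//= ifT; last first.
    by rewrite (nj l) andbT; apply/forallP => j; exact: lmax.
  rewrite (eq_bigr (fun a => lam2 (k a))) ?lerDl ?sumr_ge0//.
  by move=> a _; rewrite ffunE.
rewrite exchange_big/= -mulrA; set B := (_ + _) * _.
have -> : n.+1%:R * B = \sum_(l < n.+1) B by rewrite sumr_const card_ord mulr_natl.
apply: ler_sum => l _; rewrite {}/B (big_insert_at l).
pose Tx := x `^ (1 - p) * lg x `^ b.
have Tx0 : 0 <= Tx by rewrite mulr_ge0 ?powR_ge0.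
(* the two summands are the two cases; the first is kept for all g, as
   lam2 is summable *)
have inner (g : {ffun 'I_n -> 'I_M}) :
  \sum_(i < M) (if [forall j, index_of (insert_at l i g) j <= index_of (insert_at l i g) l]%N &&
       ~~ cross_arm x l (index_of (insert_at l i g)) then \prod_a lam2 (insert_at l i g a) else 0) <=
  \prod_j lam2 (g j) * (C1 * Tx) +
  (if [forall j, (g j).+1%:R <= x] then
    C1 * K * C0 ^+ n * (Tx * \prod_j h (g j)) else 0).
  pose PG := \prod_j lam2 (g j); have PG0 : 0 <= PG by exact: prodr_ge0.
  have term i : \prod_a lam2 (insert_at l i g a) = PG * lam2 i.
    rewrite (bigD1_ord l)//= insert_at_eq mulrC; congr (_ * _).
    by apply: eq_bigr => j _; rewrite insert_at_lift.
  have largest i : [forall j, index_of (insert_at l i g) j <= index_of (insert_at l i g) l]%N ->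
      forall j, (g j).+1%:R <= i.+1%:R :> R.
    move=> /forallP gi j; have := gi (lift l j).
    by rewrite !index_ofE insert_at_eq insert_at_lift ler_nat ltnS.
  have bnd w : 1 <= w -> (forall i : 'I_M,
      [forall j, index_of (insert_at l i g) j <= index_of (insert_at l i g) l]%N ->
      ~~ cross_arm x l (index_of (insert_at l i g)) -> w <= i.+1%:R) ->
    \sum_(i < M) (if [forall j, index_of (insert_at l i g) j <= index_of (insert_at l i g) l]%N &&
       ~~ cross_arm x l (index_of (insert_at l i g)) then \prod_a lam2 (insert_at l i g a) else 0) <=
    PG * (C1 * (w `^ (1 - p) * lg w `^ b)).
    move=> w1 hw; apply: le_trans (ler_wpM2l PG0 (hC1 w M w1)).
    rewrite mulr_sumr [leRHS]big_mkcond; apply: ler_sum => i _; rewrite term.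
    case: ifPn => [/andP[c1 c2]|_]; first by rewrite (hw i c1 c2).
    by case: ifP => // _; rewrite mulr_ge0.
  case: ifPn => gx.
    have {}gx := forallP gx.
    have [y [y1 zy _ ymin [lyx lxy]]] := hD x M g x1 gx.
    set z := x * _ in zy ymin.
    have ph0 : 0 < \prod_j h (g j) by rewrite prodr_gt0// => j _; exact: decay_gt0.
    have z0 : 0 < z by rewrite mulr_gt0.
    have y0 : 0 < y by lra.
    rewrite -[leLHS]add0r lerD//.
      by rewrite mulr_ge0// mulr_ge0// ltW.
    apply: (le_trans (bnd y y1 _)).
      move=> i /largest gi; rewrite cross_arm_ins (introT forallP gx)/= -ltNge => /ltW zi.
      by apply: ymin => //; rewrite ler1n.
    have PGle : PG <= C0 ^+ n * (\prod_j h (g j)) `^ p.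
      have -> : C0 ^+ n * (\prod_j h (g j)) `^ p = \prod_j (C0 * h (g j) `^ p).
        rewrite [RHS]big_split/= prodr_const card_ord powR_prod// => j.
        by rewrite ltW// decay_gt0.
      by apply: ler_prod => j _; rewrite lam2_ge0 lam2_le.
    have yz : y `^ (1 - p) <= z `^ (1 - p).
      have -> : 1 - p = - (p - 1) by ring.
      rewrite !powRN lef_pV2 ?posrE ?powR_gt0//.
      apply: ge0_ler_powR; [by rewrite subr_ge0 ltW|by rewrite nnegrE ltW|by rewrite nnegrE ltW|by []].
    have lyb : lg y `^ b <= K * lg x `^ b.
      by apply: powR_comparable => //; exact: lg_gt0.
    have zE : z `^ (1 - p) * (\prod_j h (g j)) `^ p = x `^ (1 - p) * \prod_j h (g j).
      rewrite powRM ?(ltW x0) ?(ltW ph0)// -mulrA; congr (_ * _).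
      by rewrite -powRD ?(gt_eqF ph0) ?implybT// subrK powRr1// ltW.
    have -> : C1 * K * C0 ^+ n * (Tx * \prod_j h (g j)) =
      (C0 ^+ n * (\prod_j h (g j)) `^ p) * (C1 * (z `^ (1 - p) * (K * lg x `^ b))).
      rewrite /Tx.
      have -> : C0 ^+ n * (\prod_j h (g j)) `^ p * (C1 * (z `^ (1 - p) * (K * lg x `^ b)))
        = C0 ^+ n * C1 * K * lg x `^ b * (z `^ (1 - p) * (\prod_j h (g j)) `^ p) by ring.
      by rewrite zE; ring.
    apply: ler_pM => //.
      by rewrite !mulr_ge0 ?powR_ge0// ltW.
    rewrite ler_wpM2l ?(ltW C1gt)//; apply: ler_pM => //; exact: powR_ge0.
  rewrite addr0; apply: bnd => // i /largest gi _.
  have := gx; rewrite negb_forall => /existsP[j]; rewrite -ltNge => /ltW xg.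
  exact: le_trans (gi j).
apply: (le_trans (ler_sum _ (fun g _ => inner g))).
rewrite big_split/= -mulr_suml -big_mkcond/= -mulr_sumr -mulr_sumr.
have sA : \sum_(g : {ffun 'I_n -> 'I_M}) \prod_j lam2 (g j) <= A ^+ n.
  rewrite (_ : \sum_g _ = (\sum_(i < M) lam2 i) ^+ n); last first.
    by rewrite -[X in _ ^+ X]card_ord -prodr_const bigA_distr_bigA.
  by apply: lerXn2r; rewrite ?nnegrE ?sumr_ge0// ltW.
set U := x `^ (1 - p) * lg x `^ (b + n%:R * s0).
have TU : Tx <= U.
  rewrite ler_wpM2l ?powR_ge0//; apply: ler_powR => //.
  by rewrite lerDl mulr_ge0.
have TE : Tx * lg x `^ (n%:R * s0) = U.
  by rewrite /Tx /U -mulrA -powRD// (gt_eqF lx0) implybT.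
rewrite mulrDl; apply: lerD.
  rewrite -mulrA; apply: ler_pM => //.
  - by apply: sumr_ge0 => g _; exact: prodr_ge0.
  - by rewrite mulr_ge0// ltW.
  - by rewrite ler_wpM2l// ltW.
rewrite -TE.
have -> : C1 * K * C0 ^+ n * C2 ^+ n * (Tx * lg x `^ (n%:R * s0)) =
  C1 * K * C0 ^+ n * (Tx * (C2 ^+ n * lg x `^ (n%:R * s0))) by ring.
rewrite ler_wpM2l ?mulr_ge0 ?exprn_ge0 ?(ltW C1gt) ?(ltW K0) ?(ltW C00)//.
by rewrite ler_wpM2l// hC2.
Qed.

End counting.

(** * The tensor product basis of the cube *)

Section cube_integrals.
Variable R : realType.
Local Notation pt n := (n.-tuple (measurableTypeR R)).
Local Notation U := (@leb01 R).

Lemma integrable_ten d1 d2 (T1 : measurableType d1) (T2 : measurableType d2)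
    (P : probability T1 R) (Q : probability T2 R) (g : T1 -> R) (k : T2 -> R) :
  P.-integrable setT (EFin \o g) -> Q.-integrable setT (EFin \o k) ->
  (P \x Q)%E.-integrable setT (EFin \o (fun p => g p.1 * k p.2)) /\
  \int[(P \x Q)%E]_p (g p.1 * k p.2) = \int[P]_x g x * \int[Q]_y k y.
Proof.
move=> ig ik; have mg : measurable_fun setT g.
  by have /measurable_int/measurable_EFinP := ig.
have mk : measurable_fun setT k by have /measurable_int/measurable_EFinP := ik.
have intf : (P \x Q)%E.-integrable setT (EFin \o (fun p => g p.1 * k p.2)).
  apply/integrable12ltyP.
    apply/measurable_EFinP; apply: measurable_funM; apply: measurableT_comp => //.
  have E x : (\int[Q]_y `|(g x * k y)%:E| = `|g x|%:E * \int[Q]_y `|k y|%:E)%E.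
    rewrite -ge0_integralZl//.
    - by apply: eq_integral => y _; rewrite /= normrM EFinM.
    - by apply/measurable_EFinP; exact: measurableT_comp.
  under eq_integral do rewrite /= E.
  have [_ ilty] := integrableP _ _ _ ig; have [_ jlty] := integrableP _ _ _ ik.
  rewrite ge0_integralZr//.
  - by apply: lte_mul_pinfty => //; [exact: integral_ge0|rewrite ge0_fin_numE ?integral_ge0].
  - by apply/measurable_EFinP; exact: measurableT_comp.
  - exact: integral_ge0.
split=> //; rewrite -(Rintegral12 intf).2 -RintegralZr//.
by apply: eq_Rintegral => x _ /=; rewrite RintegralZl.
Qed.

(** Induction on the dimension, along the recursive definition of the measure. *)
Lemma Rintegral_lebcube_prod n (f : 'I_n -> measurableTypeR R -> R) :
  (forall l, U.-integrable setT (EFin \o f l)) ->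
  (lebcube R n).-integrable setT (EFin \o (fun t => \prod_l f l (tnth t l))) /\
  \int[lebcube R n]_t (\prod_l f l (tnth t l)) = \prod_l \int[U]_x f l x.
Proof.
elim: n f => [|n IH] f intf.
  have -> : (fun t : pt 0 => \prod_l f l (tnth t l)) = cst 1.
    by apply/funext => t; rewrite big_ord0.
  split; first exact: finite_measure_integrable_cst.
  by rewrite Rintegral_cst// big_ord0 mul1r [X in fine X]probability_setT.
have [ik ek] := IH (fun l => f (lift ord0 l)) (fun l => intf _).
have [ifk efk] := integrable_ten (intf ord0) ik.
have E p : \prod_l f l (tnth (cons_pt p) l) =
    f ord0 p.1 * \prod_l f (lift ord0 l) (tnth p.2 l).
  rewrite big_ord_recl; congr (_ * _).
  by apply: eq_bigr => l _; rewrite tnthS.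
have mf : measurable_fun setT (EFin \o (fun t : pt n.+1 => \prod_l f l (tnth t l))).
  apply/measurable_EFinP; apply: measurable_prod => l _.
  apply: measurableT_comp; last exact: measurable_tnth.
  by have /measurable_int/measurable_EFinP := intf l.
have mc := @measurable_cons_pt R n.
have intc : (U \x lebcube R n)%E.-integrable (@cons_pt R n @^-1` setT)
   ((EFin \o (fun t : pt n.+1 => \prod_l f l (tnth t l))) \o @cons_pt R n).
  rewrite preimage_setT; apply: eq_integrable ifk => // p _ /=.
  by rewrite E.
split.
  exact: (integrable_pushforward mc mf intc).
rewrite big_ord_recl -ek -efk /Rintegral; congr fine.
rewrite [LHS](integral_pushforward mc mf intc)// preimage_setT.
by apply: eq_integral => p _ /=; rewrite E.
Qed.

Lemma measurable_cube n : measurable (@cube R n).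
Proof.
have -> : @cube R n = \bigcap_(l in [set: 'I_n])
    ((tnth (T := measurableTypeR R))^~ l @^-1` `[0, 1]).
  by apply/seteqP; split => t /= h l; [move=> _ /=; rewrite in_itv/=; exact: h|
    have := h l I; rewrite /= in_itv].
apply: fin_bigcap_measurable => // l _.
by rewrite -[X in measurable X]setTI; exact: measurable_tnth.
Qed.

Lemma lebcube_cube n : lebcube R n (@cube R n) = 1%E.
Proof.
have -> : @cube R n = [set t | forall l, `[0, 1]%classic (tnth t l : R)].
  by apply/seteqP; split => t /= h l; have := h l; rewrite /= in_itv.
rewrite (@lebcube_box R n (fun=> `[0, 1]%classic))//.
rewrite big1// => l _; rewrite -leb01_setT /leb01 /mrestr.
by rewrite setIid setTI.
Qed.

Lemma lebcube_cubeC n : lebcube R n (~` @cube R n) = 0%E.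
Proof.
by rewrite probability_setC ?lebcube_cube ?subee//; exact: measurable_cube.
Qed.

Lemma ae_cube n : {ae lebcube R n, forall t, @cube R n t}.
Proof.
exists (~` @cube R n); split.
- apply: measurableC; exact: (@measurable_cube n).
- exact: (@lebcube_cubeC n).
- by move=> t.
Qed.

Variable d : nat.
Local Notation Q := (lebcube R d).

(** Outside the cube nothing is known about X; cutting off there does not
    change integrals over the cube, and keeps the nodes inside. *)
Definition on_cube (f : pt d -> R) t : R := \1_(@cube R d) t * f t.

Lemma on_cubeE f t : cube t -> on_cube f t = f t.
Proof. by move=> ct; rewrite /on_cube indicE mem_set// mul1r. Qed.

Lemma on_cube0 f t : ~ cube t -> on_cube f t = 0.
Proof. by move=> ct; rewrite /on_cube indicE memNset// mul0r. Qed.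

Lemma measurable_on_cube f : measurable_fun setT f -> measurable_fun setT (on_cube f).
Proof.
move=> mf; apply: measurable_funM => //; apply: measurable_indic.
exact: measurable_cube.
Qed.

Lemma sqint_on_cube f : sqint Q f -> sqint Q (on_cube f).
Proof.
move=> [mf intf]; have mof := measurable_on_cube mf; split=> //.
apply: (@le_integrable_EFin _ _ _ _ _ (fun t => f t ^+ 2)) => //.
  exact: measurable_funX.
move=> t; rewrite ger0_norm ?sqr_ge0//.
have [ct|ct] := pselect (cube t); first by rewrite on_cubeE.
by rewrite on_cube0// expr0n sqr_ge0.
Qed.

Lemma dot_on_cube f g : sqint Q f -> sqint Q g ->
  dot Q (on_cube f) (on_cube g) = dot Q f g.
Proof.
move=> lf lg; rewrite /dot /Rintegral; congr fine; apply: ae_eq_integral => //.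
- apply/measurable_EFinP; apply: measurable_funM; apply: measurable_on_cube.
    exact: lf.1.
  exact: lg.1.
- apply/measurable_EFinP; apply: measurable_funM; [exact: lf.1|exact: lg.1].
- by apply: filterS (ae_cube d) => t ct _; rewrite !on_cubeE.
Qed.

Variable phi : nat -> R -> R.
Hypothesis ophi : orthonormal_L2_01 phi.

Definition basis (k : multi_index d) (t : pt d) : R :=
  \prod_l phi (k l) (tnth t l).

Let lphi i : sqint U (phi i).
Proof.
have := ophi.1 i; split; last exact: Lfun2_integrable_sqr.
by have := ophi.1 i; rewrite inE => /andP[/[!inE]].
Qed.

Let dphi i j : \int[U]_x (phi i x * phi j x) = (i == j)%:R.
Proof. by rewrite /Rintegral (ophi.2 i j). Qed.

Lemma sqint_basis k : sqint Q (basis k).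
Proof.
split.
  apply: measurable_prod => l _; apply: measurableT_comp; last exact: measurable_tnth.
  exact: (lphi (k l)).1.
have [+ _] := @Rintegral_lebcube_prod d (fun l x => phi (k l) x ^+ 2)
  (fun l => (lphi (k l)).2).
by apply: eq_integrable => // t _ /=; rewrite /basis prodrXl.
Qed.

Lemma dot_basis k j : dot Q (basis k) (basis j) = (k == j)%:R.
Proof.
have [_ e] := @Rintegral_lebcube_prod d (fun l x => phi (k l) x * phi (j l) x)
  (fun l => integrable_mul (lphi (k l)) (lphi (j l))).
rewrite /dot; transitivity (\prod_l \int[U]_x (phi (k l) x * phi (j l) x)).
  by rewrite -e; apply: eq_Rintegral => t _; rewrite /basis big_split.
have [->|kj] := eqVneq k j.
  by rewrite big1// => l _; rewrite dphi eqxx.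
have [l kl] : exists l, k l != j l.
  by apply/existsP; apply: contraNT kj; rewrite negb_exists => /forallP h;
    apply/eqP/ffunP => l; have /negPn/eqP := h l.
by rewrite (bigD1 l)//= dphi (negbTE kl) mul0r.
Qed.

End cube_integrals.

(** * Sampling algorithms for the tensor product field *)

(** The square avoids the root in the norm, which may be infinite. *)
Lemma L2_norm_gt (R : realType) d (f : d.-tuple (measurableTypeR R) -> R) (eps : R) :
  0 < eps -> measurable_fun setT f ->
  (eps%:E < L2_cube_norm f)%E =
  ((eps ^+ 2)%:E < \int[lebcube R d]_t (f t ^+ 2)%:E)%E.
Proof.
move=> eps0 mf; rewrite /L2_cube_norm Lnorm.unlock.
have -> : (\int[lebcube R d]_t `|(EFin \o f) t| `^ 2 = \int[lebcube R d]_t (f t ^+ 2)%:E)%E.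
  by apply: eq_integral => t _; rewrite /= powR_mulrn// real_normK// num_real.
set I := integral _ _ _; have I0 : (0 <= I)%E.
  by apply: integral_ge0 => t _; rewrite lee_fin sqr_ge0.
have -> : eps%:E = ((eps ^+ 2)%:E `^ 2^-1)%E.
  by rewrite poweR_EFin -powR_mulrn ?ltW// -powRrM divff ?powRr1 ?ltW.
have h0 : (0 : R) < 2^-1 by rewrite invr_gt0.
case: I I0 => [x| |]// x0; last by rewrite poweRyr ?gt_eqF ?ltry.
rewrite !poweR_EFin !lte_fin; apply/idP/idP => [|lt_x].
  by apply: contraTT; rewrite -!leNgt => le_x; apply: ge0_ler_powR;
    rewrite ?nnegrE ?sqr_ge0 ?(ltW h0).
by apply: gt0_ltr_powR; rewrite ?nnegrE ?sqr_ge0.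
Qed.

Section field.
Context (disp : measure_display) (Omega : measurableType disp) (R : realType).
Variables (P : probability Omega R) (d : nat).
Variables (lambda : nat -> R) (phi : nat -> R -> R).
Variables (xi : multi_index d -> {RV P >-> R}).
Variables (X : Omega -> d.-tuple (measurableTypeR R) -> R).
Hypothesis ophi : orthonormal_L2_01 phi.
Hypothesis fX : is_tensor_field lambda phi xi X.
Local Notation Q := (lebcube R d).

Let covarianceE k j : covariance P (xi k) (xi j) = (\int[P]_w (xi k w * xi j w)%:E)%E.
Proof.
have [_ E0 _ _ _] := fX; rewrite covariance.unlock !E0 /= expectation.unlock.
by apply: eq_integral => w _; rewrite /= fctE /= !subr0.
Qed.

Lemma sqint_xi k : sqint P (xi k : Omega -> R).
Proof.
have [_ _ V _ _] := fX; split=> //; apply/integrableP; split.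
  exact/measurable_EFinP/measurable_funX.
have := V k; rewrite /variance covarianceE => V1.
under eq_integral do rewrite /= ger0_norm ?sqr_ge0// expr2.
by rewrite V1 ltry.
Qed.

Lemma dot_xi k j : dot P (xi k) (xi j) = (k == j)%:R.
Proof.
have [_ _ V K _] := fX; rewrite /dot /Rintegral -covarianceE.
have [<-|kj] := eqVneq k j; first by rewrite -[covariance _ _ _]/(variance _ _) V.
by rewrite K.
Qed.

Definition coef_prod (k : multi_index d) : R := \prod_(l < d) lambda (k l).

Definition field_on_cube w := on_cube (X w).

Lemma measurable_field_on_cube : measurable_fun setT (fun p : Omega * d.-tuple (measurableTypeR R) => field_on_cube p.1 p.2).
Proof.
have [_ _ _ _ [mX _]] := fX; apply: measurable_funM => //.
apply: measurableT_comp => //; apply: measurable_indic; exact: measurable_cube.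
Qed.

(** The defining expansion, in the form used for abstract processes; the
    second moments of X_t are finite because one approximation error is. *)
Lemma mean_square_sum_field_on_cube t :
  mean_square_sum P xi (fun k => coef_prod k * on_cube (basis phi k) t) (field_on_cube^~ t).
Proof.
have [ct|ct] := pselect (cube t); last first.
  rewrite (_ : (fun k => _) = fun=> 0); last first.
    by apply/funext => k; rewrite on_cube0// mulr0.
  rewrite (_ : (fun w => _) = fun=> 0); first exact: mean_square_sum0.
  by apply/funext => w; rewrite /field_on_cube on_cube0.
rewrite (_ : (fun k => _) = fun k => tensor_coef lambda phi k t); last first.
  by apply/funext => k; rewrite on_cubeE.
rewrite (_ : (fun w => _) = X^~ t); last first.
  by apply/funext => w; rewrite /field_on_cube on_cubeE.
have [_ _ _ _ [mX /(_ t ct) cX]] := fX.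
have mXt : measurable_fun setT (X^~ t) by exact: (measurableT_comp mX (pair2_measurable t)).
pose D J w := X w t - combination xi (fun k => tensor_coef lambda phi k t) J w.
have mD J : measurable_fun setT (D J).
  apply: measurable_funB => //; apply: measurable_sum => k.
  exact: measurable_funM.
have small e : 0 < e -> exists A : {fset multi_index d}, forall J : {fset multi_index d},
    (A `<=` J)%fset -> sqint P (D J) /\ dot P (D J) (D J) <= e.
  move=> e0.
  have /cX[A _ hA] : \forall x \near (0%E : \bar R), (x < e%:E)%E.
    by apply: open_ereal_lt'; rewrite lte_fin.
  exists A => J /hA/=; rewrite expectation.unlock => le_e.
  have lJ : sqint P (D J).
    split=> //; apply/integrableP; split; first exact/measurable_EFinP/measurable_funX.
    under eq_integral do rewrite /= ger0_norm ?sqr_ge0//.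
    by rewrite (lt_trans le_e)// ltry.
  by split=> //; rewrite -lee_fin EFin_dot// ltW.
have sc s : sqint P (combination xi (fun k => tensor_coef lambda phi k t) s).
  by apply: sqint_combination; exact: sqint_xi.
split.
  have [A /(_ _ (fsubset_refl A))[lA _]] := small 1 ltr01.
  rewrite (_ : X^~ t = fun w => D A w + combination xi (fun k => tensor_coef lambda phi k t) A w).
    exact: sqintD.
  by apply/funext => w; rewrite /D subrK.
by move=> e /small[A hA]; exists A => J /hA[].
Qed.

Lemma nth_Forall (A : Type) (p : A -> Prop) (s : seq A) (l : 'I_(size s)) :
  List.Forall p s -> p (tnth (in_tuple s) l).
Proof.
have H x0 i : List.Forall p s -> (i < size s)%N -> p (nth x0 s i).
  elim: s {l} i => [|x s IH] [|i]//= /List.Forall_cons_iff[px ps] si //.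
  exact: IH.
by move=> hs; rewrite (tnth_nth (tnth (in_tuple s) l)); exact: H.
Qed.

Lemma algorithm_of_seq (s : seq (d.-tuple (measurableTypeR R) * (d.-tuple (measurableTypeR R) -> R))) :
  List.Forall (fun p => cube p.1 /\ sqint Q p.2) s ->
  exists2 A : linear_algorithm R d, nb_points A = size s &
    forall f t, apply_algorithm A f t = \sum_(p <- s) f p.1 * p.2 t.
Proof.
move=> hs; pose nd l := (tnth (in_tuple s) l).1; pose wt l := (tnth (in_tuple s) l).2.
have cnd l : cube (nd l) by have [] := nth_Forall l hs.
have lwt l : wt l \in Lfun Q 2%:E.
  have [_ [mw iw]] := nth_Forall l hs.
  rewrite inE; apply/andP; split; rewrite inE//=.
  rewrite /finite_norm Lnorm.unlock; apply: poweR_lty.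
  under eq_integral do rewrite /= powR_mulrn// real_normK ?num_real//.
  by have [_] := integrableP _ _ _ iw; under eq_integral do rewrite /= ger0_norm ?sqr_ge0//.
exists (LinearAlgorithm cnd lwt) => // f t.
by rewrite /apply_algorithm [RHS]big_tnth.
Qed.

(** The residual of the field cut off outside the cube is, almost
    everywhere, the error of the algorithm on the field itself. *)
Lemma field_algorithm (J : {fset multi_index d}) (tau Lambda e eps : R) (n : nat) :
  (forall M, \sum_(k <- box d M | k \notin J) coef_prod k ^+ 2 <= tau) ->
  (forall M, \sum_(k <- box d M) coef_prod k ^+ 2 <= Lambda) ->
  Num.max (4 * tau) ((1 - (8 * #|` J|%:R)^-1) ^+ n * (2 * Lambda)) < e ->
  0 < eps ->
  exists2 A : linear_algorithm R d, (nb_points A <= n)%N &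
    (P [set w | eps%:E < L2_cube_norm (fun t => (X w t - apply_algorithm A (X w) t)%R)] <=
      (expR (5 - eps ^+ 2 / (96 * e)))%:E)%E.
Proof.
move=> htau hL lt_e eps0.
have [s [sn hs ls le_s]] := @greedy_expansion _ _ _ _ _ P Q _ xi (box d) field_on_cube coef_prod
  (fun k => on_cube (basis phi k)) (@cube R d) J tau Lambda n
  sqint_xi dot_xi (@box_sub d) (@box_exhaust d) measurable_field_on_cube
  (fun k => sqint_on_cube (sqint_basis ophi k))
  (fun k j => etrans (dot_on_cube (sqint_basis ophi k) (sqint_basis ophi j)) (dot_basis ophi k j))
  mean_square_sum_field_on_cube (fun t ct w => on_cube0 (X w) ct) htau hL.
have [A nA hA] := algorithm_of_seq hs; exists A; first by rewrite nA.
have [_ _ _ _ [mX _]] := fX.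
have resE w t : cube t -> residual field_on_cube s w t = X w t - apply_algorithm A (X w) t.
  move=> ct; rewrite hA /residual /field_on_cube on_cubeE//; congr (_ - _).
  elim: (s) hs => [|p s' IH] hs'; first by rewrite !big_nil.
  case/List.Forall_cons_iff: hs' => -[cp _] hs''.
  by rewrite !big_cons on_cubeE// IH.
have ms w : measurable_fun setT (fun t => X w t - apply_algorithm A (X w) t).
  apply: measurable_funB; first exact: (measurableT_comp mX (pair1_measurable w)).
  rewrite /apply_algorithm; apply: measurable_sum => l; apply: measurable_funM => //.
  have := weight_L2 l; rewrite inE => /andP[]; by rewrite inE.
have -> : [set w | eps%:E < L2_cube_norm (fun t => (X w t - apply_algorithm A (X w) t)%R)]%E =
    [set w | (eps ^+ 2)%:E < \int[Q]_t (residual field_on_cube s w t ^+ 2)%:E]%E.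
  apply/funext => w /=; congr (_ : Prop); rewrite L2_norm_gt//; congr (_ < _)%E.
  apply: ae_eq_integral => //.
  - exact/measurable_EFinP/measurable_funX.
  - apply/measurable_EFinP/measurable_funX; exact: (measurable_slice ls).
  - by apply: filterS (@ae_cube R d) => t ct _; rewrite resE.
apply: (L2_tail ls); rewrite ?sqr_ge0//.
- move=> t; have [gxi _ _ _ _] := fX.
  by have := @residual_gaussian _ _ _ _ _ P _ xi sqint_xi field_on_cube _ s t gxi mean_square_sum_field_on_cube.
- exact: le_lt_trans lt_e.
Qed.

End field.

(** * Choice of the parameters *)

(** For large i the equivalence gives lambda(i) at most twice its model,
    in which ln (i + 1) is comparable to 1 + ln (i + 1); the constant takes
    care of the other i. *)
Lemma sqr_le_decay (R : realType) (lambda : nat -> R) (mu r q : R) : 0 < mu -> 0 < r ->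
  (forall i, 0 <= lambda i) ->
  lambda ~_\oo (fun i => mu * i.+1%:R `^ (- r) * ln i.+1%:R `^ q) ->
  exists2 C : R, 0 < C & forall i, lambda i ^+ 2 <= C * decay (q / r) i `^ (2 * r).
Proof.
move=> mu0 r0 l0 equ; pose g i : R := mu * i.+1%:R `^ (- r) * ln i.+1%:R `^ q.
have g0 i : 0 <= g i by rewrite !mulr_ge0 ?powR_ge0 ?ltW.
have [N0 _ hN0] : \forall i \near \oo, lambda i <= 2 * g i.
  have := (eqaddoP _ _ _ _).1 equ 1 ltr01; apply: filterS => i /=.
  rewrite mul1r (ger0_norm (g0 i)) => h.
  have : lambda i - g i <= g i by apply: le_trans h; exact: ler_norm.
  rewrite lerBlDr; lra.
have hE i : decay (q / r) i `^ (2 * r) = lg i.+1%:R `^ (2 * q) * i.+1%:R `^ (- (2 * r)).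
  have i1 : 1 <= i.+1%:R :> R by rewrite ler1n.
  rewrite /decay powRM ?powR_ge0 ?invr_ge0//; congr (_ * _).
    by rewrite -powRrM; congr (_ `^ _); field; rewrite gt_eqF.
  by rewrite -powR_inv1 ?ler0n// -powRrM mulN1r.
pose N := maxn N0 1; pose K : R := 4 * mu ^+ 2 * 3 `^ `|2 * q|.
have h0 i : 0 < decay (q / r) i `^ (2 * r) by rewrite powR_gt0// decay_gt0.
have K0 : 0 < K by rewrite !mulr_gt0 ?exprn_gt0 ?powR_gt0.
pose S := \sum_(i < N) lambda i ^+ 2 / decay (q / r) i `^ (2 * r).
have S0 : 0 <= S by apply: sumr_ge0 => i _; rewrite divr_ge0 ?sqr_ge0 ?ltW.
exists (K + S) => [|i]; first by rewrite ltr_wpDr.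
have [iN|Ni] := ltnP i N.
  rewrite -ler_pdivrMr//; apply: (@le_trans _ _ S); last by rewrite lerDr ltW.
  rewrite /S (bigD1 (Ordinal iN))//= lerDl; apply: sumr_ge0 => j _.
  by rewrite divr_ge0 ?sqr_ge0 ?ltW.
apply: (@le_trans _ _ (K * decay (q / r) i `^ (2 * r))); last first.
  by rewrite ler_wpM2r ?(ltW (h0 i))// lerDl.
move: Ni; rewrite geq_max => /andP[N0i i3].
have li := hN0 i N0i.
have ln_ge : 1 / 2 <= ln i.+1%:R :> R.
  have i2 : 2 <= i.+1%:R :> R by rewrite ler_nat.
  have := @ln_ratio_ge R i.+1%:R 1 (ltr0Sn _ _) ltr01; rewrite divr1.
  by apply: le_trans; rewrite ler_pdivlMr; move: (i.+1%:R : R) i2 => z; lra.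
apply: (@le_trans _ _ ((2 * g i) ^+ 2)).
  by rewrite ler_sqr ?nnegrE ?l0 ?(mulr_ge0 _ (g0 i)).
have -> : (2 * g i) ^+ 2 = 4 * mu ^+ 2 * i.+1%:R `^ (- (2 * r)) * ln i.+1%:R `^ (2 * q).
  rewrite /g (_ : 2 * q = q * 2%:R) 1?mulrC// (_ : - (2 * r) = - r * 2%:R); last by ring.
  rewrite !(powRrM _ _ 2%:R) !powR_mulrn ?powR_ge0//; ring.
rewrite hE /K; have : ln i.+1%:R `^ (2 * q) <= 3 `^ `|2 * q| * lg i.+1%:R `^ (2 * q) :> R.
  by apply: powR_comparable; rewrite /lg; lra.
move=> le_ln; rewrite -!mulrA !ler_pM2l ?exprn_gt0//.
by rewrite mulrC mulrA ler_wpM2r ?powR_ge0.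
Qed.

Section parameters.
Variables (R : realType) (n : nat) (alpha p C0 : R) (lam2 : nat -> R).
Hypotheses (alpha_neq : alpha != -1) (p1 : 1 < p) (C00 : 0 < C0)
  (lam2_ge0 : forall i, 0 <= lam2 i)
  (lam2_le : forall i, lam2 i <= C0 * decay alpha i `^ p).
Local Notation s := (n%:R * Num.max (1 + alpha) 0).
Local Notation coef2 k := (\prod_(l < n.+1) lam2 (k l)).

(** With v = exp (- L), this is the claimed order of the number of points,
    with beta = alpha + s and p = 2 r. *)
Definition cost (L : R) : R :=
  expR (2 / (p - 1) * L) * `|L| `^ ((p * (alpha + s + 1) - 1) / (p - 1)).

Variables (theta Lambda : R).
Hypotheses (theta_gt0 : 0 < theta) (Lambda_gt0 : 0 < Lambda).

(** J and m make the error bound of [greedy_expansion] at most a multiple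
    of v^2, where v = exp (- L). *)
Definition suited (L : R) (J : {fset multi_index n.+1}) (m : nat) : Prop :=
  (forall M, \sum_(k <- box n.+1 M | k \notin J) coef2 k <= theta * expR (- (2 * L))) /\
  (1 - (8 * #|` J|%:R)^-1) ^+ m * (2 * Lambda) <= theta * expR (- (2 * L)).

Lemma suited_le L L' J m : L' <= L -> suited L J m -> suited L' J m.
Proof.
move=> le_L [h1 h2]; have le_e : expR (- (2 * L)) <= expR (- (2 * L')) by rewrite ler_expR; lra.
by split=> [M|]; [apply: le_trans (h1 M) _|apply: le_trans h2 _]; rewrite ler_pM2l.
Qed.

Lemma log_absorbed (k a c : R) : 0 <= k -> 0 <= a -> 0 < c -> exists2 L0 : R, 1 <= L0 &
  forall L, L0 <= L -> k + a * `|ln L| <= c * L.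
Proof.
move=> k0 a0 c0; pose M := (k + 3 * a) / c.
have M0 : 0 <= M by rewrite divr_ge0 ?addr_ge0 ?mulr_ge0 ?(ltW c0).
exists (1 + M ^+ 2); first by rewrite lerDl sqr_ge0.
move=> L LM; have L1 : 1 <= L by apply: le_trans LM; rewrite lerDl sqr_ge0.
have L0 : 0 <= L by lra.
have lnL : 0 <= ln L by rewrite ln_ge0.
have lnL3 : ln L <= 3 * Num.sqrt L.
  have := @lg_le_powR R 2^-1 L; rewrite invrK powR12_sqrt// /lg => /(_ _ L1).
  by rewrite invr_gt0 ltr0n => /(_ isT); lra.
have sL : Num.sqrt L ^+ 2 = L by rewrite sqr_sqrtr.
have s1 : 1 <= Num.sqrt L by rewrite -[X in X <= _]sqrtr1 ler_sqrt// ltr0n.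
have sM : M <= Num.sqrt L.
  by rewrite -(ger0_norm M0) -sqrtr_sqr ler_wsqrtr// (le_trans _ LM)// lerDr.
rewrite (ger0_norm lnL) -[in c * L]sL.
have : M * c <= Num.sqrt L * c by rewrite ler_pM2r.
rewrite /M divfK ?gt_eqF//; move: (Num.sqrt L) s1 lnL3 => z z1 lz hz.
have := ler_wpM2l a0 lz; have : k * 1 <= k * z by rewrite ler_wpM2l.
rewrite expr2 mulrA => h1 h2.
have : (k + 3 * a) * z <= z * c * z by rewrite ler_wpM2r//; lra.
lra.
Qed.

(** Choose x so that the bound of [tail_cross], with L put for lg x up to a
    constant, is theta v^2; then ln x is of order L, whence the powers of L in the tail, in the size
    of the cross and in the number of steps. *)
Lemma suited_small : exists L0 C : R, [/\ 1 <= L0, 0 < C &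
  forall L, L0 <= L -> exists J m, suited L J m /\ m%:R <= C * cost L].
Proof.
have [Cc Cc0 hc] := card_cross n alpha_neq.
have [Ct Ct0 ht] := tail_cross n alpha_neq p1 C00 lam2_ge0 lam2_le.
have p10 : 0 < p - 1 by rewrite subr_gt0.
pose b := alpha * p + s; pose a := b / (p - 1); pose c := (p - 1)^-1.
have c0 : 0 < c by rewrite invr_gt0.
pose D := p - 1 + (3 * c + 1).
have D1 : 1 <= D by rewrite /D; lra.
pose E := Ct * D `^ `|b| / theta.
have E0 : 0 < E by by rewrite divr_gt0// mulr_gt0 ?powR_gt0//; lra.
pose k := c * ln E.
have [L0 L01 hL0] := log_absorbed (addr_ge0 (normr_ge0 k) ler01) (normr_ge0 a) c0.
exists L0.
pose F := `|ln (2 * Lambda / theta)| + 2.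
pose C := (8 * F + 1) * Cc * D `^ `|s| * expR k.
have F0 : 0 < F by rewrite ltr_wpDl.
exists C; split=> // [|L LL0].
  rewrite !mulr_gt0 ?powR_gt0 ?expR_gt0//; lra.
have L1 : 1 <= L by exact: le_trans LL0.
have Lgt0 : 0 < L by lra.
have := hL0 _ LL0; set lnL := ln L => hL.
(* exp ((1 - p) y) L^b = exp (- 2 L) / E, and E absorbs the constants *)
pose y := k + 2 * c * L + a * lnL; pose x := expR y.
have /andP[y1 y2] : c * L <= y <= 3 * c * L.
  have := ler_norm (- (a * lnL)); have := ler_norm (a * lnL).
  rewrite normrN normrM; have := ler_norm k; have := ler_norm (- k).
  rewrite normrN /y -(mulrA 2) -(mulrA 3).
  move: (`|a| * `|lnL|) (a * lnL) (c * L) hL => u1 u2 u3 *.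
  by apply/andP; split; lra.
have cL : 0 < c * L by rewrite mulr_gt0.
have x1 : 1 <= x by rewrite /x -[X in X <= _]expR0 ler_expR; lra.
have lgx : lg x = 1 + y by rewrite /lg /x expRK.
have lgx0 : 0 < lg x by rewrite lgx; lra.
have lgL : lg x <= D * L.
  rewrite lgx /D; have : (p - 1) * L >= 0 by rewrite mulr_ge0// ltW.
  lra.
have Llg : L <= D * lg x.
  rewrite lgx /D mulrDl.
  have : (p - 1) * (c * L) <= (p - 1) * (1 + y) by rewrite ler_pM2l//; lra.
  rewrite mulrA /c divff ?gt_eqF// mul1r.
  have : 0 <= (3 * c + 1) * (1 + y) by rewrite mulr_ge0//; lra.
  rewrite /c; lra.
have [J hJ] := exists_cross alpha n x1.
(* an empty J would leave (1 - 1/0)^m = 1, inverses of 0 being 0 *)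
have J1 : (1 <= #|` J|)%N.
  rewrite cardfs_gt0; apply/fset0Pn; exists [ffun=> 0%N].
  rewrite hJ; apply/existsP; exists ord0; apply/andP; split.
    by apply/forallP => j; rewrite ffunE.
  rewrite ffunE big1 ?mulr1// => j _.
  by rewrite ffunE /decay /lg ln1 addr0 powR1 divr1.
have J0 : 0 < #|` J|%:R :> R by rewrite ltr0n.
have GF : ln (2 * Lambda / theta) + 2 * L <= F * L.
  rewrite /F; have := ler_norm (ln (2 * Lambda / theta)).
  move: (ln (2 * Lambda / theta)) => z hz.
  by have := ler_wpM2l (normr_ge0 z) L1; rewrite mulr1; lra.
pose m := (Num.truncn (8 * #|` J|%:R * (F * L))).+1.
have Lb z : L `^ z = expR (z * lnL) by rewrite /powR gt_eqF.
have xb z : x `^ z = expR (z * y) by rewrite /powR gt_eqF ?expR_gt0// /x expRK.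
exists J, m; split; first split.
- move=> M; apply: (le_trans (ht x J x1 hJ M)).
  apply: (@le_trans _ _ (Ct * (x `^ (1 - p) * (D `^ `|b| * L `^ b)))).
    rewrite ler_pM2l// ler_wpM2l ?powR_ge0//.
    by apply: powR_comparable.
  rewrite le_eqVlt; apply/orP; left; apply/eqP.
  have yE : (1 - p) * y = - ln E + - (2 * L) + - (b * lnL).
    by rewrite /y /k /a /c; field; rewrite gt_eqF.
  rewrite xb Lb yE !expRD !expRN lnK ?posrE// /E.
  field; rewrite !gt_eqF ?expR_gt0// powR_gt0//; lra.
- have u1 : 0 <= 1 - (8 * #|` J|%:R)^-1 :> R.
    rewrite subr_ge0 invf_le1 ?mulr_gt0//.
    have : 1 <= #|` J|%:R :> R by rewrite ler1n.
    lra.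
  apply: (@le_trans _ _ (expR (- (8 * #|` J|%:R)^-1) ^+ m * (2 * Lambda))).
    rewrite ler_pM2r ?mulr_gt0// lerXn2r ?nnegrE ?expR_ge0//.
    exact: expR_ge1Dx.
  rewrite -expRM_natl.
  apply: (@le_trans _ _ (expR (- (ln (2 * Lambda / theta) + 2 * L)) * (2 * Lambda))).
    rewrite ler_pM2r ?mulr_gt0// ler_expR mulrN lerN2 (le_trans GF)//.
    rewrite ler_pdivlMr ?mulr_gt0// mulrC.
    by rewrite ltW// truncnS_gt.
  rewrite opprD expRD (expRN (ln _)) lnK ?posrE ?divr_gt0 ?mulr_gt0//.
  rewrite le_eqVlt; apply/orP; left; apply/eqP; field.
  by rewrite !gt_eqF.
- apply: (@le_trans _ _ ((8 * F + 1) * (#|` J|%:R * L))).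
    rewrite /m -(natr1 (Num.truncn _)).
    have J1' : 1 <= #|` J|%:R :> R by rewrite ler1n.
    have h1 : 1 <= #|` J|%:R * L by rewrite -[X in X <= _]mulr1 ler_pM.
    have h2 : (Num.truncn (8 * #|` J|%:R * (F * L)))%:R <= 8 * #|` J|%:R * (F * L).
      by rewrite truncn_le mulr_ge0 ?mulr_ge0 ?ler0n ?(ltW F0) ?(ltW Lgt0).
    rewrite (mulrDl (8 * F)) mul1r lerD//.
    by apply: (le_trans h2); rewrite le_eqVlt; apply/orP; left; apply/eqP; ring.
  rewrite /C -4!mulrA ler_pM2l; last by lra.
  apply: (@le_trans _ _ (Cc * (x * (D `^ `|s| * L `^ s)) * L)).
    rewrite ler_pM2r//; apply: (le_trans (hc x J x1 hJ)).
    rewrite ler_pM2l// ler_pM2l ?expR_gt0//.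
    by apply: powR_comparable.
  rewrite le_eqVlt; apply/orP; left; apply/eqP.
  have -> : cost L = expR (2 * c * L) * (L `^ a * L `^ s * L).
    rewrite /cost (ger0_norm (ltW Lgt0)) /c; congr (_ * _).
    have -> : (p * (alpha + s + 1) - 1) / (p - 1) = a + s + 1.
      by rewrite /a /b; field; rewrite gt_eqF.
    by rewrite !powRD ?(gt_eqF Lgt0) ?implybT// powRr1 ?ltW.
  rewrite /x /y !expRD !Lb; ring.
Qed.

(** Beyond L0 this is [suited_small]. For L <= - L1 the total variance is
    already small enough for zero steps. In between the choice made for L0
    remains suited, and the cost is bounded below, |L| being bounded and
    bounded away from 0. *)
Lemma exists_suited (delta : R) :
  (forall M, \sum_(k <- box n.+1 M) coef2 k <= Lambda) -> 0 < delta ->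
  exists2 C : R, 0 < C & forall L, delta <= `|L| ->
    exists J m, suited L J m /\ m%:R <= C * cost L.
Proof.
move=> hLam delta0; have [L0 [C [L01 C0' hC]]] := suited_small.
have p10 : 0 < p - 1 by rewrite subr_gt0.
have c0 : 0 <= 2 / (p - 1) by rewrite divr_ge0// ltW.
have [J0 [m0 [s0 _]]] := hC _ (lexx L0).
(* beyond - L1, exp (- 2 L) >= 2 L1 *)
pose L1 := Lambda / theta; have L1gt : 0 < L1 by rewrite divr_gt0.
pose D := 1 + delta^-1 + L0 + L1; have di : 0 < delta^-1 by rewrite invr_gt0.
pose kappa := (p * (alpha + s + 1) - 1) / (p - 1).
pose C1 := m0%:R * D `^ `|kappa| * expR (2 / (p - 1) * L1).
have C1ge : 0 <= C1 by rewrite !mulr_ge0 ?ler0n ?powR_ge0 ?expR_ge0.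
exists (C + C1) => [|L dL]; first by rewrite ltr_wpDr.
have cost0 : 0 <= cost L by rewrite mulr_ge0 ?expR_ge0 ?powR_ge0.
have [LL0|LL0] := leP L0 L.
  have [J [m [hs hm]]] := hC _ LL0; exists J, m; split=> //.
  by rewrite (le_trans hm)// ler_wpM2r// lerDl.
have [LL1|LL1] := leP L (- L1).
  have big : 2 * Lambda <= theta * expR (- (2 * L)).
    have -> : 2 * Lambda = theta * (2 * L1) by rewrite /L1; field; rewrite gt_eqF.
    by rewrite ler_pM2l//; apply: (le_trans _ (expR_ge1Dx _)); lra.
  exists fset0, 0%N; split; last by rewrite mulr_ge0// addr_ge0// ltW.
  split; last by rewrite expr0 mul1r.
  move=> M; apply: le_trans big; under eq_bigl do rewrite in_fset0.
  by apply: le_trans (hLam M) _; rewrite ler_peMl ?(ltW Lambda_gt0)// (ler_nat _ 1).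
exists J0, m0; split; first exact: suited_le (ltW LL0) s0.
apply: (@le_trans _ _ (C1 * cost L)); last by rewrite ler_wpM2r// lerDr ltW.
have absL : `|L| <= L0 + L1 by rewrite ler_norml; apply/andP; split; lra.
have D1 : 1 <= D * `|L|.
  apply: (@le_trans _ _ (delta^-1 * delta)); first by rewrite mulVf ?gt_eqF.
  by apply: ler_pM; rewrite ?(ltW di) ?(ltW delta0)// /D; lra.
have key : 1 <= D `^ `|kappa| * `|L| `^ kappa.
  rewrite [leLHS](_ : 1 = 1 `^ kappa); last by rewrite powR1.
  apply: powR_comparable => //.
  - exact: lt_le_trans dL.
  - by rewrite /D; lra.
  - by rewrite mulr1 /D; lra.
rewrite /cost -/kappa /C1.
have e1 : 1 <= expR (2 / (p - 1) * L1) * expR (2 / (p - 1) * L).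
  rewrite -expRD -mulrDr -[X in X <= _]expR0 ler_expR mulr_ge0//; lra.
have := ler_pM ler01 ler01 key e1; rewrite mulr1 => h.
have := ler_wpM2l (ler0n R m0) h; rewrite mulr1 => /le_trans; apply.
by rewrite le_eqVlt; apply/orP; left; apply/eqP; ring.
Qed.

End parameters.

Lemma sum_box_le (R : realType) (d : nat) (lam2 : nat -> R) (A : R) M :
  (forall i, 0 <= lam2 i) -> \sum_(i < M) lam2 i <= A ->
  \sum_(k <- box d M) \prod_(l < d) lam2 (k l) <= A ^+ d.
Proof.
move=> l0 hA; rewrite (@big_box d R M xpredT).
under eq_bigr => k _ do under eq_bigr do rewrite index_ofE.
rewrite -(bigA_distr_bigA (fun (_ : 'I_d) (i : 'I_M) => lam2 i)) prodr_const card_ord.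
by rewrite lerXn2r ?nnegrE ?(le_trans _ hA) ?sumr_ge0.
Qed.

(** With l = |ln gamma|, eps^2 / (96 e) = 5 (1 + sqrt (2 l))^2 is at least
    5 + 10 l; the factor 5 serves to dominate the additive 5. *)
Lemma tail_le_gamma (R : realType) (eps gamma v : R) : 0 < eps -> 0 < gamma < 1 ->
  v = eps / (1 + Num.sqrt (2 * `|ln gamma|)) ->
  expR (5 - eps ^+ 2 / (96 * (v ^+ 2 / (5 * 96)))) <= gamma.
Proof.
move=> eps0 /andP[g0 g1] ->; set t := Num.sqrt _.
have lg0 : ln gamma < 0 by rewrite -ln1 ltr_ln ?posrE.
have t0 : 0 <= t by exact: sqrtr_ge0.
have t2 : t ^+ 2 = - (2 * ln gamma).
  by rewrite sqr_sqrtr ?mulr_ge0// ltr0_norm// mulrN.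
have -> : eps ^+ 2 / (96 * ((eps / (1 + t)) ^+ 2 / (5 * 96))) = 5 * (1 + t) ^+ 2.
  by field; rewrite !gt_eqF//; lra.
rewrite -[leRHS]lnK ?posrE// ler_expR; nra.
Qed.

Lemma beta_exponentE (R : realType) (n : nat) (alpha : R) :
  beta_exponent n.+1 alpha = alpha + n%:R * Num.max (1 + alpha) 0.
Proof.
rewrite /beta_exponent; have [ha|ha] := ltP (-1) alpha.
  by rewrite (max_idPl _) -?natr1; [ring|lra].
by rewrite (max_idPr _) ?mulr0; [ring|lra].
Qed.

Theorem proposition5p1 (R : realType) (d : nat)
    (lambda : nat -> R) (phi : nat -> R -> R) (mu r q : R)
    (d_ge1 : (1 <= d)%N)
    (phi_orthonormal : orthonormal_L2_01 phi)
    (kernel_cvg : forall s t : R, 0 <= s <= 1 -> 0 <= t <= 1 ->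
       cvgn (kernel_series lambda phi s t))
    (lambda_ge0 : forall i, 0 <= lambda i)
    (mu_gt0 : 0 < mu) (r_gt_half : 1 / 2 < r) (q_neq : q != - r)
    (lambda_equiv : lambda ~_\oo
       (fun i => mu * i.+1%:R `^ (- r) * ln i.+1%:R `^ q))
    (delta : R) (delta_gt0 : 0 < delta) :
  exists2 C : R, 0 < C &
    forall (disp : measure_display) (Omega : measurableType disp)
      (P : probability Omega R) (xi : multi_index d -> {RV P >-> R})
      (X : Omega -> d.-tuple (measurableTypeR R) -> R),
      is_tensor_field lambda phi xi X ->
    forall eps gamma : R, 0 < eps -> 0 < gamma < 1 ->
    let v := eps / (1 + Num.sqrt (2 * `|ln gamma|)) in
    delta <= `|ln v| ->
    exists A : linear_algorithm R d,
      (P [set w | (eps%:E < L2_cube_norm (fun t => (X w t - apply_algorithm A (X w) t)%R))%E]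
         <= gamma%:E)%E /\
      (nb_points A)%:R <=
        C * (v ^+ 2 * `|ln v| `^ (1 - 2 * r * (beta_exponent d (q / r) + 1)))
              `^ (- (2 * r - 1)^-1).

Proof.
case: d d_ge1 => // n _.
have r0 : 0 < r by lra.
have p1 : 1 < 2 * r by lra.
have a_neq : q / r != -1.
  by apply: contraNneq q_neq => h; apply/eqP; rewrite -[q](divfK (lt0r_neq0 r0)) h mulN1r.
have [C0 C00 hC0] := sqr_le_decay mu_gt0 r0 lambda_ge0 lambda_equiv.
have l2 i : 0 <= lambda i ^+ 2 by exact: sqr_ge0.
have [A A0 hA] := sum_lam2_le p1 C00 hC0.
have L0 : 0 < A ^+ n.+1 by exact: exprn_gt0.
have [c c0 cE] : exists2 c : R, 0 < c & c = (5 * 96)^-1.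
  by eexists; [|reflexivity]; rewrite invr_gt0 mulr_gt0.
(* any theta below c / 4 would do *)
have theta0 : 0 < c / 8 by rewrite divr_gt0.
have hLam M : \sum_(k <- box n.+1 M) \prod_(l < n.+1) lambda (k l) ^+ 2 <= A ^+ n.+1.
  exact: (sum_box_le _ l2 (hA M)).
have [C Cgt hC] := exists_suited a_neq p1 C00 l2 hC0 theta0 L0 hLam delta_gt0.
exists C => // disp Omega P xi X fX eps gamma eps0 hgamma v hv.
have v0 : 0 < v by rewrite divr_gt0// ltr_wpDr// sqrtr_ge0.
have v2 : v ^+ 2 = expR (- (2 * - ln v)).
  by rewrite mulrN opprK expRM_natl lnK.
have [|J [m [[htau hm] le_m]]] := hC (- ln v); first by rewrite normrN.
have coefE k : coef_prod lambda k ^+ 2 = \prod_(l < n.+1) lambda (k l) ^+ 2.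
  by rewrite /coef_prod prodrXl.
have [] := @field_algorithm _ _ _ P _ lambda phi xi X phi_orthonormal fX J
  (c / 8 * v ^+ 2) (A ^+ n.+1) (v ^+ 2 * c) eps m _ _ _ eps0.
- by move=> M; under eq_bigr do rewrite coefE; rewrite v2.
- by move=> M; under eq_bigr do rewrite coefE.
- have cv : 0 < v ^+ 2 * c by rewrite mulr_gt0 ?exprn_gt0.
  rewrite gt_max; apply/andP; split; last apply: (le_lt_trans hm); rewrite -?v2; lra.
move=> B Bm hB; exists B; split.
  by apply: (le_trans hB); rewrite lee_fin cE (@tail_le_gamma _ _ gamma).
apply: (@le_trans _ _ m%:R); first by rewrite ler_nat.
apply: (le_trans le_m); rewrite ler_pM2l// le_eqVlt; apply/orP; left; apply/eqP.
rewrite /cost normrN powRM ?powR_ge0 ?sqr_ge0//; have p10 : 2 * r - 1 != 0 by rewrite gt_eqF// subr_gt0.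
congr (_ * _).
  by rewrite v2 /powR gt_eqF ?expR_gt0// expRK; congr expR; ring.
rewrite -powRrM beta_exponentE; congr (_ `^ _).
by field; rewrite p10 gt_eqF.
Qed.
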